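(* Let $\mathrm{T}$ be a bounded linear operator on $L^2(\mathbb{D})$, let $\mathrm{P}:L^2(\mathbb{D})\to L^2(\mathbb{D})$ be the orthogonal projection onto $A^2(\mathbb{D})$, and let $Q=\mathscr{Q}[\mathrm{T}]$. Then for every $f\in L^2(\mathbb{D})$, $$\mathrm{P}\mathrm{T}\bar{\mathrm{P}}f(z)=\int_{\mathbb{D}}\partial_z\partial_wQ(z,w)\,f(w)\,\mathrm{dA}(w),\qquad z\in\mathbb{D}.$$
   Context: $\mathbb{D}$ is the open unit disk, $\mathrm{dA}=\mathrm{d}x\,\mathrm{d}y/\pi$, $L^2(\mathbb{D})=L^2(\mathbb{D},\mathrm{dA})$ with inner product $\langle f,g\rangle_{\mathbb{D}}=\int_{\mathbb{D}}f\bar g\,\mathrm{dA}$, and $A^2(\mathbb{D})$ is the Bergman space of holomorphic functions in $L^2(\mathbb{D})$. $\bar{\mathrm{P}}$ is given by $\bar{\mathrm{P}}f=\overline{\mathrm{P}\bar f}$, i.e. the orthogonal projection onto the space of complex conjugates of functions in $A^2(\mathbb{D})$. For $z\in\mathbb{D}$ let $s_z(\zeta)=(1-\bar z\zeta)^{-1}$, and let $\bar s_z$ be its complex conjugate. The Dirichlet operator symbol of $\mathrm{T}$ is the holomorphic function on the bidisk $\mathbb{D}^2$ $$\mathscr{Q}[\mathrm{T}](z,w)=zw\,\langle\mathrm{T}(\bar s_w),s_z\rangle_{\mathbb{D}}.$$ *)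

(* Defs.v *)
From HB Require Import structures.
From mathcomp Require Import all_boot all_order all_algebra.
From mathcomp Require Import complex.
From mathcomp Require Import all_classical all_reals all_analysis.

Set Implicit Arguments.
Unset Strict Implicit.
Unset Printing Implicit Defensive.

Import Order.TTheory GRing.Theory Num.Theory.
Import numFieldNormedType.Exports.

Local Open Scope classical_set_scope.
Local Open Scope ring_scope.
Local Open Scope complex_scope.

(* [R[i]] as a numFieldType, hence with its norm topology and as a normed module
   over itself: [derivable] and [derive1] for functions [CC R -> CC R] are about
   complex differentiability. *)
Definition CC (R : realType) : numFieldType := R[i].

Section BergmanSpace.
Context {R : realType}.
Local Notation C := (CC R).
Local Notation plane := (measurableTypeR R * measurableTypeR R)%type.
Local Notation Re := complex.Re.
Local Notation Im := complex.Im.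
Implicit Types (f g : C -> C) (z w : C).

Definition unit_disk : set C := [set z | `|z| < 1].

Definition of_xy (p : plane) : C := p.1 +i* p.2.

Definition dA : {measure set plane -> \bar R} :=
  mscale (NngNum (eqbRL (invr_ge0 pi) (pi_ge0 R)))
    (lebesgue_measure \x lebesgue_measure)%E.

Definition disk_xy : set plane := of_xy @^-1` unit_disk.

Definition disk_integrable f : Prop :=
  dA.-integrable disk_xy (fun p => (Re (f (of_xy p)))%:E) /\
  dA.-integrable disk_xy (fun p => (Im (f (of_xy p)))%:E).

Definition disk_integral f : C :=
  Rintegral dA disk_xy (fun p => Re (f (of_xy p))) +i*
  Rintegral dA disk_xy (fun p => Im (f (of_xy p))).

Definition conjf f : C -> C := fun z => conjc (f z).

(* A class of L^2(D) is represented by any of its members: [L2] says that [f] is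
   a representative, [L2_eq] that two representatives have the same class.
   The values of a representative outside of the disk are irrelevant. *)
Definition L2 f : Prop :=
  [/\ measurable_fun disk_xy (fun p => Re (f (of_xy p))),
      measurable_fun disk_xy (fun p => Im (f (of_xy p))) &
      (\int[dA]_(p in disk_xy) (Normc.normc (f (of_xy p)) ^+ 2)%:E < +oo)%E].

Definition L2_eq f g : Prop := ae_eq dA disk_xy (f \o of_xy) (g \o of_xy).

Definition L2_dot f g : C := disk_integral (fun z => f z * conjc (g z)).

Definition L2_norm f : R :=
  Num.sqrt (Rintegral dA disk_xy (fun p => Normc.normc (f (of_xy p)) ^+ 2)).

Definition bounded_linear_operator (T : (C -> C) -> C -> C) : Prop :=
  [/\ forall f, L2 f -> L2 (T f),
      forall f g, L2 f -> L2 g -> L2_eq f g -> L2_eq (T f) (T g),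
      forall (a : C) f g, L2 f -> L2 g ->
        L2_eq (T (a *: f + g)) (a *: T f + T g) &
      exists M : R, forall f, L2 f -> L2_norm (T f) <= M * L2_norm f].

Definition holomorphic_on_disk f : Prop :=
  forall z, unit_disk z -> derivable f z 1.

Definition A2 : set (C -> C) := [set f | L2 f /\ holomorphic_on_disk f].

(* [P f] is required to be a representative of the projection that lies in [V]
   itself. For [V := A2] it is the holomorphic one, whose values at the points
   of the disk are determined by the class of [f]. *)
Definition orthogonal_projection (V : set (C -> C)) (P : (C -> C) -> C -> C) :
    Prop :=
  forall f, L2 f -> V (P f) /\ forall g, V g -> L2_dot (f - P f) g = 0.

Definition conj_op (P : (C -> C) -> C -> C) : (C -> C) -> C -> C :=
  fun f => conjf (P (conjf f)).

Definition szego z : C -> C := fun zeta => (1 - conjc z * zeta)^-1.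

Definition dirichlet_symbol (T : (C -> C) -> C -> C) z w : C :=
  z * w * L2_dot (T (conjf (szego w))) (szego z).

Definition partial_z (Q : C -> C -> C) z w : C := derive1 (fun z' => Q z' w) z.

Definition partial_w (Q : C -> C -> C) z w : C := derive1 (fun w' => Q z w') w.

End BergmanSpace.

(* Main.v *)
(* Write K_z(x) = (1 - conj(z) x)^-2 for the Bergman kernel.  Differentiating
   under the bounded functionals <T(.), g> and <g, .> gives
   d_z d_w Q(z,w) = <T (conj K_w), K_z>.  As <P T g, K_z> = P T g (z), the formula
   states, for the functional L = <T(.), K_z>, that L (conj P f) is the integral
   of w |-> L (conj K_w) against f.

   The reproducing property <g, K_z> = g(z) of g in A2 comes from Cauchy's formula
   on circles, which follows from Goursat's bisection argument applied to the
   pull-back of k(x) dx / (x - l) along a contraction of the circle to l.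
   Averaging over rotations, it turns <g, (1 - conj(z) x)^-1> into the integral of
   g(z |x|^2) over the disk, that is of g(z s) over s in [0,1] since |x|^2 is
   uniformly distributed; multiplying by z gives the primitive of g, whose
   derivative is <g, K_z>.

   For f supported in a smaller disk, K_w is a uniform limit of finite sums of
   products, and L commutes with the integral.  Taking f = conj H on a smaller
   disk, with H w = L (conj K_w), bounds the norm of H there by that of L, so H is
   square-integrable, and truncating f gives the general case. *)
From HB Require Import structures.
From mathcomp Require Import all_boot all_order all_algebra.
From mathcomp Require Import complex.
From mathcomp Require Import all_classical all_reals all_analysis.
From mathcomp Require Import measurable_realfun.
From mathcomp Require Import ring lra.
Require Import Defs.

Set Implicit Arguments.
Unset Strict Implicit.
Unset Printing Implicit Defensive.

Import Order.TTheory GRing.Theory Num.Theory.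
Import numFieldNormedType.Exports.

Local Open Scope classical_set_scope.
Local Open Scope ring_scope.
Local Open Scope complex_scope.

(** * Complex numbers *)

(** The disk integral cannot be read as a norm-convergent integral of the vectors
    [conjf (bergman_kernel w)]: their L2 norm is 1 / (1 - |w|^2), which is not square-integrable
    over the disk, so for a general [f] in L2 a bounded operator does not simply pass under the
    integral sign. On a disk of radius r < 1 these vectors are bounded, which settles truncated [f].
    The uniformity needed for the limit comes from duality: writing H_r for the truncation of H,
    testing the truncated formula on the conjugate of H_r gives |H_r|^2 <= M |H_r| in L2 norm, with
    M independent of r because the projection does not increase norms.

    Membership in [A2] asserts only complex differentiability at each point. The derivative is not
    known to be continuous beforehand, so Cauchy's formula is obtained by Goursat's argument rather
    than by Green's formula or by differentiating an integral over circles. *)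

Section ComplexBasics.
Context {R : realType}.
Local Notation C := (CC R).
Implicit Types x y z : C.

(* The operations of [R[i]] retyped on [CC R], which is only convertible to it, so
   that rewriting finds the structures of [CC R]. *)
Definition ReC (z : C) : R := complex.Re z.
Definition ImC (z : C) : R := complex.Im z.
Definition cabs (z : C) : R := Normc.normc z.
Definition rc (r : R) : C := r%:C.
Definition cc (z : C) : C := conjc z.

Lemma C_eq x y : ReC x = ReC y -> ImC x = ImC y -> x = y.
Proof. by case: x y => [a b] [c d]; rewrite /ReC /ImC /= => -> ->. Qed.

Lemma ReCD x y : ReC (x + y) = ReC x + ReC y.
Proof. by case: x y => [a b] [c d]. Qed.
Lemma ImCD x y : ImC (x + y) = ImC x + ImC y.
Proof. by case: x y => [a b] [c d]. Qed.
Lemma ReCN x : ReC (- x) = - ReC x.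
Proof. by case: x => [a b]. Qed.
Lemma ImCN x : ImC (- x) = - ImC x.
Proof. by case: x => [a b]. Qed.
Lemma ReCM x y : ReC (x * y) = ReC x * ReC y - ImC x * ImC y.
Proof. by case: x y => [a b] [c d]. Qed.
Lemma ImCM x y : ImC (x * y) = ReC x * ImC y + ImC x * ReC y.
Proof. by case: x y => [a b] [c d]. Qed.
Lemma Re_cc x : ReC (cc x) = ReC x.
Proof. by case: x. Qed.
Lemma Im_cc x : ImC (cc x) = - ImC x.
Proof. by case: x. Qed.
Lemma Re_rc r : ReC (rc r) = r. Proof. by []. Qed.
Lemma Im_rc r : ImC (rc r) = 0. Proof. by []. Qed.

Lemma ccB x y : cc (x - y) = cc x - cc y.
Proof. exact: (rmorphB (@conjc R)). Qed.
Lemma ccM x y : cc (x * y) = cc x * cc y.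
Proof. exact: (rmorphM (@conjc R)). Qed.
Lemma cc1 : cc 1 = 1.
Proof. exact: (rmorph1 (@conjc R)). Qed.
Lemma ccV x : cc (x^-1) = (cc x)^-1.
Proof. exact: conjc_inv. Qed.
Lemma ccX x n : cc (x ^+ n) = cc x ^+ n.
Proof. exact: (rmorphXn (@conjc R)). Qed.
Lemma ccK x : cc (cc x) = x.
Proof. exact: conjcK. Qed.
Lemma cc_rc r : cc (rc r) = rc r.
Proof. by apply: C_eq; rewrite ?Re_cc ?Im_cc// Im_rc oppr0. Qed.

Lemma rcD r s : rc (r + s) = rc r + rc s.
Proof. exact: (rmorphD (real_complex R)). Qed.
Lemma rcB r s : rc (r - s) = rc r - rc s.
Proof. exact: (rmorphB (real_complex R)). Qed.
Lemma rcM r s : rc (r * s) = rc r * rc s.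
Proof. exact: (rmorphM (real_complex R)). Qed.
Lemma rcX r n : rc (r ^+ n) = rc r ^+ n.
Proof. exact: (rmorphXn (real_complex R)). Qed.
Lemma rc1 : rc 1 = 1. Proof. by []. Qed.
Lemma rc0 : rc 0 = 0. Proof. by []. Qed.
Lemma rcV r : rc (r^-1) = (rc r)^-1.
Proof. exact: (fmorphV (real_complex R)). Qed.
Lemma rcI r s : rc r = rc s -> r = s.
Proof. by move=> /(congr1 ReC). Qed.

Lemma normE z : `|z| = rc (cabs z).
Proof. by []. Qed.
Lemma ltcR' (r s : R) : (rc r < rc s) = (r < s).
Proof. exact: ltcR. Qed.
Lemma lecR' (r s : R) : (rc r <= rc s) = (r <= s).
Proof. exact: lecR. Qed.

Lemma cabs_ge0 z : 0 <= cabs z.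
Proof. by rewrite -lecR' -normE normr_ge0. Qed.
Lemma cabsD x y : cabs (x + y) <= cabs x + cabs y.
Proof. by rewrite -lecR' rcD -!normE ler_normD. Qed.
Lemma cabsN x : cabs (- x) = cabs x.
Proof. by apply: rcI; rewrite -!normE normrN. Qed.
Lemma cabsB x y : cabs (x - y) = cabs (y - x).
Proof. by rewrite -cabsN opprB. Qed.
Lemma cabsM x y : cabs (x * y) = cabs x * cabs y.
Proof. by apply: rcI; rewrite rcM -!normE normrM. Qed.
Lemma cabsX x n : cabs (x ^+ n) = cabs x ^+ n.
Proof. by apply: rcI; rewrite rcX -!normE normrX. Qed.
Lemma cabsV x : cabs (x^-1) = (cabs x)^-1.
Proof. by apply: rcI; rewrite rcV -!normE normfV. Qed.
Lemma cabs0 : cabs 0 = 0.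
Proof. by apply: rcI; rewrite -!normE normr0. Qed.
Lemma cabs1 : cabs 1 = 1.
Proof. by apply: rcI; rewrite -!normE normr1. Qed.
Lemma cabs0_eq x : cabs x = 0 -> x = 0.
Proof. by move=> h; apply/eqP; rewrite -normr_eq0 normE h. Qed.
Lemma cabs_gt0 x : (0 < cabs x) = (x != 0).
Proof. by rewrite -ltcR' -normE normr_gt0. Qed.
Lemma cabsE z : cabs z = Num.sqrt (ReC z ^+ 2 + ImC z ^+ 2).
Proof. by case: z. Qed.
Lemma cabs_sqr z : cabs z ^+ 2 = ReC z ^+ 2 + ImC z ^+ 2.
Proof. by rewrite cabsE sqr_sqrtr// addr_ge0// sqr_ge0. Qed.
Lemma cabs_rc r : cabs (rc r) = `|r|.
Proof. by rewrite cabsE Im_rc Re_rc expr0n addr0 sqrtr_sqr. Qed.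
Lemma cabs_cc z : cabs (cc z) = cabs z.
Proof. by rewrite !cabsE Re_cc Im_cc sqrrN. Qed.
Lemma mulcc z : z * cc z = rc (cabs z ^+ 2).
Proof.
by apply: C_eq; rewrite ?ReCM ?ImCM ?Re_rc ?Im_rc Re_cc Im_cc ?cabs_sqr; ring.
Qed.
Lemma Re_le_cabs z : `|ReC z| <= cabs z.
Proof. by rewrite cabsE -sqrtr_sqr ler_wsqrtr// lerDl sqr_ge0. Qed.
Lemma Im_le_cabs z : `|ImC z| <= cabs z.
Proof. by rewrite cabsE -sqrtr_sqr ler_wsqrtr// lerDr sqr_ge0. Qed.
Lemma cabs_le_ReIm z : cabs z <= `|ReC z| + `|ImC z|.
Proof.
rewrite cabsE -[leRHS]ger0_norm ?addr_ge0// -sqrtr_sqr ler_wsqrtr//.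
rewrite sqrrD !real_normK ?num_real// lerD2r lerDl mulrn_wge0// mulr_ge0//.
Qed.
Lemma ler_cabsB x y : cabs x - cabs y <= cabs (x - y).
Proof. by rewrite lerBlDr; apply: le_trans (cabsD _ _); rewrite subrK. Qed.

(** Used to turn an integral into a nonnegative real number, and to write a point of the disk as a
    direction times its modulus. *)
Lemma unimodular_rotation z : exists2 u : C, cabs u = 1 & u * z = rc (cabs z).
Proof.
have [->|z0] := eqVneq z 0; first by exists 1; rewrite ?cabs1// mulr0 cabs0.
have z1 : cabs z != 0 by rewrite gt_eqF// cabs_gt0.
exists (cc z / rc (cabs z)).
  by rewrite cabsM cabsV cabs_cc cabs_rc ger0_norm ?cabs_ge0// divff.
rewrite mulrAC mulrC (mulrC (cc z)) mulcc expr2 rcM mulrA mulVf ?mul1r//.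
by apply/eqP => /(@rcI _ 0) h; rewrite h eqxx in z1.
Qed.

Lemma unit_diskE z : unit_disk z <-> cabs z < 1.
Proof. by rewrite /unit_disk /= normE -ltcR'. Qed.

(** The norm of [CC R] takes its values in [CC R], so the radius [e] of a neighbourhood is a complex
    number; being positive forces it to be real. *)
Lemma cvgC_P (T : Type) (F : set_system T) (FF : Filter F) (f : T -> C) (l : C) :
  f @ F --> l <-> forall e : R, 0 < e -> \forall x \near F, cabs (f x - l) < e.
Proof.
split=> [/cvgrPdist_lt h e e0|h].
  have := h (rc e); rewrite ltcR' => /(_ e0); apply: filterS => x.
  by rewrite normE ltcR' cabsB.
apply/cvgrPdist_lt => e e0.
have [i0 i1] : ImC e = 0 /\ 0 < ReC e.
  move: e0; rewrite /ReC /ImC ltcE /= => /andP[/eqP].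
  by [].
have eE : e = rc (ReC e) by apply: C_eq.
have := h _ i1; apply: filterS => x.
by rewrite eE normE ltcR' cabsB.
Qed.

Lemma nbhsC_P (z : C) (P : set C) :
  nbhs z P <-> exists2 e : R, 0 < e & forall x : C, cabs (x - z) < e -> P x.
Proof.
split=> [/nbhs_ballP[e /= e0 h]|[e e0 h]].
  have [i0 i1] : ImC e = 0 /\ 0 < ReC e.
    by move: e0; rewrite /ReC /ImC ltcE /= => /andP[/eqP].
  have eE : e = rc (ReC e) by apply: C_eq.
  exists (ReC e) => // x hx; apply: h.
  by rewrite -ball_normE /= eE normE ltcR' cabsB.
apply/nbhs_ballP; exists (rc e); first by rewrite /= ltcR'.
by move=> x; rewrite -ball_normE /= normE ltcR' cabsB; exact: h.
Qed.

End ComplexBasics.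

(** * Integrals of complex-valued functions *)

Section ComplexIntegral.
Context {d} {T : measurableType d} {R : realType}.
Local Notation C := (CC R).
Implicit Types (D : set T) (F G : T -> C).

Definition mC D F := measurable_fun D (ReC \o F) /\ measurable_fun D (ImC \o F).

Lemma mC_cst D (k : C) : mC D (fun=> k).
Proof. by split; exact: measurable_cst. Qed.

Lemma mCD D F G : mC D F -> mC D G -> mC D (fun x => F x + G x).
Proof.
move=> [F1 F2] [G1 G2]; split.
  rewrite (_ : _ \o _ = fun x => (ReC \o F) x + (ReC \o G) x).
    exact: measurable_funD.
  by apply/funext => x /=; rewrite ReCD.
rewrite (_ : _ \o _ = fun x => (ImC \o F) x + (ImC \o G) x).
  exact: measurable_funD.
by apply/funext => x /=; rewrite ImCD.
Qed.

Lemma mCM D F G : mC D F -> mC D G -> mC D (fun x => F x * G x).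
Proof.
move=> [F1 F2] [G1 G2]; split.
  rewrite (_ : _ \o _ = (fun x => (ReC \o F) x * (ReC \o G) x) \-
                        (fun x => (ImC \o F) x * (ImC \o G) x)).
    by apply: measurable_funB; exact: measurable_funM.
  by apply/funext => x /=; rewrite ReCM.
rewrite (_ : _ \o _ = (fun x => (ReC \o F) x * (ImC \o G) x) \+
                        (fun x => (ImC \o F) x * (ReC \o G) x)).
  by apply: measurable_funD; exact: measurable_funM.
by apply/funext => x /=; rewrite ImCM.
Qed.

Lemma mCZ D (k : C) F : mC D F -> mC D (fun x => k * F x).
Proof. by apply: mCM; exact: mC_cst. Qed.

Lemma mCN D F : mC D F -> mC D (fun x => - F x).
Proof.
move=> /(mCZ (-1)); congr mC.
by apply/funext => x; rewrite mulN1r.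
Qed.

Lemma mCB D F G : mC D F -> mC D G -> mC D (fun x => F x - G x).
Proof. by move=> hF /mCN; exact: mCD. Qed.

Lemma mC_cc D F : mC D F -> mC D (fun x => cc (F x)).
Proof.
move=> [F1 F2]; split.
  by congr measurable_fun: F1; apply/funext => x /=; rewrite Re_cc.
have := measurable_funN F2.
by congr measurable_fun; apply/funext => x /=; rewrite Im_cc.
Qed.

Lemma mC_sum D (I : Type) (s : seq I) (F : I -> T -> C) :
  (forall i, mC D (F i)) -> mC D (fun x => \sum_(i <- s) F i x).
Proof.
move=> h; elim: s => [|i s IH].
  have := mC_cst D 0; congr mC.
  by apply/funext => x; rewrite big_nil.
have := mCD (h i) IH; congr mC.
by apply/funext => x; rewrite big_cons.
Qed.

Lemma mCX D F n : mC D F -> mC D (fun x => F x ^+ n).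
Proof.
move=> h; elim: n => [|n IH]; first exact: mC_cst.
have := mCM h IH; congr mC.
by apply/funext => x; rewrite exprS.
Qed.

Lemma mC_rc D (f : T -> R) : measurable_fun D f -> mC D (fun x => rc (f x)).
Proof. by move=> h; split => //; exact: measurable_cst. Qed.

Lemma measurable_cabs D F : mC D F -> measurable_fun D (fun x => cabs (F x)).
Proof.
move=> [F1 F2].
rewrite (_ : (fun x => _) = Num.sqrt \o
   ((fun x => (ReC \o F) x ^+ 2) \+ (fun x => (ImC \o F) x ^+ 2))); last first.
  by apply/funext => x /=; rewrite cabsE.
apply: measurableT_comp.
  apply: continuous_measurable_fun; exact: sqrt_continuous.
by apply: measurable_funD; exact: measurable_funX.
Qed.

Lemma mCV D F : mC D F -> mC D (fun x => (F x)^-1).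
Proof.
(* The inverse of F is its conjugate times |F|^-2. Where F vanishes both sides are 0, since the
   inverse of 0 is 0. *)
move=> h; have := mCM (mC_cc h) (mC_rc (measurableT_comp (measurable_powR (-1))
   (measurable_funX 2 (measurable_cabs h)))).
congr mC; apply/funext => x.
rewrite /= powR_inv1 ?sqr_ge0//.
have [->|F0] := eqVneq (F x) 0.
  by apply: C_eq; rewrite invr0 ?ReCM ?ImCM ?Re_cc ?Im_cc /ReC /ImC /= oppr0 !mul0r ?subr0 ?addr0.
apply: (mulfI F0); rewrite divff// mulrA mulcc -rcM divff//.
by rewrite sqrf_eq0 gt_eqF// cabs_gt0.
Qed.

Context (mu : {measure set T -> \bar R}).

Definition intC D F := mu.-integrable D (EFin \o (ReC \o F)) /\
  mu.-integrable D (EFin \o (ImC \o F)).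

(** Convertible to [disk_integral] when the measure is [dA] and [F] factors through [of_xy];
    [L2_dotE] and the final step rely on this. *)
Definition cint D F : C :=
  Rintegral mu D (ReC \o F) +i* Rintegral mu D (ImC \o F).

Lemma Re_cint D F : ReC (cint D F) = Rintegral mu D (fun x => ReC (F x)).
Proof. by []. Qed.
Lemma Im_cint D F : ImC (cint D F) = Rintegral mu D (fun x => ImC (F x)).
Proof. by []. Qed.

Lemma intC_mC D F : intC D F -> mC D F.
Proof.
by move=> [/measurable_int/measurable_EFinP ? /measurable_int/measurable_EFinP ?].
Qed.

Lemma eq_cint D F G : {in D, F =1 G} -> cint D F = cint D G.
Proof.
move=> h; apply: C_eq; rewrite ?Re_cint ?Im_cint; apply: eq_Rintegral => x xD;
  by rewrite h.
Qed.

Lemma intC_eq D F G : measurable D -> {in D, F =1 G} -> intC D F -> intC D G.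
Proof.
move=> mD h [F1 F2]; split.
  by apply: eq_integrable F1 => // x xD /=; rewrite h.
by apply: eq_integrable F2 => // x xD /=; rewrite h.
Qed.

Section MeasurableDomain.
Variable D : set T.
Hypothesis mD : measurable D.

Lemma intC_dom F (h : T -> R) : mC D F -> mu.-integrable D (EFin \o h) ->
  (forall x, D x -> cabs (F x) <= h x) -> intC D F.
Proof.
move=> [F1 F2] ih le; split; apply: le_integrable ih => //.
- exact/measurable_EFinP.
- move=> x Dx; rewrite lee_fin /= (le_trans (Re_le_cabs _))//.
  by rewrite (le_trans (le _ Dx))// ler_norm.
- exact/measurable_EFinP.
- move=> x Dx; rewrite lee_fin /= (le_trans (Im_le_cabs _))//.
  by rewrite (le_trans (le _ Dx))// ler_norm.
Qed.

Lemma intC_cabs F : intC D F -> mu.-integrable D (EFin \o (fun x => cabs (F x))).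
Proof.
move=> iF; have mF := intC_mC iF; case: iF => i1 i2.
have := integrableD mD (integrable_abse i1) (integrable_abse i2).
apply: le_integrable => //; first exact/measurable_EFinP/measurable_cabs.
move=> x Dx; rewrite /= lee_fin ger0_norm ?cabs_ge0//.
by rewrite (le_trans (cabs_le_ReIm _))// ler_norm.
Qed.

Lemma intC_cabsP F :
  intC D F <-> mC D F /\ mu.-integrable D (EFin \o (fun x => cabs (F x))).
Proof.
split=> [h|[h1 h2]]; first by split; [exact: intC_mC|exact: intC_cabs].
exact: intC_dom h1 h2 _.
Qed.

Lemma intCD F G : intC D F -> intC D G -> intC D (fun x => F x + G x).
Proof.
move=> [F1 F2] [G1 G2]; split.
  have := integrableD mD F1 G1; apply: eq_integrable => // x _ /=.
  by rewrite ReCD EFinD.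
have := integrableD mD F2 G2; apply: eq_integrable => // x _ /=.
by rewrite ImCD EFinD.
Qed.

Lemma intCZ (k : C) F : intC D F -> intC D (fun x => k * F x).
Proof.
move=> /intC_cabsP[mF iF]; apply/intC_cabsP; split; first exact: mCZ.
have := integrableZl mD (cabs k) iF; apply: eq_integrable => // x _ /=.
by rewrite cabsM EFinM.
Qed.

Lemma intCN F : intC D F -> intC D (fun x => - F x).
Proof.
by move=> /(intCZ (-1)); apply: intC_eq => // x _; rewrite mulN1r.
Qed.

Lemma intCB F G : intC D F -> intC D G -> intC D (fun x => F x - G x).
Proof. by move=> hF /intCN; exact: intCD. Qed.

Lemma intC_cc F : intC D F -> intC D (fun x => cc (F x)).
Proof.
move=> /intC_cabsP[mF iF]; apply/intC_cabsP; split; first exact: mC_cc.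
by apply: eq_integrable iF => // x _ /=; rewrite cabs_cc.
Qed.

Lemma intC_sum (I : Type) (s : seq I) (F : I -> T -> C) :
  (forall i, intC D (F i)) -> intC D (fun x => \sum_(i <- s) F i x).
Proof.
move=> h; elim: s => [|i s IH].
  have : intC D (fun=> 0).
    by split; apply: eq_integrable (integrable0 mu D).
  by apply: intC_eq => // x _; rewrite big_nil.
have := intCD (h i) IH; apply: intC_eq => // x _.
by rewrite big_cons.
Qed.

Lemma cintD F G : intC D F -> intC D G ->
  cint D (fun x => F x + G x) = cint D F + cint D G.
Proof.
move=> [F1 F2] [G1 G2]; apply: C_eq; rewrite ?ReCD ?ImCD ?Re_cint ?Im_cint.
  by rewrite -RintegralD//; apply: eq_Rintegral => x _; rewrite ReCD.
by rewrite -RintegralD//; apply: eq_Rintegral => x _; rewrite ImCD.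
Qed.

Lemma cintZ (k : C) F : intC D F -> cint D (fun x => k * F x) = k * cint D F.
Proof.
move=> [F1 F2]; apply: C_eq; rewrite ?ReCM ?ImCM ?Re_cint ?Im_cint.
  rewrite -!RintegralZl// -RintegralB//; first by apply: eq_Rintegral => x _; rewrite ReCM.
    by have := integrableZl mD (ReC k) F1; apply: eq_integrable.
  by have := integrableZl mD (ImC k) F2; apply: eq_integrable.
rewrite -!RintegralZl// -RintegralD//; first by apply: eq_Rintegral => x _; rewrite ImCM.
  by have := integrableZl mD (ReC k) F2; apply: eq_integrable.
by have := integrableZl mD (ImC k) F1; apply: eq_integrable.
Qed.

Lemma cintN F : intC D F -> cint D (fun x => - F x) = - cint D F.
Proof.
move=> h; rewrite -mulN1r -cintZ//.
by apply: eq_cint => x _; rewrite mulN1r.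
Qed.

Lemma cintB F G : intC D F -> intC D G ->
  cint D (fun x => F x - G x) = cint D F - cint D G.
Proof. by move=> iF iG; rewrite cintD ?cintN//; exact: intCN. Qed.

Lemma cint0 : cint D (fun=> 0) = 0.
Proof.
have i0 : intC D (fun=> 0) by split; apply: eq_integrable (integrable0 mu D).
by rewrite -[RHS](mul0r (cint D (fun=> 0))) -cintZ//; apply: eq_cint => x _; rewrite mulr0.
Qed.

Lemma cint_sum (I : Type) (s : seq I) (F : I -> T -> C) :
  (forall i, intC D (F i)) ->
  cint D (fun x => \sum_(i <- s) F i x) = \sum_(i <- s) cint D (F i).
Proof.
move=> h; elim: s => [|i s IH].
  by rewrite big_nil -[RHS]cint0; apply: eq_cint => x _; rewrite big_nil.
rewrite big_cons -IH -cintD//; last exact: intC_sum.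
by apply: eq_cint => x _; rewrite big_cons.
Qed.

Lemma cint_cc F : intC D F -> cint D (fun x => cc (F x)) = cc (cint D F).
Proof.
move=> [F1 F2]; apply: C_eq; rewrite ?Re_cc ?Im_cc ?Re_cint ?Im_cint.
  by apply: eq_Rintegral => x _; rewrite Re_cc.
rewrite -mulN1r -RintegralZl//; apply: eq_Rintegral => x _.
by rewrite Im_cc mulN1r.
Qed.

(** After multiplication by a unimodular constant the integral is real and nonnegative, hence the
    integral of a real part, which the modulus dominates pointwise. *)
Lemma le_cabs_cint F : intC D F ->
  cabs (cint D F) <= Rintegral mu D (fun x => cabs (F x)).
Proof.
move=> iF; have [u u1 uE] := unimodular_rotation (cint D F).
rewrite -[leLHS]Re_rc -uE -cintZ// Re_cint.
have iuF := intCZ u iF.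
apply: le_Rintegral => //; [by case: iuF|exact: intC_cabs|].
move=> x Dx; rewrite (le_trans (ler_norm _))// (le_trans (Re_le_cabs _))//.
by rewrite cabsM u1 mul1r.
Qed.

Lemma integrable_cst_fin (k : R) : (mu D < +oo)%E ->
  mu.-integrable D (EFin \o fun=> k).
Proof.
move=> muD; apply/integrableP; split; first exact: measurable_cst.
by rewrite (_ : (fun x => _) = cst (`|k|%:E))// integral_cst// lte_mul_pinfty.
Qed.

Lemma intC_bounded F (B : R) : (mu D < +oo)%E -> mC D F ->
  (forall x, D x -> cabs (F x) <= B) -> intC D F.
Proof.
by move=> muD mF; apply: (intC_dom (h := fun=> B)) => //; exact: integrable_cst_fin.
Qed.

Lemma le_cabs_cint_cst F (B : R) : (mu D < +oo)%E -> intC D F ->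
  (forall x, D x -> cabs (F x) <= B) ->
  cabs (cint D F) <= B * fine (mu D).
Proof.
move=> muD iF le; rewrite (le_trans (le_cabs_cint iF))//.
rewrite -Rintegral_cst//; apply: le_Rintegral => //; first exact: intC_cabs.
exact: integrable_cst_fin.
Qed.

Lemma intC_cst (k : C) : (mu D < +oo)%E -> intC D (fun=> k).
Proof. by move=> h; apply: (@intC_bounded _ (cabs k)) => //; exact: mC_cst. Qed.

Lemma cint_cst (k : C) : cint D (fun=> k) = k * rc (fine (mu D)).
Proof.
apply: C_eq; rewrite ?ReCM ?ImCM Re_rc Im_rc mulr0 ?subr0 ?add0r ?Re_cint ?Im_cint.
  by rewrite Rintegral_cst.
by rewrite Rintegral_cst// addrC addr0.
Qed.

End MeasurableDomain.

Lemma intCS D E F : measurable D -> measurable E -> D `<=` E -> intC E F -> intC D F.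
Proof. by move=> mD mE DE [h1 h2]; split; exact: integrableS DE _. Qed.

End ComplexIntegral.
Arguments intC {d T R} mu D F.
Arguments cint {d T R} mu D F.

(** * Goursat's bisection *)

Section Bisection.
Context {R : realType}.
Local Notation C := (CC R).

Lemma nested_intervals (a b : nat -> R) :
  (forall n, a n <= a n.+1) -> (forall n, b n.+1 <= b n) ->
  (forall n, a n <= b n) -> exists t, forall n, a n <= t <= b n.
Proof.
move=> ha hb hab.
have am m n : (m <= n)%N -> a m <= a n.
  by move=> /subnK <-; elim: (n - m)%N => // j IH; rewrite addSn (le_trans IH).
have bm m n : (m <= n)%N -> b n <= b m.
  by move=> /subnK <-; elim: (n - m)%N => // j IH; rewrite addSn (le_trans _ IH).
have amb m n : a m <= b n.
  case: (leqP m n) => h; first exact: le_trans (am _ _ h) (hab _).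
  exact: le_trans (hab _) (bm _ _ (ltnW h)).
exists (sup (range a)) => n; apply/andP; split.
  apply: ub_le_sup; last by exists n.
  by exists (b 0%N) => _ [m _ <-]; exact: amb.
apply: ge_sup; first by exists (a 0%N); exists 0%N.
by move=> _ [m _ <-]; exact: amb.
Qed.

Lemma small_dyadic (L e : R) : 0 < e -> exists n, L / 2 ^+ n < e.
Proof.
move=> e0; have [n hn] : exists n, L / e < n%:R.
  exists (Num.truncn `|L / e|).+1; rewrite (le_lt_trans (ler_norm _))//.
  by rewrite truncnS_gt.
exists n; rewrite ltr_pdivrMr ?exprn_gt0// mulrC -ltr_pdivrMr//.
by rewrite (lt_trans hn)// -natrX ltr_nat ltn_expl.
Qed.

Definition half (right : bool) (x : R * R) : R * R :=
  let m := (x.1 + x.2) / 2 in if right then (m, x.2) else (x.1, m).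

Lemma halfP i (x : R * R) : x.1 <= x.2 ->
  [/\ x.1 <= (half i x).1, (half i x).1 <= (half i x).2, (half i x).2 <= x.2 &
      (half i x).2 - (half i x).1 = (x.2 - x.1) / 2].
Proof. by case: x => a b /= ab; rewrite /half; case: i => /=; split; lra. Qed.

(* If the bound fails on a rectangle, it fails on one of its four quarters, hence
   on a sequence of nested rectangles shrinking to a point. *)
Lemma additive_rectangle_function_eq0 (I : R -> R -> R -> R -> C) (a0 b0 c0 d0 : R) :
  a0 <= b0 -> c0 <= d0 ->
  (forall a m b c d, a0 <= a -> a <= m -> m <= b -> b <= b0 ->
    c0 <= c -> c <= d -> d <= d0 -> I a b c d = I a m c d + I m b c d) ->
  (forall a b c m d, a0 <= a -> a <= b -> b <= b0 ->
    c0 <= c -> c <= m -> m <= d -> d <= d0 -> I a b c d = I a b c m + I a b m d) ->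
  (forall t s e, a0 <= t <= b0 -> c0 <= s <= d0 -> 0 < e ->
    exists2 r, 0 < r & forall a b c d, a0 <= a -> a <= t -> t <= b -> b <= b0 ->
      c0 <= c -> c <= s -> s <= d -> d <= d0 -> b - a < r -> d - c < r ->
      cabs (I a b c d) <= e * ((b - a) + (d - c)) ^+ 2) ->
  I a0 b0 c0 d0 = 0.
Proof.
move=> ab0 cd0 addl addr small.
suff key e : 0 < e -> cabs (I a0 b0 c0 d0) <= e * ((b0 - a0) + (d0 - c0)) ^+ 2.
  apply: cabs0_eq; apply/eqP; rewrite eq_le cabs_ge0 andbT leNgt; apply/negP => I0.
  set L2 := ((b0 - a0) + (d0 - c0)) ^+ 2 in key.
  have L20 : 0 <= L2 by exact: sqr_ge0.
  (* This choice of [e] would give |I| (L2 + 1) <= |I| L2. The [+ 1] keeps the divisor positive when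
     the rectangle is degenerate. *)
  have := key (cabs (I a0 b0 c0 d0) / (L2 + 1)).
  rewrite divr_gt0 ?ltr_wpDl// => /(_ isT).
  rewrite mulrAC ler_pdivlMr ?ltr_wpDl// ler_pM2l//; lra.
move=> e0.
pose bad (q : (R * R) * (R * R)) :=
  e * ((q.1.2 - q.1.1) + (q.2.2 - q.2.1)) ^+ 2 < cabs (I q.1.1 q.1.2 q.2.1 q.2.2).
pose inside (q : (R * R) * (R * R)) :=
  [/\ a0 <= q.1.1, q.1.1 <= q.1.2 & q.1.2 <= b0] /\
    [/\ c0 <= q.2.1, q.2.1 <= q.2.2 & q.2.2 <= d0].
pose quarter (i : bool * bool) (q : (R * R) * (R * R)) := (half i.1 q.1, half i.2 q.2).
have bad_quarter q : inside q -> bad q -> exists i, bad (quarter i q).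
  case: q => -[a b] [c d] [[/= h1 h2 h3] [/= h4 h5 h6]] hbad.
  apply: contrapT => none.
  (* Halving both sides divides the allowed bound by 4, so four good quarters add up to a good
     rectangle. *)
  have good i : cabs (I (half i.1 (a, b)).1 (half i.1 (a, b)).2
       (half i.2 (c, d)).1 (half i.2 (c, d)).2) <= e * (((b - a) + (d - c)) / 2) ^+ 2.
    rewrite leNgt; apply/negP => h; apply: none; exists i.
    move: h; rewrite /bad /quarter /half /=; case: i => -[] [] /=;
      congr (e * _ ^+ 2 < _); lra.
  move: hbad; rewrite /bad /=; apply/negP; rewrite -leNgt.
  rewrite (addl a ((a + b) / 2) b); try lra.
  rewrite (addr a _ c ((c + d) / 2) d); try lra.
  rewrite (addr _ b c ((c + d) / 2) d); try lra.
  have := good (false, false); have := good (false, true).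
  have := good (true, false); have := good (true, true); rewrite /half /=.
  move: (I _ _ _ _) (I _ _ _ _) (I _ _ _ _) (I _ _ _ _) => x y z w hx hy hz hw.
  apply: (le_trans (cabsD _ _)); apply: (le_trans (lerD (cabsD _ _) (cabsD _ _))).
  move: hx hy hz hw; rewrite expr_div_n.
  by have := sqr_ge0 (b - a + (d - c)); move: (_ ^+ 2) => P; lra.
rewrite leNgt; apply/negP => bad0.
(* The default [q] is never reached on the sequence below, since a bad rectangle inside the initial
   one always has a bad quarter. *)
pose step q := if [pick i | `[< bad (quarter i q) >]] is Some i then quarter i q else q.
pose q n := iter n step ((a0, b0), (c0, d0)).
have qP n : inside (q n) /\ bad (q n).
  elim: n => [|n [IH1 IH2]]; first by [].
  rewrite /q iterS -/(q n) /step; case: pickP => [i /asboolP hi|none].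
    split => //; move: IH1 => [[h1 h2 h3] [h4 h5 h6]].
    have [x1 x2 x3 _] := halfP i.1 h2; have [y1 y2 y3 _] := halfP i.2 h5.
    by split; split; rewrite //= ?(le_trans h1)// ?(le_trans h4)// ?(le_trans _ h3)// (le_trans _ h6).
  have [i hi] := bad_quarter _ IH1 IH2.
  by have /asboolP := none i.
have qS n : exists i, q n.+1 = quarter i (q n).
  have [IH1 IH2] := qP n; rewrite /q iterS -/(q n) /step.
  case: pickP => [i _|none]; first by exists i.
  by have [i hi] := bad_quarter _ IH1 IH2; have /asboolP := none i.
have wx n : (q n).1.2 - (q n).1.1 = (b0 - a0) / 2 ^+ n.
  elim: n => [|n IH]; first by rewrite expr0 divr1.
  have [i ->] := qS n; have [[[_ h _] _] _] := qP n.
  by have [_ _ _ ->] := halfP i.1 h; rewrite IH exprSr invfM mulrA.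
have wy n : (q n).2.2 - (q n).2.1 = (d0 - c0) / 2 ^+ n.
  elim: n => [|n IH]; first by rewrite expr0 divr1.
  have [i ->] := qS n; have [[_ [_ h _]] _] := qP n.
  by have [_ _ _ ->] := halfP i.2 h; rewrite IH exprSr invfM mulrA.
have [t ht] : exists t, forall n, (q n).1.1 <= t <= (q n).1.2.
  apply: nested_intervals => n; have [[[_ h _] _] _] := qP n => //.
    by have [i ->] := qS n; have [] := halfP i.1 h.
  by have [i ->] := qS n; have [] := halfP i.1 h.
have [s hs] : exists s, forall n, (q n).2.1 <= s <= (q n).2.2.
  apply: nested_intervals => n; have [[_ [_ h _]] _] := qP n => //.
    by have [i ->] := qS n; have [] := halfP i.2 h.
  by have [i ->] := qS n; have [] := halfP i.2 h.
have [r r0 hr] := small t s e (ht 0%N) (hs 0%N) e0.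
have [n hn] := small_dyadic ((b0 - a0) + (d0 - c0)) r0.
have [[[h1 h2 h3] [h4 h5 h6]] hbad] := qP n.
have /andP[t1 t2] := ht n; have /andP[s1 s2] := hs n.
have p2 : 0 < (2 ^+ n : R)^-1 by rewrite invr_gt0 exprn_gt0.
move: hbad; rewrite /bad; apply/negP; rewrite -leNgt; apply: hr => //.
  by rewrite wx (le_lt_trans _ hn)// ler_wpM2r ?(ltW p2)// lerDl subr_ge0.
by rewrite wy (le_lt_trans _ hn)// ler_wpM2r ?(ltW p2)// lerDr subr_ge0.
Qed.

End Bisection.

(** * Complex derivatives and curve integrals *)

Section ComplexDerivative.
Context {R : realType}.
Local Notation C := (CC R).

Implicit Types (f : C -> C) (z l : C).

Lemma dnbhsC_P (z : C) (P : set C) :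
  (\forall h \near z^', P h) <->
  exists2 e : R, 0 < e & forall x : C, x != z -> cabs (x - z) < e -> P x.
Proof.
have -> : (\forall h \near z^', P h) = nbhs z [set y | y != z -> P y] by [].
rewrite nbhsC_P; split=> -[e e0 h]; exists e => // x.
  by move=> xz /h; apply.
by move=> hx xz; apply: h.
Qed.

(** An explicit value [l] and real radii; [derivC_cvgP] links this form to the filter behind
    [derivable] and [derive1]. *)
Definition derivC (f : C -> C) (z l : C) : Prop := forall e : R, 0 < e ->
  exists2 r : R, 0 < r & forall h, h != 0 -> cabs h < r ->
    cabs (h^-1 * (f (h + z) - f z) - l) < e.

Lemma derivC_cvgP f z l :
  derivC f z l <-> h^-1 *: (f (h *: 1 + z) - f z) @[h --> 0^'] --> l.
Proof.
rewrite cvgC_P; split=> H e e0.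
  have [r r0 hr] := H e e0; apply/dnbhsC_P; exists r => // h h0.
  by rewrite subr0 => hh; have := hr _ h0 hh; rewrite [h%:A]mulr1.
have /dnbhsC_P[r r0 hr] := H e e0; exists r => // h h0 hh.
by have := hr h h0; rewrite subr0 [h%:A]mulr1; apply.
Qed.

Lemma derivC_derivable f z l : derivC f z l -> derivable f z 1.
Proof. by move=> /derivC_cvgP h; apply/cvg_ex; exists l. Qed.

Lemma derivC_derive1 f z l : derivC f z l -> derive1 f z = l.
Proof.
move=> /derivC_cvgP h; rewrite derive1E; apply: cvg_lim => //.
Qed.

Lemma derivable_derivC f z : derivable f z 1 -> exists l, derivC f z l.
Proof. by move=> /cvg_ex[l hl]; exists l; apply/derivC_cvgP. Qed.

Lemma derivC_affine f z l : derivC f z l -> forall e : R, 0 < e ->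
  exists2 r : R, 0 < r & forall x, cabs (x - z) < r ->
    cabs (f x - f z - l * (x - z)) <= e * cabs (x - z).
Proof.
move=> h e /h[r r0 hr]; exists r => // x xr.
have [->|xz] := eqVneq x z; first by rewrite !subrr mulr0 subrr cabs0 mulr0.
have xz0 : x - z != 0 by rewrite subr_eq0.
have := hr _ xz0 xr; rewrite subrK => /ltW le.
rewrite (_ : _ - _ = (x - z) * ((x - z)^-1 * (f x - f z) - l)); last first.
  by rewrite [RHS]mulrBr [in RHS]mulrA divff// mul1r (mulrC l).
by rewrite cabsM mulrC ler_wpM2r ?cabs_ge0.
Qed.

Lemma derivC_cont f z l : derivC f z l -> f x @[x --> z] --> f z.
Proof.
move=> /derivC_affine/(_ 1 ltr01)[r r0 hr]; apply/(@cvgC_P _ _ (nbhs z)) => e e0.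
apply/nbhsC_P; exists (Num.min r (e / (2 + cabs l))) => [|x].
  by rewrite lt_min r0 divr_gt0// ltr_wpDr ?cabs_ge0.
rewrite lt_min => /andP[/hr h]; rewrite ltr_pdivlMr ?ltr_wpDr ?cabs_ge0// => h2.
have [xz|xz] := eqVneq x z; first by rewrite xz subrr cabs0.
have {xz} x0 : 0 < cabs (x - z) by rewrite cabs_gt0 subr_eq0.
rewrite -(subrK (l * (x - z)) (f x - f z)) (le_lt_trans (cabsD _ _))//.
rewrite (le_lt_trans (lerD h (lexx _)))// cabsM (lt_trans _ h2)//; nra.
Qed.

Lemma derivable_cont f z : derivable f z 1 -> f x @[x --> z] --> f z.
Proof. by move=> /derivable_derivC[l]; exact: derivC_cont. Qed.

End ComplexDerivative.

(** * Integrals of complex functions over segments *)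

Section CurveIntegral.
Context {R : realType}.
Local Notation C := (CC R).
Local Notation mu := (@lebesgue_measure R).
Implicit Types F G : R -> C.

(** Continuity is two-sided even at the endpoints. This is available below because [k] is
    differentiable, hence continuous, at the points of the unit circle as well. *)
Definition contC_on (a b : R) F := forall x, a <= x <= b -> F y @[y --> x] --> F x.

Lemma cvg_ReC (T : Type) (G : set_system T) (FG : Filter G) (F : T -> C) l :
  F @ G --> l -> ReC (F x) @[x --> G] --> ReC l.
Proof.
move=> /cvgC_P h; apply/cvgrPdist_lt => e /h; apply: filterS => x.
by rewrite distrC -ReCN -ReCD; exact/le_lt_trans/Re_le_cabs.
Qed.

Lemma cvg_ImC (T : Type) (G : set_system T) (FG : Filter G) (F : T -> C) l :
  F @ G --> l -> ImC (F x) @[x --> G] --> ImC l.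
Proof.
move=> /cvgC_P h; apply/cvgrPdist_lt => e /h; apply: filterS => x.
by rewrite distrC -ImCN -ImCD; exact/le_lt_trans/Im_le_cabs.
Qed.

Lemma cvg_ReImC (T : Type) (G : set_system T) (FG : Filter G) (F : T -> C) l :
  ReC (F x) @[x --> G] --> ReC l -> ImC (F x) @[x --> G] --> ImC l -> F @ G --> l.
Proof.
move=> /cvgrPdist_lt h1 /cvgrPdist_lt h2; apply/cvgC_P => e e0.
have e2 : 0 < e / 2 by rewrite divr_gt0.
apply: (@filterS _ G FG _ _ _ (@filterI _ G FG _ _ (h1 _ e2) (h2 _ e2))) => x [k1 k2].
rewrite (le_lt_trans (cabs_le_ReIm _))// ReCD ReCN ImCD ImCN.
by rewrite (distrC (ReC (F x))) (distrC (ImC (F x))) (splitr e) ltrD.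
Qed.

Lemma lebesgue_segment_lty (a b : R) : (mu `[a, b]%classic < +oo)%E.
Proof. by rewrite lebesgue_measure_itv /=; case: ifP => // _; rewrite -EFinB ltry. Qed.

Lemma fine_lebesgue_segment (a b : R) : a <= b -> fine (mu `[a, b]%classic) = b - a.
Proof.
move=> ab; rewrite lebesgue_measure_itv /= lte_fin; case: ltP => // ba.
by rewrite (@le_anti _ _ a b) ?ab// subrr.
Qed.

Lemma intC_cont a b F : contC_on a b F -> intC mu `[a, b]%classic F.
Proof.
move=> h; split; apply: continuous_compact_integrable;
  try exact: segment_compact; apply: continuous_in_subspaceT => x;
  rewrite inE /= in_itv /= => /h.
  exact: cvg_ReC.
exact: cvg_ImC.
Qed.

Lemma cint_split a c b F : a <= c -> c <= b -> intC mu `[a, b]%classic F ->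
  cint mu `[a, b]%classic F = cint mu `[a, c]%classic F + cint mu `[c, b]%classic F.
Proof.
move=> ac cb [i1 i2].
(* The closed pieces share the point [c], which is a null set; the half-open piece makes the
   splitting exact. *)
have j1 : mu.-integrable `]c, b]%classic (EFin \o (ReC \o F)).
  by apply: integrableS i1 => // x /=; rewrite !in_itv /= => /andP[? ->]; lra.
have j2 : mu.-integrable `]c, b]%classic (EFin \o (ImC \o F)).
  by apply: integrableS i2 => // x /=; rewrite !in_itv /= => /andP[? ->]; lra.
apply: C_eq; rewrite ?ReCD ?ImCD ?Re_cint ?Im_cint.
  rewrite -(Rintegral_itv_obnd_cbnd j1) -(@Rintegral_itvB _ _ _ _ c i1) ?bnd_simp//.
  by rewrite addrC subrK.
rewrite -(Rintegral_itv_obnd_cbnd j2) -(@Rintegral_itvB _ _ _ _ c i2) ?bnd_simp//.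
by rewrite addrC subrK.
Qed.

Lemma le_cabs_cint_segment a b F (B : R) : a <= b -> intC mu `[a, b]%classic F ->
  (forall x, a <= x <= b -> cabs (F x) <= B) ->
  cabs (cint mu `[a, b]%classic F) <= B * (b - a).
Proof.
move=> ab iF h; rewrite -fine_lebesgue_segment//.
apply: le_cabs_cint_cst => //; exact: lebesgue_segment_lty.
Qed.

Lemma cint_segment_cst a b (k : C) : a <= b ->
  cint mu `[a, b]%classic (fun=> k) = k * rc (b - a).
Proof. by move=> ab; rewrite cint_cst// fine_lebesgue_segment. Qed.

Lemma Rintegral_FTC (a b : R) (f F : R -> R) : a <= b -> continuous f ->
  (forall x : R, is_derive x 1 F (f x)) ->
  \int[mu]_(x in `[a, b]) f x = F b - F a.
Proof.
rewrite le_eqVlt => /predU1P[->|ab] cf dF.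
  by rewrite set_itv1 Rintegral_set1 subrr.
have cF : continuous F.
  by move=> x; apply/differentiable_continuous/derivable1_diffP; case: (dF x).
rewrite /Rintegral (@continuous_FTC2 _ _ F)//.
- exact: continuous_subspaceT.
- split => [x _||]; [by case: (dF x)|apply: cvg_at_right_filter; exact: cF|apply: cvg_at_left_filter; exact: cF].
- by move=> x _; rewrite derive1E; case: (dF x).
Qed.

Lemma cint_FTC (a b : R) (f F : R -> C) : a <= b -> (forall x, contC_on x x f) ->
  (forall x : R, is_derive x 1 (ReC \o F) (ReC (f x))) ->
  (forall x : R, is_derive x 1 (ImC \o F) (ImC (f x))) ->
  cint mu `[a, b]%classic f = F b - F a.
Proof.
move=> ab cf d1 d2; apply: C_eq; rewrite ?ReCD ?ImCD ?ReCN ?ImCN ?Re_cint ?Im_cint.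
  rewrite (@Rintegral_FTC _ _ _ (ReC \o F))//.
  by move=> x; apply: cvg_ReC; apply: (cf x); rewrite lexx.
rewrite (@Rintegral_FTC _ _ _ (ImC \o F))//.
by move=> x; apply: cvg_ImC; apply: (cf x); rewrite lexx.
Qed.

End CurveIntegral.

(** * Parametrization of the unit circle by the angle *)

Section UnitCircle.
Context {R : realType}.
Local Notation C := (CC R).
Local Notation mu := (@lebesgue_measure R).

Definition iC : C := Complex 0 1.
Definition cis (t : R) : C := Complex (cos t) (sin t).

Lemma Re_cis t : ReC (cis t) = cos t. Proof. by []. Qed.
Lemma Im_cis t : ImC (cis t) = sin t. Proof. by []. Qed.

Lemma cabs_cis t : cabs (cis t) = 1.
Proof. by rewrite cabsE Re_cis Im_cis cos2Dsin2 sqrtr1. Qed.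

Lemma cabs_iC : cabs (iC : C) = 1.
Proof. by rewrite cabsE /iC /ReC /ImC /= expr0n expr1n add0r sqrtr1. Qed.

Lemma cis0 : cis 0 = 1.
Proof. by apply: C_eq; rewrite ?Re_cis ?Im_cis ?cos0 ?sin0. Qed.

Lemma cis2pi : cis (2 * pi) = 1.
Proof. by apply: C_eq; rewrite ?Re_cis ?Im_cis mulr2n mulrDl !mul1r ?cos2pi ?sin2pi -?mulr2n ?cos2pi ?sin2pi. Qed.

Lemma cvg_cis t : cis s @[s --> t] --> cis t.
Proof.
by apply: cvg_ReImC; [exact: continuous_cos|exact: continuous_sin].
Qed.

Lemma sin_lipschitz (s t : R) : `|sin t - sin s| <= `|t - s|.
Proof.
wlog st : s t / (s <= t)%R.
  move=> h; have [st|/ltW ts] := leP s t; first exact: h.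
  by rewrite distrC (distrC t); exact: h.
have [|c _ ->] := @MVT_segment R sin cos s t st.
  by apply: continuous_subspaceT => x; exact: continuous_sin.
rewrite normrM ler_piMl// ler_norml cos_geN1 cos_le1//.
Qed.

Lemma cos_lipschitz (s t : R) : `|cos t - cos s| <= `|t - s|.
Proof.
wlog st : s t / (s <= t)%R.
  move=> h; have [st|/ltW ts] := leP s t; first exact: h.
  by rewrite distrC (distrC t); exact: h.
have [|c _ ->] := @MVT_segment R cos (fun x => - sin x) s t st.
  by apply: continuous_subspaceT => x; exact: continuous_cos.
by rewrite normrM ler_piMl// normrN ler_norml sin_geN1 sin_le1.
Qed.

Lemma cis_lipschitz s t : cabs (cis t - cis s) <= 2 * `|t - s|.
Proof.
rewrite (le_trans (cabs_le_ReIm _))// ReCD ImCD ReCN ImCN.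
by rewrite mulr2n mulrDl mul1r lerD// ?cos_lipschitz ?sin_lipschitz.
Qed.

Lemma cint_cis c d : c <= d -> cint mu `[c, d]%classic (fun s => iC * cis s) = cis d - cis c.
Proof.
move=> cd; apply: cint_FTC => // x.
- by move=> y _; apply: cvgM; [exact: cvg_cst|exact: cvg_cis].
- rewrite ReCM /iC /ReC /ImC /= mul0r mul1r sub0r; exact: is_derive_cos.
- rewrite ImCM /iC /ReC /ImC /= mul0r mul1r add0r; exact: is_derive_sin.
Qed.

End UnitCircle.

(** * Cauchy's formula on the unit circle *)

Section CircleCauchy.
Context {R : realType}.
Local Notation C := (CC R).
Local Notation mu := (@lebesgue_measure R).
Variables (k : C -> C) (l : C).
Hypothesis kd : forall x : C, cabs x <= 1 -> derivable k x 1.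
Hypothesis l1 : cabs l < 1.

(* [path] contracts the unit circle to [l]; pulling [k(z)/(z - l) dz] back along
   it gives [k (path t s) * (dt / t + ang s ds)]. *)
Let path (t s : R) : C := l + rc t * (cis s - l).
Let ang (s : R) : C := iC * (1 - l * cc (cis s))^-1.

Lemma one_sub_cis_neq0 s : 1 - l * cc (cis s) != 0.
Proof.
rewrite -cabs_gt0; apply: lt_le_trans (ler_cabsB _ _).
by rewrite cabs1 cabsM cabs_cc cabs_cis mulr1 subr_gt0.
Qed.

Lemma cabs_one_sub_cisV s : cabs ((1 - l * cc (cis s))^-1) <= (1 - cabs l)^-1.
Proof.
rewrite cabsV lef_pV2 ?posrE ?subr_gt0//; last first.
  by rewrite cabs_gt0 one_sub_cis_neq0.
by apply: le_trans (ler_cabsB _ _); rewrite cabs1 cabsM cabs_cc cabs_cis mulr1.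
Qed.

(** On the unit circle [1 - l * cc x] equals [(x - l) * cc x], so [ang] is the angular coefficient
    of dx / (x - l). *)
Let ang_cis s : ang s * (cis s - l) = iC * cis s.
Proof.
rewrite /ang -mulrA; congr (_ * _).
rewrite (_ : cis s - l = (1 - l * cc (cis s)) * cis s).
  by rewrite mulrA mulVf ?one_sub_cis_neq0// mul1r.
by rewrite mulrBl mul1r -mulrA (mulrC (cc _)) mulcc cabs_cis expr1n mulr1.
Qed.

Let cis_l s : cabs (cis s - l) <= 2.
Proof. by rewrite (le_trans (cabsD _ _))// cabsN cabs_cis; have := ltW l1; lra. Qed.

Let path_le1 (t s : R) : 0 <= t <= 1 -> cabs (path t s) <= 1.
Proof.
move=> /andP[t0 t1]; rewrite /path (_ : _ + _ = rc (1 - t) * l + rc t * cis s).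
  rewrite (le_trans (cabsD _ _))// !cabsM !cabs_rc cabs_cis !ger0_norm ?subr_ge0//.
  have := ltW l1; have := cabs_ge0 l; nra.
by rewrite rcB rc1; ring.
Qed.

Let path_lipschitz (t s t' s' : R) : 0 <= t <= 1 ->
  cabs (path t' s' - path t s) <= 2 * (`|t' - t| + `|s' - s|).
Proof.
move=> /andP[t0 t1].
rewrite (_ : _ - _ = rc (t' - t) * (cis s' - l) + rc t * (cis s' - cis s)); last first.
  by rewrite /path rcB; ring.
rewrite (le_trans (cabsD _ _))// [leRHS]mulrDr lerD//.
  by rewrite cabsM cabs_rc mulrC ler_wpM2r// cis_l.
rewrite cabsM cabs_rc ger0_norm// (le_trans _ (cis_lipschitz _ _))//.
by rewrite ler_piMl ?cabs_ge0.
Qed.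

Let kpath_cont_t (s t : R) : 0 <= t <= 1 -> k (path x s) @[x --> t] --> k (path t s).
Proof.
move=> t01; have h := derivable_cont (kd (path_le1 s t01)).
apply: (@cvg_comp _ _ _ (path^~ s) k _ _ _ _ h).
apply: cvgD; first exact: cvg_cst.
apply: cvgM; last exact: cvg_cst.
by apply/cvgC_P => e e0; near=> x; rewrite -rcB cabs_rc distrC; near: x;
  apply: cvgr_dist_lt => //; exact: cvg_id.
Unshelve. all: by end_near. Qed.

Let kpath_cont_s (s t : R) : 0 <= t <= 1 -> k (path t x) @[x --> s] --> k (path t s).
Proof.
move=> t01; have h := derivable_cont (kd (path_le1 s t01)).
apply: (@cvg_comp _ _ _ (path t) k _ _ _ _ h).
apply: cvgD; first exact: cvg_cst.
apply: cvgM; first exact: cvg_cst.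
by apply: cvgB; [exact: cvg_cis|exact: cvg_cst].
Qed.

Lemma cvg_cc_cis (s : R) : cc (cis x) @[x --> s] --> cc (cis s).
Proof.
apply: cvg_ReImC; rewrite ?Re_cc ?Im_cc.
  under eq_cvg do rewrite Re_cc; exact: continuous_cos.
under eq_cvg do rewrite Im_cc; apply: cvgN; exact: continuous_sin.
Qed.

Lemma cvg_one_sub_cisV (s : R) :
  (1 - l * cc (cis x))^-1 @[x --> s] --> (1 - l * cc (cis s))^-1.
Proof.
apply: cvgV; first exact: one_sub_cis_neq0.
apply: cvgB; first exact: cvg_cst.
apply: cvgM; [exact: cvg_cst|exact: cvg_cc_cis].
Qed.

Let ang_cont (s : R) : ang x @[x --> s] --> ang s.
Proof. by apply: cvgM; [exact: cvg_cst|exact: cvg_one_sub_cisV]. Qed.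

Let dtV_cont (t : R) : 0 < t -> rc x^-1 @[x --> t] --> rc t^-1.
Proof.
move=> t0; apply: cvg_ReImC; last exact: cvg_cst.
by rewrite Re_rc; apply: cvgV; rewrite ?gt_eqF//; exact: cvg_id.
Qed.

(** [rect] is the integral of the pulled-back form around the boundary of [a, b] x [c, d], with
    opposite sides paired: [A] collects the two sides where only t moves, [B] the two where only s
    moves. *)
Let A (f : C -> C) c d t := f (path t c) * rc t^-1 - f (path t d) * rc t^-1.
Let B (f : C -> C) a b s := f (path b s) * ang s - f (path a s) * ang s.
Let rect f a b c d : C :=
  cint mu `[a, b]%classic (A f c d) + cint mu `[c, d]%classic (B f a b).

Let A_cont a b c d : 0 < a -> b <= 1 -> contC_on a b (A k c d).
Proof.
move=> a0 b1 t /andP[at_ tb]; have t0 := lt_le_trans a0 at_.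
have t01 : 0 <= t <= 1 by rewrite ltW//= (le_trans tb).
by apply: cvgB; apply: cvgM; [exact: kpath_cont_t|exact: dtV_cont|
  exact: kpath_cont_t|exact: dtV_cont].
Qed.

Let B_cont a b c d : 0 <= a <= 1 -> 0 <= b <= 1 -> contC_on c d (B k a b).
Proof.
move=> ha hb s _.
by apply: cvgB; apply: cvgM; [exact: kpath_cont_s|exact: ang_cont|
  exact: kpath_cont_s|exact: ang_cont].
Qed.

(** The affine part of [k] at a point integrates to exactly 0 around every rectangle, and the
    remainder is o(size) on a boundary whose length is of order the size. The bound [a > 0] keeps dt
    / t under control. *)
Lemma contraction_rectangle_eq0 (a c d : R) : 0 < a <= 1 -> c <= d -> rect k a 1 c d = 0.
Proof.
move=> /andP[a0 a1] cd.
apply: (additive_rectangle_function_eq0 (I := rect k)) => //.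
- move=> a' m b' c' d' h1 h2 h3 h4 h5 h6 h7; rewrite /rect.
  rewrite (@cint_split _ a' m b')//; last by apply/intC_cont/A_cont; lra.
  rewrite -!addrA; congr (_ + _); rewrite addrCA; congr (_ + _).
  rewrite -cintD//; try by apply/intC_cont/B_cont; lra.
  by apply: eq_cint => s _; rewrite /B; ring.
- move=> a' b' c' m d' h1 h2 h3 h4 h5 h6 h7; rewrite /rect.
  rewrite (@cint_split _ c' m d')//; last by apply/intC_cont/B_cont; lra.
  rewrite addrACA; congr (_ + _).
  rewrite -cintD//; try by apply/intC_cont/A_cont; lra.
  by apply: eq_cint => t _; rewrite /A; ring.
move=> t s e tP sP e0.
have t01 : 0 <= t <= 1 by lra.
have [k1 kP] := derivable_derivC (kd (path_le1 s t01)).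
pose M := (1 - cabs l)^-1; have M0 : 0 <= M by rewrite invr_ge0 subr_ge0 ltW.
(* The 4 is two opposite sides times the Lipschitz constant 2 of [path]; [a^-1] and [M] bound the
   coefficients of dt and ds. *)
pose e' := e / (4 * (a^-1 + M)).
have a0' : 0 < a^-1 by rewrite invr_gt0.
have e'0 : 0 < e' by rewrite divr_gt0// mulr_gt0// ltr_wpDr.
have [r r0 hr] := derivC_affine kP e'0.
(* With both sides shorter than r / 4, the 2-Lipschitz [path] stays within r of [p0]. *)
exists (r / 4); first by rewrite divr_gt0.
move=> a' b' c' d' h1 h2 h3 h4 h5 h6 h7 h8 h9 h10.
have [ab' cd'] : a' <= b' /\ c' <= d' by split; lra.
pose p0 := path t s.
(* The constant term cancels between opposite sides. The linear term makes both coefficients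
   explicit: [path] absorbs 1/t on the [A] sides, and [ang_cis] absorbs [ang] on the [B] sides. *)
pose aff x := k p0 + k1 * (x - p0).
pose rem x := k x - k p0 - k1 * (x - p0).
pose P := (b' - a') + (d' - c').
have P0 : 0 <= P by rewrite /P; lra.
have remP x y : a' <= x <= b' -> c' <= y <= d' -> cabs (rem (path x y)) <= e' * (2 * P).
  move=> hx hy.
  have le2 : cabs (path x y - p0) <= 2 * P.
    apply: (le_trans (path_lipschitz _ _ _ t01)); rewrite ler_wpM2l// lerD//.
      by rewrite ler_norml; lra.
    by rewrite ler_norml; lra.
  apply: (le_trans (hr _ _)); last by rewrite ler_wpM2l// ltW.
  by apply: (le_lt_trans le2); rewrite /P; lra.
have int_const_t (q : C) : intC mu `[a', b']%classic (fun=> q).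
  by apply: intC_cst => //; exact: lebesgue_segment_lty.
have iA : intC mu `[a', b']%classic (A k c' d') by apply/intC_cont/A_cont; lra.
have iB : intC mu `[c', d']%classic (B k a' b') by apply/intC_cont/B_cont; lra.
have AffA x : a' <= x <= b' -> A aff c' d' x = k1 * (cis c' - cis d').
  move=> /andP[hx _]; have x0 : rc x != 0 :> C.
    by apply/eqP => /(@rcI _ _ 0) x0; move: hx; rewrite x0; lra.
  by rewrite /A /aff /path rcV; field.
have AffB y : B aff a' b' y = k1 * rc (b' - a') * (iC * cis y).
  rewrite -ang_cis /B /aff /path rcB; ring.
have cB : contC_on c' d' (fun y => k1 * rc (b' - a') * (iC * cis y)).
  move=> y _; apply: cvgM; first exact: cvg_cst.
  by apply: cvgM; [exact: cvg_cst|exact: cvg_cis].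
have iBaff : intC mu `[c', d']%classic (B aff a' b').
  by apply: intC_eq (intC_cont cB) => // y _; rewrite AffB.
have iAaff : intC mu `[a', b']%classic (A aff c' d').
  apply: intC_eq (int_const_t (k1 * (cis c' - cis d'))) => //.
  by move=> x; rewrite inE /= in_itv /= => hx; rewrite AffA.
have EA : cint mu `[a', b']%classic (A aff c' d') = k1 * (cis c' - cis d') * rc (b' - a').
  rewrite -cint_segment_cst//; apply: eq_cint => x.
  by rewrite inE /= in_itv /= => hx; rewrite AffA.
have EB : cint mu `[c', d']%classic (B aff a' b') = k1 * rc (b' - a') * (cis d' - cis c').
  rewrite -cint_cis// -cintZ//; first by apply: eq_cint => y _; rewrite AffB.
  apply: intC_cont => y _; apply: cvgM; [exact: cvg_cst|exact: cvg_cis].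
have aff0 : rect aff a' b' c' d' = 0 by rewrite /rect EA EB; ring.
have remE : rect k a' b' c' d' = rect rem a' b' c' d'.
  rewrite -[LHS]subr0 -[in LHS]aff0 /rect opprD addrACA -!cintB//.
  by congr (_ + _); apply: eq_cint => x _; rewrite /A /B /rem /aff; ring.
rewrite remE /rect.
have iAr : intC mu `[a', b']%classic (A rem c' d').
  by apply: intC_eq (intCB _ iA iAaff) => // x _; rewrite /A /rem /aff; ring.
have iBr : intC mu `[c', d']%classic (B rem a' b').
  by apply: intC_eq (intCB _ iB iBaff) => // x _; rewrite /B /rem /aff; ring.
rewrite (le_trans (cabsD _ _))//.
have leA : cabs (cint mu `[a', b']%classic (A rem c' d')) <=
    (e' * (2 * P) * a^-1 + e' * (2 * P) * a^-1) * (b' - a').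
  apply: le_cabs_cint_segment => // x hx.
  have leV : cabs (rc x^-1 : C) <= a^-1.
    have ax : a <= x by case/andP: hx => hx _; exact: le_trans h1 hx.
    have x0 : 0 < x by exact: lt_le_trans a0 ax.
    by rewrite cabs_rc ger0_norm ?invr_ge0 ?(ltW x0)// lef_pV2.
  rewrite (le_trans (cabsD _ _))// cabsN lerD// cabsM ler_pM ?cabs_ge0 ?remP// lexx ?cd'//.
have leB : cabs (cint mu `[c', d']%classic (B rem a' b')) <=
    (e' * (2 * P) * M + e' * (2 * P) * M) * (d' - c').
  apply: le_cabs_cint_segment => // y hy.
  have leV : cabs (ang y) <= M.
    by rewrite /ang cabsM cabs_iC mul1r; exact: cabs_one_sub_cisV.
  rewrite (le_trans (cabsD _ _))// cabsN lerD// cabsM ler_pM ?cabs_ge0 ?remP// lexx ?ab'//.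
rewrite (le_trans (lerD leA leB))//.
have -> : e * (b' - a' + (d' - c')) ^+ 2 = e' * (4 * (a^-1 + M)) * P ^+ 2.
  by rewrite /e' divfK// gt_eqF// mulr_gt0// ltr_wpDr.
have e'P : 0 <= e' * P by rewrite mulr_ge0// ltW.
have Q0 : 0 <= d' - c' by rewrite subr_ge0.
have Q1 : 0 <= b' - a' by rewrite subr_ge0.
rewrite [leLHS](_ : _ = 4 * (e' * P) * (a^-1 * (b' - a') + M * (d' - c'))); last by ring.
rewrite [leRHS](_ : _ = 4 * (e' * P) * ((a^-1 + M) * P)); last by ring.
apply: ler_wpM2l; first exact: mulr_ge0.
rewrite [leRHS]mulrDl; apply: lerD; apply: ler_wpM2l => //; first exact: ltW.
  by rewrite /P lerDl.
by rewrite /P lerDr.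
Qed.

Lemma circle_integral_contract (a : R) : 0 < a <= 1 ->
  cint mu `[0, 2 * pi]%classic (fun s => k (cis s) * (iC * (1 - l * cc (cis s))^-1)) =
  cint mu `[0, 2 * pi]%classic
    (fun s => k (l + rc a * (cis s - l)) * (iC * (1 - l * cc (cis s))^-1)).
Proof.
move=> a01; have /andP[a0 a1] := a01.
have pi0 : 0 <= 2 * pi :> R by rewrite mulr_ge0 ?pi_ge0.
(* The sides s = 0 and s = 2 pi cancel by periodicity, leaving the outer circle t = 1 and the
   contracted one t = a. *)
have := contraction_rectangle_eq0 a01 pi0; rewrite /rect (@eq_cint _ _ _ _ _ _ (fun=> 0)); last first.
  by move=> t _; rewrite /A /path cis0 cis2pi subrr.
have a01' : 0 <= a <= 1 by rewrite a1 ltW.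
have o01 : 0 <= (1 : R) <= 1 by rewrite ler01 lexx.
rewrite cint0// add0r cintB//; [| by apply: intC_cont => s _;
  apply: cvgM; [exact: kpath_cont_s|exact: ang_cont]..].
move=> /eqP; rewrite subr_eq0 => /eqP <-.
by apply: eq_cint => s _; rewrite /path rc1 mul1r (addrC l) subrK.
Qed.

Lemma circle_kernel_intC : intC mu `[0, 2 * pi]%classic (fun s => (1 - l * cc (cis s))^-1).
Proof. by apply: intC_cont => s _; exact: cvg_one_sub_cisV. Qed.

(** As the contracted circle shrinks to [l], the values of [k] on it tend uniformly to [k l], while
    the kernel stays bounded by [M]. *)
Lemma circle_integral_limit :
  cint mu `[0, 2 * pi]%classic (fun s => k (cis s) * (iC * (1 - l * cc (cis s))^-1)) =
  k l * (iC * cint mu `[0, 2 * pi]%classic (fun s => (1 - l * cc (cis s))^-1)).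
Proof.
have pi0 : 0 <= 2 * pi :> R by rewrite mulr_ge0 ?pi_ge0.
have iang : intC mu `[0, 2 * pi]%classic (fun s => iC * (1 - l * cc (cis s))^-1).
  by apply: intCZ => //; exact: circle_kernel_intC.
rewrite -cintZ//; last exact: circle_kernel_intC.
rewrite -cintZ//.
apply/eqP; rewrite -subr_eq0; apply/eqP; apply: cabs0_eq.
apply/eqP; rewrite eq_le cabs_ge0 andbT; apply/ler_addgt0Pr => e e0; rewrite add0r.
pose M := (1 - cabs l)^-1; have M0 : 0 <= M by rewrite invr_ge0 subr_ge0 ltW.
pose N := M * (2 * pi) + 1.
have N0 : 0 < N by rewrite ltr_wpDl// mulr_ge0.
have := derivable_cont (kd (ltW l1)); move=> /(@cvgC_P _ _ (nbhs l) _).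
move=> /(_ (e / N)); rewrite divr_gt0// => /(_ isT) /nbhsC_P[r r0 hr].
(* Points of the contracted circle are within 2a of [l], and 2a <= 2r / 3 < r. *)
pose a := Num.min 1 (r / 3).
have a0 : 0 < a by rewrite lt_min ltr01 divr_gt0.
have a1 : a <= 1 by rewrite ge_min lexx.
have ar : a * 2 < r.
  by apply: (@le_lt_trans _ _ (r / 3 * 2)); [rewrite ler_wpM2r// ge_min lexx orbT|lra].
rewrite (@circle_integral_contract a) ?a0//.
have ik : intC mu `[0, 2 * pi]%classic
    (fun s => k (l + rc a * (cis s - l)) * (iC * (1 - l * cc (cis s))^-1)).
  apply: (@intC_cont _ _ _ (fun s : R => k (path a s) * ang s)) => s _.
  by apply: cvgM; [apply: kpath_cont_s; rewrite a1 ltW|exact: ang_cont].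
rewrite -cintB//; last exact: intCZ.
apply: (@le_trans _ _ (e / N * M * (2 * pi))).
  rewrite -[X in _ <= _ * X]subr0; apply: le_cabs_cint_segment => //.
    by apply: intCB => //; exact: intCZ.
  move=> s _; rewrite -mulrBl cabsM ler_pM ?cabs_ge0//.
    apply/ltW/hr; rewrite addrC addKr cabsM cabs_rc ger0_norm ?(ltW a0)//.
    by apply: le_lt_trans ar; rewrite ler_wpM2l ?(ltW a0).
  by rewrite cabsM cabs_iC mul1r; exact: cabs_one_sub_cisV.
by rewrite -mulrA mulrAC ler_pdivrMr// ler_wpM2l ?(ltW e0)// /N lerDl.
Qed.

End CircleCauchy.

(** * The mean of the Cauchy kernel, and Cauchy's formula *)

Section CauchyFormula.
Context {R : realType}.
Local Notation C := (CC R).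
Local Notation mu := (@lebesgue_measure R).

Lemma cisM (s t : R) : cis (s + t) = cis s * cis t.
Proof.
by apply: C_eq; rewrite ?ReCM ?ImCM ?Re_cis ?Im_cis ?cosD ?sinD//; ring.
Qed.

Lemma cisX (s : R) n : cis s ^+ n = cis (n%:R * s).
Proof.
elim: n => [|n IH]; first by rewrite expr0 mul0r cis0.
by rewrite exprS IH -cisM -natr1 mulrDl mul1r addrC.
Qed.

Lemma cint_cisX n : (0 < n)%N -> cint mu `[0, 2 * pi]%classic (fun s => cis s ^+ n) = 0.
Proof.
move=> n0; have pi0 : 0 <= 2 * pi :> R by rewrite mulr_ge0 ?pi_ge0.
have nR : n%:R != 0 :> R by rewrite pnatr_eq0 -lt0n.
have cisn2pi : cis (n%:R * (2 * pi : R)) = 1 by rewrite -(cisX (2 * pi) n) cis2pi expr1n.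
(* A primitive of [cis s ^+ n], periodic because [n] is an integer. *)
pose F (s : R) : C := (rc n%:R)^-1 * - iC * cis (n%:R * s).
have FE s : F s = Complex (n%:R^-1 * sin (n%:R * s)) (n%:R^-1 * - cos (n%:R * s)).
  apply: C_eq; rewrite /F -rcV !(ReCM, ImCM) ReCN ImCN Re_cis Im_cis Re_rc Im_rc /iC /ReC /ImC /=;
    ring.
have -> : cint mu `[0, 2 * pi]%classic (fun s => cis s ^+ n) = F (2 * pi) - F 0; last first.
  by rewrite /F cisn2pi mulr0 cis0 subrr.
apply: cint_FTC => //.
- move=> x s _; have h : continuous (fun x : R => cis (n%:R * x)).
    move=> y; apply: (@continuous_comp _ _ _ (fun x : R => n%:R * x) (@cis R)); last exact: cvg_cis.
    by apply: cvgM; [exact: cvg_cst|exact: cvg_id].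
  under eq_cvg do rewrite cisX; rewrite cisX; exact: h.
- move=> x; rewrite cisX Re_cis (_ : _ \o _ = fun s => n%:R^-1 * sin (n%:R * s)); last first.
    by apply/funext => s; exact: (congr1 ReC (FE s)).
  apply: is_derive_eq; rewrite /GRing.scale /=; field; exact: nR.
- move=> x; rewrite cisX Im_cis (_ : _ \o _ = fun s => n%:R^-1 * - cos (n%:R * s)); last first.
    by apply/funext => s; exact: (congr1 ImC (FE s)).
  apply: is_derive_eq; rewrite /GRing.scale /=; field; exact: nR.
Qed.

Lemma cisX_cont n (s : R) : cis x ^+ n @[x --> s] --> cis s ^+ n.
Proof.
elim: n => [|n IH]; first exact: cvg_cst.
under eq_cvg do rewrite exprS; rewrite exprS.
exact: (cvgM (@cvg_cis R s) IH).
Qed.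

Lemma geometric_remainder (u : C) n : 1 - u != 0 ->
  (1 - u)^-1 = \sum_(i < n) u ^+ i + u ^+ n * (1 - u)^-1.
Proof.
move=> u1; apply: (mulIf u1); rewrite mulVf// mulrDl -mulrA mulVf// mulr1.
by have := subrX1 u n => h; rewrite -[X in _ = X + _]opprK -mulrN opprB mulrC -h; ring.
Qed.

(** Expand the kernel in a geometric series, uniformly convergent as |l| < 1: only the constant term
    has a nonzero mean over the circle. *)
Lemma cint_circle_kernel (l : C) : cabs l < 1 ->
  cint mu `[0, 2 * pi]%classic (fun s => (1 - l * cc (cis s))^-1) = rc (2 * pi).
Proof.
move=> l1; have pi0 : 0 <= 2 * pi :> R by rewrite mulr_ge0 ?pi_ge0.
pose G n (s : R) : C := \sum_(i < n) (l * cc (cis s)) ^+ i.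
have term i : intC mu `[0, 2 * pi]%classic (fun s => (l * cc (cis s)) ^+ i).
  have : intC mu `[0, 2 * pi]%classic (fun s => l ^+ i * cc (cis s ^+ i)).
    apply: intCZ => //; apply: intC_cc => //; apply: intC_cont => s _; exact: cisX_cont.
  by apply: intC_eq => // s _; rewrite exprMn ccX.
have termE i : cint mu `[0, 2 * pi]%classic (fun s => (l * cc (cis s)) ^+ i) =
    if i == 0%N then rc (2 * pi) else 0.
  transitivity (cint mu `[0, 2 * pi]%classic (fun s => l ^+ i * cc (cis s ^+ i))).
    by apply: eq_cint => s _; rewrite exprMn ccX.
  rewrite cintZ//; last first.
    apply: intC_cc => //; apply: intC_cont => s _; exact: cisX_cont.
  rewrite cint_cc//; last by apply: intC_cont => s _; exact: cisX_cont.
  case: i => [|i]; rewrite [RHS]/=; last first.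
    rewrite (_ : cint _ _ _ = 0); last exact: cint_cisX.
    by rewrite -rc0 cc_rc rc0 mulr0.
  rewrite (_ : cint _ _ _ = rc (2 * pi)); first by rewrite cc_rc expr0 mul1r.
  by have := @cint_segment_cst R 0 (2 * pi) 1 pi0; rewrite mul1r subr0.
have GE n : cint mu `[0, 2 * pi]%classic (G n.+1) = rc (2 * pi).
  rewrite cint_sum//; under eq_bigr do rewrite termE.
  by rewrite big_ord_recl /= big1 ?addr0.
apply/eqP; rewrite -subr_eq0; apply/eqP; apply: cabs0_eq.
apply/eqP; rewrite eq_le cabs_ge0 andbT; apply/ler_addgt0Pr => e e0; rewrite add0r.
pose M := (1 - cabs l)^-1; have M0 : 0 <= M by rewrite invr_ge0 subr_ge0 ltW.
pose N := M * (2 * pi) + 1.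
have N0 : 0 < N by rewrite ltr_wpDl// mulr_ge0.
have [n hn] : exists n, cabs l ^+ n <= e / N.
  have : (cabs l) ^+ n @[n --> \oo] --> (0 : R).
    by apply: cvg_expr; rewrite ger0_norm ?cabs_ge0.
  move=> /cvgrPdist_le/(_ (e / N)); rewrite divr_gt0// => /(_ isT) [n _ /(_ n (leqnn n))].
  by rewrite sub0r normrN ger0_norm ?exprn_ge0 ?cabs_ge0//; exists n.
rewrite -(GE n) -cintB//; [|exact: circle_kernel_intC|exact: intC_sum].
apply: (@le_trans _ _ (e / N * M * (2 * pi))); last first.
  by rewrite -mulrA mulrAC ler_pdivrMr// ler_wpM2l ?(ltW e0)// /N lerDl.
rewrite -[X in _ <= _ * X]subr0; apply: le_cabs_cint_segment => //.
  by apply: intCB => //; [exact: circle_kernel_intC|exact: intC_sum].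
move=> s _; rewrite {1}(geometric_remainder n.+1 (one_sub_cis_neq0 l1 s)) addrC addKr.
rewrite cabsM ler_pM ?cabs_ge0//; last exact: cabs_one_sub_cisV.
rewrite cabsX cabsM cabs_cc cabs_cis mulr1 (le_trans _ hn)// exprS ler_piMl ?exprn_ge0 ?cabs_ge0//.
exact: ltW.
Qed.

(** At [x = cis s] the form dx / (x - l) is [iC * (1 - l * cc x)^-1] ds; the factor [iC] is
    cancelled from both sides. *)
Lemma circle_cauchy_formula (k : C -> C) (l : C) :
  (forall x : C, cabs x <= 1 -> derivable k x 1) -> cabs l < 1 ->
  cint mu `[0, 2 * pi]%classic (fun s => k (cis s) * (1 - l * cc (cis s))^-1) =
  rc (2 * pi) * k l.
Proof.
move=> kd l1; have := circle_integral_limit kd l1.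
have iC0 : iC != 0 :> C by rewrite -cabs_gt0 cabs_iC.
rewrite cint_circle_kernel// mulrCA [X in _ = iC * X]mulrC => h; apply: (mulfI iC0).
rewrite -h -cintZ//; first by apply: eq_cint => s _; ring.
apply: intC_cont => s _; apply: cvgM; last exact: cvg_one_sub_cisV.
have kc : derivable k (cis s) 1 by apply: kd; rewrite cabs_cis.
exact: (cvg_comp (@cis R) k (@cvg_cis R s) (derivable_cont kc)).
Qed.

End CauchyFormula.

(** * Rotation invariance of the area *)

Section MeasurePreserving.
Context {R : realType}.
Local Notation T1 := (measurableTypeR R).
Local Notation plane := (T1 * T1)%type.
Local Notation mu := (@lebesgue_measure R).
(** Named so that the sigma-finite structure required by Fubini's theorem can be attached to the
    product measure. *)
Definition area : set plane -> \bar R := (mu \x mu)%E.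
HB.instance Definition _ := Measure.on area.

Let area_sigma_finite : sigma_finite setT area.
Proof.
pose F (n : nat) : set T1 := `[- n%:R, n%:R]%classic.
have mF n : measurable (F n) by exact: measurable_itv.
exists (fun n => F n `*` F n) => [|n]; last first.
  split; first exact: measurableX.
  rewrite /area product_measure1E// lte_mul_pinfty// ?ge0_fin_numE//; exact: lebesgue_segment_lty.
apply/seteqP; split => // -[x y] _; exists (Num.truncn (Num.max `|x| `|y|)).+1 => //.
have : Num.max `|x| `|y| <= (Num.truncn (Num.max `|x| `|y|)).+1%:R by exact/ltW/truncnS_gt.
by rewrite ge_max => /andP[hx hy]; split; rewrite /F /= in_itv /= -ler_norml.
Qed.

HB.instance Definition _ := Measure_isSigmaFinite.Build _ _ _ area area_sigma_finite.

Lemma measurable_translate (c : R) : measurable_fun [set: T1] (fun y : T1 => (y + c : T1)).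
Proof. by apply: measurable_funD => //; exact: measurable_cst. Qed.

Lemma lebesgue_translate (c : R) (A : set T1) : measurable A ->
  mu ((fun y : T1 => (y + c : T1)) @^-1` A) = mu A.
Proof.
move=> mA; have mt := measurable_translate c.
suff : pushforward mu (fun y : T1 => (y + c : T1)) A = mu A by [].
apply/esym/lebesgue_measure_unique => //= _ [[a b]] _ <-.
rewrite /pushforward.
rewrite (_ : _ @^-1` _ = `](a - c), (b - c)]%classic).
  rewrite !lebesgue_measure_itv/= !lte_fin ltrD2r.
  by case: ifP => // _; rewrite -!EFinB; congr EFin; ring.
by apply/seteqP; split => x /=; rewrite !in_itv /= ltrBlDr lerBrDr.
Qed.

Definition preserves_area (f : plane -> plane) := measurable_fun [set: plane] f /\
  forall A, measurable A -> area (f @^-1` A) = area A.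

Lemma preserves_area_comp f g : preserves_area f -> preserves_area g ->
  preserves_area (f \o g).
Proof.
move=> [mf hf] [mg hg]; split; first exact: measurableT_comp.
move=> A mA; rewrite comp_preimage hg ?hf//.
by rewrite -[X in measurable X]setTI; exact: mf.
Qed.

(** On each vertical line the shear is a translation, so every section keeps its measure. *)
Lemma preserves_area_yshear (a : R) :
  preserves_area (fun p : plane => (p.1, p.2 + a * p.1) : plane).
Proof.
have ms : measurable_fun [set: plane] (fun p : plane => (p.1, p.2 + a * p.1) : plane).
  apply: measurable_fun_pair; first exact: measurable_fst.
  apply: measurable_funD; first exact: measurable_snd.
  apply: measurable_funM; [exact: measurable_cst|exact: measurable_fst].
split=> // A mA; apply: eq_integral => x _ /=.
rewrite -[RHS](lebesgue_translate (a * x)); last exact: measurable_xsection.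
by congr (mu _); rewrite !xsectionE.
Qed.

(** Slicing horizontally instead of vertically is what the other family of shears requires. *)
Lemma areaE2 (A : set plane) : measurable A -> area A = (mu \x^ mu)%E A.
Proof.
move=> mA; apply: product_measure_unique => // B C mB mC.
by rewrite /= product_measure2E.
Qed.

Lemma preserves_area_xshear (a : R) :
  preserves_area (fun p : plane => (p.1 + a * p.2, p.2) : plane).
Proof.
have ms : measurable_fun [set: plane] (fun p : plane => (p.1 + a * p.2, p.2) : plane).
  apply: measurable_fun_pair; last exact: measurable_snd.
  apply: measurable_funD; first exact: measurable_fst.
  apply: measurable_funM; [exact: measurable_cst|exact: measurable_snd].
split=> // A mA.
rewrite !areaE2//; last by rewrite -[X in measurable X]setTI; exact: ms.
apply: eq_integral => y _ /=.
rewrite -[RHS](lebesgue_translate (a * y)); last exact: measurable_ysection.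
by congr (mu _); rewrite !ysectionE.
Qed.

Definition linear2 (c s : R) (p : plane) : plane := (c * p.1 - s * p.2, s * p.1 + c * p.2).

(* A rotation is a product of three shears, unless its sine vanishes. *)
Lemma preserves_area_rotation (c s : R) : c ^+ 2 + s ^+ 2 = 1 ->
  preserves_area (linear2 c s).
Proof.
have gen (c' s' : R) : s' != 0 -> c' ^+ 2 + s' ^+ 2 = 1 -> preserves_area (linear2 c' s').
  (* Minus the tangent of half the angle whose cosine and sine are c' and s'. *)
  move=> s0 cs; pose a := (c' - 1) / s'.
  have -> : linear2 c' s' = (fun p : plane => (p.1 + a * p.2, p.2) : plane) \o
     ((fun p : plane => (p.1, p.2 + s' * p.1) : plane) \o
      (fun p : plane => (p.1 + a * p.2, p.2) : plane)).
    apply/funext => -[x y]; rewrite /linear2 /=.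
    have as' : a * s' = c' - 1 by rewrite /a divfK.
    have ac : a * (c' + 1) = - s'.
      apply: (mulIf s0); rewrite mulrAC as' mulNr -expr2.
      by rewrite -[s' ^+ 2](addrK (c' ^+ 2)) [s' ^+ 2 + _]addrC cs; ring.
    congr (_, _).
      have ac' : a * (a * s') + 2 * a = - s' by rewrite as' -ac; ring.
      transitivity (x + (a * s') * x + (a * (a * s') + 2 * a) * y); last by ring.
      by rewrite ac' as'; ring.
    transitivity (s' * x + (1 + a * s') * y); last by ring.
    by rewrite as'; ring.
  apply: preserves_area_comp; first exact: preserves_area_xshear.
  by apply: preserves_area_comp; [exact: preserves_area_yshear|exact: preserves_area_xshear].
move=> cs; have [s0|s0] := eqVneq s 0; last exact: gen.
(* A zero sine leaves the identity and the half turn; the latter is two quarter turns. *)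
have quarter : preserves_area (linear2 0 1) by apply: gen; rewrite ?oner_eq0// expr0n expr1n add0r.
have [c1|c1] : c = 1 \/ c = -1.
  move: cs; rewrite s0 expr0n addr0 => /eqP; rewrite sqrf_eq1 => /orP[] /eqP; by [left|right].
- have -> : linear2 c s = id by apply/funext => -[x y]; rewrite /linear2 s0 c1 /= !mul0r !mul1r subr0 add0r.
  by split.
- have -> : linear2 c s = linear2 0 1 \o linear2 0 1.
    by apply/funext => -[x y]; rewrite /linear2 s0 c1 /=; congr (_, _); ring.
  exact: preserves_area_comp.
Qed.

Lemma preserves_area_integral (f : plane -> plane) (g : plane -> \bar R) :
  preserves_area f -> measurable_fun setT g -> (forall p, (0 <= g p)%E) ->
  (\int[area]_p g (f p) = \int[area]_p g p)%E.
Proof.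
move=> [mf hf] mg g0; have := @ge0_integral_pushforward _ _ _ _ R f mf area setT g.
rewrite preimage_setT => /(_ measurableT mg) <-; last by move=> y _.
by apply: eq_measure_integral => // A mA _; exact: hf.
Qed.

Lemma integrable_preserves_area (f : plane -> plane) (g : plane -> R) :
  preserves_area f -> area.-integrable setT (EFin \o g) ->
  area.-integrable setT (EFin \o (g \o f)).
Proof.
move=> pf /integrableP[/measurable_EFinP mg ig]; apply/integrableP; split.
  by apply/measurable_EFinP; apply: measurableT_comp => //; case: pf.
rewrite (@preserves_area_integral f (fun p => (`|g p|%:E)%E))//.
by apply/measurable_EFinP; apply: measurableT_comp.
Qed.

Lemma integral_preserves_area (f : plane -> plane) (g : plane -> R) :
  preserves_area f -> area.-integrable setT (EFin \o g) ->
  (\int[area]_p (g (f p))%:E = \int[area]_p (g p)%:E)%E.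
Proof.
move=> pf ig; have mg := measurable_int _ ig.
have [mf hf] := pf.
have := @integral_pushforward _ _ _ _ R f mf area setT (EFin \o g) mg.
rewrite preimage_setT => /(_ (integrable_preserves_area pf ig) measurableT) <-.
by apply: eq_measure_integral => // A mA _; exact: hf.
Qed.

(** * From area to normalized area, and rotations of the disk *)

Lemma integrable_mscale d (T : measurableType d) (m : {measure set T -> \bar R})
    (k : {nonneg R}) (D : set T) (f : T -> \bar R) : 0 < k%:num -> measurable D ->
  (mscale k m).-integrable D f <-> m.-integrable D f.
Proof.
move=> k0 mD; split=> /integrableP[mf h]; apply/integrableP; split=> //; move: h;
  rewrite ge0_integral_mscale//; try exact: measurableT_comp.
  have : (0 <= \int[m]_(x in D) `|f x|)%E by exact: integral_ge0.
  case: (\int[m]_(x in D) `|f x|)%E => [r||]//; first by move=> *; rewrite ltry.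
  by move=> _; rewrite mulry gtr0_sg// mul1e.
by move=> h; rewrite lte_mul_pinfty// lee_fin ltW.
Qed.

Lemma Rintegral_mscale d (T : measurableType d) (m : {measure set T -> \bar R})
    (k : {nonneg R}) (D : set T) (f : T -> R) : 0 < k%:num -> measurable D ->
  m.-integrable D (EFin \o f) ->
  Rintegral (mscale k m) D f = k%:num * Rintegral m D f.
Proof.
move=> k0 mD intf; have intf' := (@integrable_mscale _ _ m k D (EFin \o f) k0 mD).2 intf.
have mf := measurable_int _ intf.
rewrite /Rintegral integralE [in RHS]integralE.
rewrite !ge0_integral_mscale//; [|exact: measurable_funeneg|exact: measurable_funepos].
have [p1 p2] := (integrable_pos_fin_num mD intf, integrable_neg_fin_num mD intf).
rewrite -muleBr//; last exact: fin_num_adde_defr.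
by rewrite fineM// fin_numB p1 p2.
Qed.

Lemma integrable_dA (D : set plane) (f : plane -> \bar R) : measurable D ->
  dA.-integrable D f <-> area.-integrable D f.
Proof. by move=> mD; apply: integrable_mscale => //=; rewrite invr_gt0 pi_gt0. Qed.

Lemma Rintegral_dA (D : set plane) (f : plane -> R) : measurable D ->
  area.-integrable D (EFin \o f) ->
  Rintegral dA D f = pi^-1 * Rintegral area D f.
Proof. by move=> mD; apply: Rintegral_mscale => //=; rewrite invr_gt0 pi_gt0. Qed.

Lemma measurable_of_xy D : mC D (of_xy : plane -> CC R).
Proof.
split; first exact: measurable_funS measurable_fst.
exact: measurable_funS measurable_snd.
Qed.

Lemma disk_xyE (p : plane) : disk_xy p <-> cabs (of_xy p) < 1.
Proof. exact: unit_diskE. Qed.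

Lemma measurable_disk_cabs (r : R) : measurable [set p : plane | cabs (of_xy p) < r].
Proof.
rewrite (_ : [set p | _] = setT `&` (fun p : plane => cabs (of_xy p)) @^-1` `]-oo, r[).
  by apply: (measurable_cabs (measurable_of_xy setT)) => //; exact: measurable_itv.
by rewrite setTI; apply/seteqP; split => p /=; rewrite in_itv.
Qed.

Lemma measurable_disk : measurable (disk_xy : set plane).
Proof.
rewrite (_ : disk_xy = [set p | cabs (of_xy p) < 1]); first exact: measurable_disk_cabs.
by apply/seteqP; split => p /= /disk_xyE.
Qed.

Definition rotate (s : R) : plane -> plane := linear2 (cos s) (sin s).

Lemma rotateE s p : of_xy (rotate s p) = cis s * of_xy p.
Proof.
apply: C_eq; rewrite ?ReCM ?ImCM ?Re_cis ?Im_cis /of_xy /rotate /linear2 /ReC /ImC /=; ring.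
Qed.

Lemma preserves_area_rotate s : preserves_area (rotate s).
Proof. by apply: preserves_area_rotation; rewrite cos2Dsin2. Qed.

Lemma disk_rotate s p : disk_xy (rotate s p) <-> disk_xy p.
Proof. by rewrite !disk_xyE rotateE cabsM cabs_cis mul1r. Qed.

(** Joint measurability in angle and point, as Fubini's theorem requires. *)
Lemma measurable_rotate : measurable_fun setT (fun q : T1 * plane => rotate q.1 q.2).
Proof.
have mx : measurable_fun setT (fun q : T1 * plane => q.2.1).
  by apply: (measurableT_comp measurable_fst); exact: measurable_snd.
have my : measurable_fun setT (fun q : T1 * plane => q.2.2).
  by apply: (measurableT_comp measurable_snd); exact: measurable_snd.
have mc : measurable_fun setT (fun q : T1 * plane => cos q.1 : T1).
  apply: (measurableT_comp _ measurable_fst).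
  by apply: continuous_measurable_fun; exact: continuous_cos.
have ms : measurable_fun setT (fun q : T1 * plane => sin q.1 : T1).
  apply: (measurableT_comp _ measurable_fst).
  by apply: continuous_measurable_fun; exact: continuous_sin.
apply: measurable_fun_pair.
  by apply: measurable_funB; exact: measurable_funM.
by apply: measurable_funD; exact: measurable_funM.
Qed.

(** Fubini's theorem: integrating over the plane first, every angle contributes the same integral of
    [g] by rotation invariance. *)
Lemma Rintegral_average (g : plane -> R) :
  area.-integrable disk_xy (EFin \o g) ->
  (forall p, disk_xy p -> mu.-integrable `[0, 2 * pi]%classic (EFin \o (fun s => g (rotate s p)))) ->
  \int[area]_(p in disk_xy) \int[mu]_(s in `[0, 2 * pi]) g (rotate s p) =
  2 * pi * \int[area]_(p in disk_xy) g p.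
Proof.
move=> ig irot; have mD := measurable_disk.
have pi0 : 0 <= 2 * pi :> R by rewrite mulr_ge0 ?pi_ge0.
(* Extension by zero lets area preservation be used on the whole plane; the disk is rotation
   invariant, so nothing is lost. *)
pose g0 := g \_ disk_xy.
have ig0 : area.-integrable setT (EFin \o g0).
  by rewrite -restrict_EFin; apply/integrable_restrict => //; rewrite setTI.
have mg0 : measurable_fun setT g0 by have /measurable_EFinP := measurable_int _ ig0.
pose I : set T1 := `[0, 2 * pi]%classic.
have mI : measurable I by exact: measurable_itv.
have muI : mu I = (2 * pi)%:E.
  by rewrite /I lebesgue_measure_itv /= lte_fin mulr_gt0 ?pi_gt0// -EFinB subr0.
pose h (q : T1 * plane) : \bar R := (\1_I q.1 * g0 (rotate q.1 q.2))%:E.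
have mh : measurable_fun setT h.
  apply/measurable_EFinP/measurable_funM.
    by apply: (measurableT_comp _ measurable_fst); exact: measurable_indic.
  by apply: (measurableT_comp mg0); exact: measurable_rotate.
have abs_rot s : (\int[area]_p `|g0 (rotate s p)|%:E = \int[area]_p `|g0 p|%:E)%E.
  apply: (@preserves_area_integral (rotate s) (fun p => (`|g0 p|%:E)%E)) => //.
    exact: preserves_area_rotate.
  by apply/measurable_EFinP/measurableT_comp.
have ih : ((mu : {sigma_finite_measure set T1 -> \bar R}) \x area)%E.-integrable setT h.
  apply/integrable12ltyP => //.
  have /integrableP[_] := ig0; set J := (X in (X < _)%E) => J0.
  have inner s : (\int[area]_p `|h (s, p)| = (\1_I s)%:E * J)%E.
    under eq_integral do rewrite /h /= normrM EFinM ger0_norm//.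
    rewrite ge0_integralZl//; first by rewrite abs_rot.
    apply/measurable_EFinP/measurableT_comp => //; apply: (measurableT_comp mg0).
    by case: (preserves_area_rotate s).
  under eq_integral do rewrite inner.
  rewrite ge0_integralZr//.
  - rewrite integral_indic// setIT lte_mul_pinfty//.
    by rewrite ge0_fin_numE//; exact: lebesgue_segment_lty.
  - by apply/measurable_EFinP; exact: measurable_indic.
  - exact: integral_ge0.
have := Fubini ih.
rewrite (@eq_integral _ _ _ mu _ (fun s => ((\1_I s)%:E * \int[area]_p (g0 p)%:E)%E)); last first.
  move=> s _; rewrite /h /=; under eq_integral do rewrite EFinM.
  rewrite integralZl//; last exact: (integrable_preserves_area (preserves_area_rotate s) ig0).
  by rewrite (integral_preserves_area (preserves_area_rotate s) ig0).
rewrite -(fineK (integrable_fin_num measurableT ig0)) -/(Rintegral area setT g0).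
under eq_integral do rewrite -EFinM.
rewrite (_ : (\int[mu]_s _)%E = (2 * pi * Rintegral area setT g0)%:E); last first.
  under eq_integral do rewrite EFinM.
  rewrite integralZr//; last first.
    exact: integrable_indic_itv.
  by rewrite integral_indic// setIT -[X in (X * _)%E]/(mu I) muI -EFinM.
move=> /(congr1 fine) /= fub.
rewrite (Rintegral_mkcond _ _ g) -/g0 fub /Rintegral integral_mkcond; congr fine.
apply: eq_integral => p _; rewrite patchE; case: ifPn => [|/negP] pD.
  (* Integrability along the circle through [p] makes the inner integral finite, so [fine] can be
     undone. *)
  rewrite inE in pD; rewrite fineK; last exact: integrable_fin_num (irot _ pD).
  rewrite integral_mkcond; apply: eq_integral => s _.
  have rp : rotate s p \in disk_xy by rewrite inE; exact/disk_rotate.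
  rewrite /h /= patchE indicE /g0 patchE rp.
  by case: ifPn => _; rewrite ?mul1r ?mul0r.
rewrite integral0_eq// => s _; rewrite /h /= /g0 patchE.
by rewrite memNset ?mulr0// => /disk_rotate h'; apply: pD; rewrite inE.
Qed.

End MeasurePreserving.

(** * Distribution of the squared modulus *)

Section DiskArea.
Context {R : realType}.
Local Notation T1 := (measurableTypeR R).
Local Notation plane := (T1 * T1)%type.
Local Notation mu := (@lebesgue_measure R).

Lemma integral_half_circle (r : R) : 0 < r ->
  (\int[mu]_(x in `[(- r)%R, r]) (2 * Num.sqrt (r ^+ 2 - x ^+ 2))%R%:E = (pi * r ^+ 2)%R%:E)%E.
Proof.
move=> r0.
have dF (x : R) : is_derive x 1 (fun t : R => r * sin t) (r * cos x).
  by apply: is_derive_eq; rewrite /GRing.scale /=; ring.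
have F'E : derive1 (fun t : R => r * sin t) = (fun x : R => r * cos x).
  by apply/funext => x; rewrite derive1E; case: (dF x).
have cF : continuous (fun t : R => r * sin t).
  by move=> x; apply/differentiable_continuous/derivable1_diffP; case: (dF x).
have cF' : continuous (fun t : R => r * cos t).
  by move=> x; apply: cvgM; [exact: cvg_cst|exact: continuous_cos].
have p2 : - (pi / 2) <= pi / 2 :> R by have := pi_gt0 R; lra.
have := @integration_by_substitution_increasing R (fun t => r * sin t)
   (fun x => 2 * Num.sqrt (r ^+ 2 - x ^+ 2)) (- (pi / 2)) (pi / 2) p2.
rewrite sinN sin_pihalf mulr1 mulrN1 F'E => ->.
(* Substituting x = r sin t, with a nonnegative cosine on the interval, turns the integrand into 2
   r^2 cos^2 t, of which [H] is a primitive. *)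
- pose H (t : R) := r ^+ 2 * (t + sin t * cos t).
  pose h (t : R) := 2 * r ^+ 2 * cos t ^+ 2.
  have dH (t : R) : is_derive t 1 H (h t).
    apply: is_derive_eq; rewrite /GRing.scale /= /h.
    transitivity (r ^+ 2 * (1 - sin t ^+ 2 + cos t ^+ 2)); first by ring.
    by rewrite sin2cos2; ring.
  have ch : continuous h.
    move=> x; apply: cvgM; first exact: cvg_cst.
    by apply: cvgM; exact: continuous_cos.
  transitivity ((H (pi / 2))%:E - (H (- (pi / 2)))%:E)%E; last first.
    by rewrite /H sinN cosN cos_pihalf -EFinB; congr EFin; field.
  have := @Rintegral_FTC R (- (pi / 2)) (pi / 2) h H p2 ch dH.
  have ih : mu.-integrable `[(- (pi / 2)), (pi / 2)] (EFin \o h).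
    apply: continuous_compact_integrable; first exact: segment_compact.
    exact: continuous_subspaceT.
  rewrite /Rintegral -EFinB => <-; rewrite fineK; last exact: integrable_fin_num.
  apply: eq_integral => x; rewrite inE /= in_itv /= => hx.
  have cx : 0 <= cos x by exact: cos_ge0_pihalf.
  rewrite /h fctE /=; congr EFin.
  rewrite (_ : r ^+ 2 - _ = (r * cos x) ^+ 2).
    by rewrite sqrtr_sqr ger0_norm ?mulr_ge0 ?(ltW r0)//; ring.
  by rewrite !exprMn sin2cos2; ring.
- by move=> x y hx hy xy; rewrite ltr_pM2l// ltr_sin.
- by move=> x _; exact: cF'.
- apply/cvg_ex; exists (r * cos (- (pi / 2))); apply: cvg_at_right_filter; exact: cF'.
- apply/cvg_ex; exists (r * cos (pi / 2)); apply: cvg_at_left_filter; exact: cF'.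
- split => [x _||]; first by case: (dF x).
    by apply: cvg_at_right_filter; exact: cF.
  by apply: cvg_at_left_filter; exact: cF.
- apply: continuous_subspaceT => x; apply: cvgM; first exact: cvg_cst.
  apply: (@continuous_comp _ _ _ (fun x : R => r ^+ 2 - x ^+ 2) (@Num.sqrt R)); last exact: sqrt_continuous.
  by apply: cvgB; [exact: cvg_cst|exact: exprn_continuous].
Qed.

Lemma area_disk (r : R) : 0 <= r ->
  area [set p : plane | cabs (of_xy p) < r] = (pi * r ^+ 2)%:E.
Proof.
rewrite le_eqVlt => /predU1P[<-|r0].
  rewrite (_ : [set p | _] = set0) ?measure0 ?expr0n ?mulr0//.
  by apply/seteqP; split => p // h; have := cabs_ge0 (of_xy p); rewrite leNgt h.
rewrite -integral_half_circle// integral_mkcond /area /product_measure1.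
apply: eq_integral => x _ /=.
(* Since [Num.sqrt] is 0 on negative numbers, ]-w, w[ is the section for every [x], including those
   beyond the radius. *)
pose w : R := Num.sqrt (r ^+ 2 - x ^+ 2).
have w0 : 0 <= w by exact: sqrtr_ge0.
have -> : xsection [set p : plane | cabs (of_xy p) < r] x = `](- w), w[%classic.
  apply/seteqP; split => y; rewrite xsectionE /preimage /mkset /= in_itv /= -ltr_norml.
    rewrite -sqrtr_sqr /of_xy /ReC /ImC /= -[X in _ < X](ger0_norm (ltW r0)) -sqrtr_sqr.
    rewrite ltr_sqrt ?exprn_gt0// => h; rewrite ltr_sqrt; first by rewrite ltrBrDl.
    by rewrite subr_gt0 (le_lt_trans _ h)// lerDl sqr_ge0.
  rewrite -sqrtr_sqr /of_xy /ReC /ImC /= => h.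
  rewrite -[X in _ < X](ger0_norm (ltW r0)) -sqrtr_sqr ltr_sqrt ?exprn_gt0//.
  rewrite -ltrBrDl; move: h; rewrite /w.
  have [rx|rx] := leP (r ^+ 2 - x ^+ 2) 0.
    by rewrite (ler0_sqrtr rx) ltNge sqrtr_ge0.
  by rewrite ltr_sqrt.
rewrite patchE; case: ifPn => [|/negP] xr.
  rewrite lebesgue_measure_itv /= lte_fin -/w.
  case: ltP => ww; first by rewrite -EFinB; congr EFin; ring.
  by congr EFin; lra.
have -> : w = 0.
  apply/ler0_sqrtr; rewrite subr_le0 -[leLHS]real_normK ?num_real// -[leRHS]real_normK ?num_real//.
  rewrite ler_sqr ?nnegrE// (ger0_norm (ltW r0)) leNgt; apply/negP => h; apply: xr.
  by rewrite inE /= in_itv /= -ler_norml ltW.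
by rewrite set_itv_ge ?measure0// bnd_simp oppr0 ltxx.
Qed.

Lemma dA_disk (r : R) : 0 <= r ->
  dA [set p : plane | cabs (of_xy p) < r] = (r ^+ 2)%:E.
Proof.
move=> r0; transitivity (pi^-1%:E * area [set p : plane | (cabs (of_xy p) < r)%R])%E.
  by [].
rewrite area_disk// -EFinM.
by rewrite mulrA mulVf ?mul1r// gt_eqF// pi_gt0.
Qed.

Lemma disk_xy_cabs : disk_xy = [set p : plane | cabs (of_xy p) < 1].
Proof. by apply/seteqP; split => p /= /disk_xyE. Qed.

Lemma dA_unit_disk : dA (disk_xy : set plane) = 1%E.
Proof. by rewrite disk_xy_cabs dA_disk// expr1n. Qed.

Lemma dA_disk_lty : (dA (disk_xy : set plane) < +oo)%E.
Proof. by rewrite dA_unit_disk ltry. Qed.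

Lemma measurable_cabs2 (rho : R) :
  measurable_fun [set: plane] (fun p : plane => rho * cabs (of_xy p) ^+ 2 : T1).
Proof.
apply: measurable_funM; first exact: measurable_cst.
exact/measurable_funX/measurable_cabs/measurable_of_xy.
Qed.

(* The measure structure of [pushforward] depends on a proof of measurability,
   which cannot be inferred: hence the explicit canonical instance. *)
Let squared_modulus_law (rho : R) (rho0 : 0 < rho) : {measure set T1 -> \bar R} :=
  mscale (NngNum (ltW rho0))
  (measure_function_pushforward__canonical__measure_function_Measure dA (measurable_cabs2 rho)).

(** A disk of radius r has normalized area r^2, so {rho |x|^2 < m} has measure m / rho. This gives
    agreement on rays, which are stable under intersection and generate the Borel sets. *)
Let squared_modulus_lawE (rho : R) (rho0 : 0 < rho) (A : set T1) : measurable A -> A `<=` `[0, rho[%classic ->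
  squared_modulus_law rho0 A = mu A.
Proof.
move=> mA AD; have mD : measurable (`[0, rho[%classic : set T1) by exact: measurable_itv.
have -> : A = A `&` `[0, rho[%classic by rewrite setIidl.
(* Restriction to [0, rho[ makes the rays, which have infinite Lebesgue measure, sets of finite
   measure, as the uniqueness theorem requires. *)
pose m1 := mrestr (squared_modulus_law rho0) mD.
pose m2 := mrestr mu mD.
suff : m1 A = m2 A by [].
have law (x : R) : m1 `]-oo, x[%classic = m2 `]-oo, x[%classic.
  pose phi (p : plane) := (rho * cabs (of_xy p) ^+ 2 : T1).
  transitivity (rho%:E * dA (phi @^-1` (`]-oo, x[ `&` `[0%R, rho[)))%E; first by [].
  transitivity (mu (`]-oo, x[ `&` `[0%R, rho[)); last by [].
  have [x0|x0] := leP x 0.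
    rewrite (_ : _ `&` _ = set0) ?preimage_set0 ?measure0 ?mule0//.
    by apply/seteqP; split => // y /=; rewrite !in_itv /=; lra.
  pose m := Num.min x rho.
  have m0 : 0 < m by rewrite lt_min x0.
  rewrite (_ : _ `&` _ = `[0, m[%classic); last first.
    apply/seteqP; split => y /=; rewrite !in_itv /= /m lt_min.
      by move=> [-> /andP[-> ->]].
    by move=> /and3P[-> -> ->].
  rewrite lebesgue_measure_itv /= lte_fin m0 -EFinB subr0.
  rewrite (_ : _ @^-1` _ = [set p : plane | cabs (of_xy p) < Num.sqrt (m / rho)]).
    rewrite dA_disk ?sqrtr_ge0// sqr_sqrtr ?divr_ge0 ?ltW// -EFinM.
    by congr EFin; rewrite mulrCA divff ?mulr1// gt_eqF.
  apply/seteqP; split => p; rewrite /preimage /mkset in_itv /= /phi.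
    move=> /andP[_]; rewrite mulrC -ltr_pdivlMr// => h.
    by rewrite -[ltLHS]ger0_norm ?cabs_ge0// -sqrtr_sqr ltr_sqrt// divr_gt0.
  move=> h; rewrite mulr_ge0 ?sqr_ge0 ?ltW//= mulrC -ltr_pdivlMr//.
  by move: h; rewrite -[ltLHS]ger0_norm ?cabs_ge0// -sqrtr_sqr ltr_sqrt// divr_gt0.
pose G := [set B : set T1 | exists x : R, B = `]-oo, x[%classic].
pose g (n : nat) : set T1 := `]-oo, n%:R[%classic.
have mG : measurable = <<s G >> by exact: RGenInftyO.measurableE.
have GI : setI_closed G.
  move=> _ _ [x ->] [y ->]; exists (Num.min x y).
  by apply/seteqP; split => z /=; rewrite !in_itv /= lt_min; [move=> [-> ->]|move=> /andP[]].
have Gg n : G (g n) by exists n%:R.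
have gT : \bigcup_k (g k) = setT.
  apply/seteqP; split => // x _; exists (Num.truncn `|x|).+1 => //=.
  by rewrite /g /= in_itv /= (le_lt_trans (ler_norm x))// truncnS_gt.
have m12 B : G B -> m1 B = m2 B by move=> [x ->]; exact: law.
have m1fin n : (m1 (g n) < +oo)%E.
  rewrite m12// /m2 /mrestr.
  apply: (@le_lt_trans _ _ (mu `[0, rho]%classic)); last exact: lebesgue_segment_lty.
  apply: le_measure; rewrite ?inE.
  - by apply: measurableI => //; exact: measurable_itv.
  - exact: measurable_itv.
  - by move=> y /= [_]; rewrite !in_itv /= => /andP[-> /ltW].
exact: (measure_unique G g mG GI Gg gT m1 m2 m12 m1fin A mA).
Qed.

Lemma Rintegral_squared_modulus (rho : R) (f : R -> R) : 0 < rho ->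
  mu.-integrable `[0, rho]%classic (EFin \o f) ->
  dA.-integrable disk_xy (EFin \o (fun p => f (rho * cabs (of_xy p) ^+ 2))) /\
  rho * \int[dA]_(p in disk_xy) f (rho * cabs (of_xy p) ^+ 2) = \int[mu]_(s in `[0, rho]) f s.
Proof.
move=> rho0 intf; pose D : set T1 := `[0, rho[%classic.
have mD : measurable D by exact: measurable_itv.
pose phi (p : plane) := (rho * cabs (of_xy p) ^+ 2 : T1).
have intfD : mu.-integrable D (EFin \o f).
  apply: integrableS intf => // x; rewrite /D /= !in_itv /= => /andP[-> /ltW].
  by [].
have phiD : phi @^-1` D = disk_xy.
  rewrite disk_xy_cabs; apply/seteqP; split => p; rewrite /preimage /mkset /D /= in_itv /= /phi.
    move=> /andP[_]; rewrite -[ltRHS]mulr1 ltr_pM2l// -[X in _ < X](expr1n R 2).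
    by rewrite ltr_pXn2r ?nnegrE ?cabs_ge0.
  move=> h; rewrite mulr_ge0 ?sqr_ge0 ?(ltW rho0)//= -[ltRHS]mulr1 ltr_pM2l//.
  by rewrite expr_lt1 ?cabs_ge0.
rewrite -Rintegral_itv_bndo_bndc//.
(* The pushforward formula asks for a function measurable on the whole line, hence the extension by
   zero. *)
pose f0 := f \_ D.
have if0 : mu.-integrable setT (EFin \o f0).
  by rewrite -restrict_EFin; apply/integrable_restrict => //; rewrite setTI.
have mf0 : measurable_fun setT (EFin \o f0) := measurable_int _ if0.
have ff0 s : s \in D -> f0 s = f s by move=> sD; rewrite /f0 patchE sD.
have lawE (f' : R -> \bar R) : (\int[squared_modulus_law rho0]_(s in D) f' s =
    \int[mu]_(s in D) f' s)%E.
  by apply: eq_measure_integral => A mA AD; exact: squared_modulus_lawE.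
pose law := measure_function_pushforward__canonical__measure_function_Measure dA (measurable_cabs2 rho).
have iflaw : law.-integrable D (EFin \o f0).
  apply/(@integrable_mscale _ _ _ law (NngNum (ltW rho0))) => //=.
  apply/integrableP; split; first exact: measurable_funTS.
  rewrite lawE; have /integrableP[_] := if0; apply: le_lt_trans.
  by apply: ge0_subset_integral => //; exact: measurableT_comp.
have ifphi : dA.-integrable (phi @^-1` D) (EFin \o f0 \o phi).
  apply/integrableP; split.
    by apply: measurable_funTS; apply: (measurableT_comp mf0); exact: measurable_cabs2.
  have /integrableP[_] := iflaw; rewrite ge0_integral_pushforward//; first exact: measurable_cabs2.
  exact/measurable_funTS/measurableT_comp.
have fphi p : p \in disk_xy -> f0 (phi p) = f (phi p).
  by rewrite -phiD inE => pD; rewrite ff0// inE.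
split.
  rewrite phiD in ifphi; apply: eq_integrable ifphi; first exact: measurable_disk.
  by move=> p pD /=; rewrite fphi.
rewrite (@eq_Rintegral _ _ _ dA _ (f0 \o phi)); last by move=> p pD; rewrite /= fphi.
rewrite -phiD.
have := @integral_pushforward _ _ _ _ R phi (measurable_cabs2 rho) dA D (EFin \o f0) mf0 ifphi mD.
move=> /(congr1 fine); rewrite -/(Rintegral dA _ (f0 \o phi)) => <-.
rewrite -/(Rintegral law D f0).
rewrite -[X in X * _]/((NngNum (ltW rho0))%:num) -(Rintegral_mscale _ mD iflaw)//.
rewrite /Rintegral lawE; congr fine; apply: eq_integral => s sD; by rewrite ff0.
Qed.

End DiskArea.

(** * Square-integrable functions on the disk *)

Section DiskL2.
Context {R : realType}.
Local Notation C := (CC R).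
Local Notation T1 := (measurableTypeR R).
Local Notation plane := (T1 * T1)%type.
Local Notation mu := (@lebesgue_measure R).
Implicit Types (f g h : C -> C) (z w : C).

Let mD := @measurable_disk R.

Lemma intC_dA (D : set plane) (F : plane -> C) : measurable D ->
  intC dA D F <-> intC area D F.
Proof. by move=> m; split => -[h1 h2]; split; apply/integrable_dA. Qed.

(** Rotation invariance allows an integrand to be replaced by its means over circles. *)
Lemma cint_average f g : intC dA disk_xy (f \o of_xy) -> intC dA disk_xy (g \o of_xy) ->
  (forall z, cabs z < 1 -> intC mu `[0, 2 * pi]%classic (fun s => f (cis s * z))) ->
  (forall z, cabs z < 1 ->
     cint mu `[0, 2 * pi]%classic (fun s => f (cis s * z)) = rc (2 * pi) * g z) ->
  cint dA disk_xy (f \o of_xy) = cint dA disk_xy (g \o of_xy).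
Proof.
move=> /(intC_dA _ mD)[f1 f2] /(intC_dA _ mD)[g1 g2] fi fg.
have pi0 : 2 * pi != 0 :> R by rewrite mulf_neq0// gt_eqF// pi_gt0.
apply: C_eq; rewrite ?Re_cint ?Im_cint.
  have := @Rintegral_average R (fun p => ReC (f (of_xy p))) f1.
  have -> : \int[area]_(p in disk_xy) \int[mu]_(s in `[0, 2 * pi]) ReC (f (of_xy (rotate s p)))
      = \int[area]_(p in disk_xy) (2 * pi * ReC (g (of_xy p))).
    apply: eq_Rintegral => p; rewrite inE => /disk_xyE pD.
    under eq_Rintegral do rewrite rotateE.
    by rewrite -(Re_cint mu) fg// ReCM Im_rc mul0r subr0.
  rewrite RintegralZl// => h; rewrite !Rintegral_dA//; congr (_ * _).
  apply: (mulfI pi0); rewrite -h// => p /disk_xyE pD.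
  by have [i1 _] := fi _ pD; apply: eq_integrable i1 => // s _; rewrite /= rotateE.
have := @Rintegral_average R (fun p => ImC (f (of_xy p))) f2.
have -> : \int[area]_(p in disk_xy) \int[mu]_(s in `[0, 2 * pi]) ImC (f (of_xy (rotate s p)))
    = \int[area]_(p in disk_xy) (2 * pi * ImC (g (of_xy p))).
  apply: eq_Rintegral => p; rewrite inE => /disk_xyE pD.
  under eq_Rintegral do rewrite rotateE.
  by rewrite -(Im_cint mu) fg// ImCM Im_rc mul0r addr0.
rewrite RintegralZl// => h; rewrite !Rintegral_dA//; congr (_ * _).
apply: (mulfI pi0); rewrite -h// => p /disk_xyE pD.
by have [_ i2] := fi _ pD; apply: eq_integrable i2 => // s _; rewrite /= rotateE.
Qed.

Lemma cint_squared_modulus (rho : R) (G : R -> C) : 0 < rho ->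
  intC mu `[0, rho]%classic G ->
  intC dA disk_xy (fun p => G (rho * cabs (of_xy p) ^+ 2)) /\
  rc rho * cint dA disk_xy (fun p => G (rho * cabs (of_xy p) ^+ 2)) = cint mu `[0, rho]%classic G.
Proof.
move=> rho0 [G1 G2].
have [i1 e1] := Rintegral_squared_modulus rho0 G1.
have [i2 e2] := Rintegral_squared_modulus rho0 G2.
split; first by split.
by apply: C_eq; rewrite ?ReCM ?ImCM Re_rc Im_rc mul0r ?subr0 ?addr0 ?Re_cint ?Im_cint.
Qed.

Lemma mem_disk p : p \in (disk_xy : set plane) -> cabs (of_xy p) < 1.
Proof. by rewrite inE => /disk_xyE. Qed.

Lemma L2_mC f : L2 f -> mC disk_xy (f \o of_xy).
Proof. by case. Qed.

Lemma L2P f : L2 f <-> mC disk_xy (f \o of_xy) /\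
  dA.-integrable disk_xy (fun p : plane => (cabs (f (of_xy p)) ^+ 2)%:E).
Proof.
have ge0 p : `|(cabs (f (of_xy p)) ^+ 2)%:E|%E = (cabs (f (of_xy p)) ^+ 2)%:E.
  by rewrite gee0_abs// lee_fin sqr_ge0.
split=> [[h1 h2 h3]|[[h1 h2] /integrableP[_ h3]]]; last first.
  split => //; apply: le_lt_trans h3.
  by under [leRHS]eq_integral do rewrite ge0.
split; first by split.
apply/integrableP; split.
  by apply/measurable_EFinP/measurable_funX/measurable_cabs; split.
by under eq_integral do rewrite ge0.
Qed.

Lemma L2_int f : L2 f -> dA.-integrable disk_xy (EFin \o (fun p : plane => cabs (f (of_xy p)) ^+ 2)).
Proof. by case/L2P. Qed.

Lemma L2_dominated f (h : plane -> R) : mC disk_xy (f \o of_xy) ->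
  dA.-integrable disk_xy (EFin \o h) ->
  (forall p, disk_xy p -> cabs (f (of_xy p)) ^+ 2 <= h p) -> L2 f.
Proof.
move=> mf ih le; apply/L2P; split => //; apply: le_integrable ih => //.
  by apply/measurable_EFinP/measurable_funX/measurable_cabs.
move=> p Dp /=; rewrite lee_fin ger0_norm ?sqr_ge0// (le_trans (le _ Dp))//.
exact: ler_norm.
Qed.

Lemma L2_bounded f (B : R) : mC disk_xy (f \o of_xy) ->
  (forall z, cabs z < 1 -> cabs (f z) <= B) -> L2 f.
Proof.
move=> mf fB; apply: (@L2_dominated _ (fun=> B ^+ 2)) => //.
  by apply: integrable_cst_fin => //; exact: dA_disk_lty.
move=> p /disk_xyE pD; have := fB _ pD => h.
by rewrite ler_pXn2r ?nnegrE ?cabs_ge0// (le_trans _ h) ?cabs_ge0.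
Qed.

Lemma L2D f g : L2 f -> L2 g -> L2 (fun z => f z + g z).
Proof.
move=> hf hg; have [mf mg] := (L2_mC hf, L2_mC hg).
apply: (@L2_dominated _ (fun p => 2 * (cabs (f (of_xy p)) ^+ 2) + 2 * (cabs (g (of_xy p)) ^+ 2))).
- exact: mCD mf mg.
- have := integrableD mD (integrableZl mD 2 (L2_int hf)) (integrableZl mD 2 (L2_int hg)).
  by apply: eq_integrable.
- move=> p _; have := cabsD (f (of_xy p)) (g (of_xy p)) => h.
  apply: (@le_trans _ _ ((cabs (f (of_xy p)) + cabs (g (of_xy p))) ^+ 2)).
    by rewrite ler_pXn2r ?nnegrE ?addr_ge0 ?cabs_ge0.
  by have := sqr_ge0 (cabs (f (of_xy p)) - cabs (g (of_xy p))); nra.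
Qed.

Lemma L2Z (a : C) f : L2 f -> L2 (fun z => a * f z).
Proof.
move=> hf; apply: (@L2_dominated _ (fun p => cabs a ^+ 2 * (cabs (f (of_xy p)) ^+ 2))).
- exact: mCZ (L2_mC hf).
- by have := integrableZl mD (cabs a ^+ 2) (L2_int hf); apply: eq_integrable.
- by move=> p _; rewrite cabsM exprMn.
Qed.

Lemma L2N f : L2 f -> L2 (fun z => - f z).
Proof.
move=> /(L2Z (-1)); congr L2; apply/funext => z; by rewrite mulN1r.
Qed.

Lemma L2B f g : L2 f -> L2 g -> L2 (fun z => f z - g z).
Proof. by move=> hf /L2N; exact: L2D. Qed.

Lemma L2_conjf f : L2 f -> L2 (conjf f).
Proof.
move=> hf; apply: (@L2_dominated _ (fun p => cabs (f (of_xy p)) ^+ 2)).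
- exact: mC_cc (L2_mC hf).
- exact: L2_int.
- by move=> p _; rewrite cabs_cc.
Qed.

Lemma conjfK f : conjf (conjf f) = f.
Proof. by apply/funext => z; exact: ccK. Qed.

Lemma L2_cst (a : C) : L2 (fun=> a).
Proof. by apply: (@L2_bounded _ (cabs a)) => //; exact: mC_cst. Qed.

Lemma L2_sum (I : Type) (s : seq I) (F : I -> C -> C) :
  (forall i, L2 (F i)) -> L2 (fun z => \sum_(i <- s) F i z).
Proof.
move=> h; elim: s => [|i s IH].
  have := L2_cst 0; congr L2; by apply/funext => z; rewrite big_nil.
have := L2D (h i) IH; congr L2; by apply/funext => z; rewrite big_cons.
Qed.

Lemma L2_prod_abs f g : L2 f -> L2 g ->
  dA.-integrable disk_xy (EFin \o (fun p : plane => cabs (f (of_xy p)) * cabs (g (of_xy p)))).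
Proof.
move=> hf hg; have [mf mg] := (L2_mC hf, L2_mC hg).
have := integrableD mD (L2_int hf) (L2_int hg); apply: le_integrable => //.
  by apply/measurable_EFinP/measurable_funM; apply: measurable_cabs.
move=> p _ /=; rewrite lee_fin ger0_norm ?mulr_ge0 ?cabs_ge0//.
rewrite ger0_norm ?addr_ge0 ?sqr_ge0//.
have := sqr_ge0 (cabs (f (of_xy p)) - cabs (g (of_xy p))).
have := sqr_ge0 (cabs (f (of_xy p))); have := sqr_ge0 (cabs (g (of_xy p))); nra.
Qed.

Lemma L2_prod f g : L2 f -> L2 g -> intC dA disk_xy (fun p => f (of_xy p) * g (of_xy p)).
Proof.
move=> hf hg; apply/intC_cabsP => //; split; first exact: mCM (L2_mC hf) (L2_mC hg).
have := L2_prod_abs hf hg; apply: eq_integrable => // p _ /=.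
by rewrite cabsM.
Qed.

Lemma L2_intC f : L2 f -> intC dA disk_xy (f \o of_xy).
Proof.
move=> hf; have := L2_prod hf (L2_cst 1); apply: intC_eq => // p _ /=.
by rewrite mulr1.
Qed.

Lemma L2_dotE f g : L2_dot f g = cint dA disk_xy (fun p => f (of_xy p) * cc (g (of_xy p))).
Proof. by []. Qed.

Lemma L2_dot_int f g : L2 f -> L2 g ->
  intC dA disk_xy (fun p => f (of_xy p) * cc (g (of_xy p))).
Proof. by move=> hf hg; have := L2_prod hf (L2_conjf hg). Qed.

Lemma L2_norm_ge0 f : 0 <= L2_norm f.
Proof. exact: sqrtr_ge0. Qed.

Lemma L2_norm_sqr f : L2_norm f ^+ 2 = \int[dA]_(p in disk_xy) (cabs (f (of_xy p)) ^+ 2).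
Proof. by rewrite sqr_sqrtr// Rintegral_ge0// => p _; exact: sqr_ge0. Qed.

Lemma L2_norm_dot f : L2 f -> L2_dot f f = rc (L2_norm f ^+ 2).
Proof.
move=> hf; rewrite L2_norm_sqr L2_dotE; apply: C_eq; rewrite ?Re_rc ?Im_rc ?Re_cint ?Im_cint.
  by apply: eq_Rintegral => p _; rewrite mulcc.
by under eq_Rintegral do rewrite mulcc; rewrite Rintegral_cst// mul0r.
Qed.

Lemma cauchy_schwarz f g : L2 f -> L2 g -> cabs (L2_dot f g) <= L2_norm f * L2_norm g.
Proof.
move=> hf hg; rewrite L2_dotE.
have := L2_prod_abs hf hg; set F := fun p : plane => _ => iF.
apply: (@le_trans _ _ (Rintegral dA disk_xy F)).
  rewrite (le_trans (le_cabs_cint mD (L2_dot_int hf hg)))// le_eqVlt; apply/orP; left.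
  by apply/eqP; apply: eq_Rintegral => p _; rewrite cabsM cabs_cc.
set X := Rintegral dA disk_xy F.
have X0 : 0 <= X by apply: Rintegral_ge0 => p _; rewrite mulr_ge0 ?cabs_ge0.
(* Integrate (|f| - t |g|)^2 >= 0. In general t = a / b is optimal; for b = 0 a large t makes X as
   small as desired, and for a = 0 the choice t = X / b^2 forces X = 0. *)
have key (t : R) : 2 * t * X <= L2_norm f ^+ 2 + t ^+ 2 * L2_norm g ^+ 2.
  rewrite !L2_norm_sqr -!RintegralZl//; [|exact: L2_int].
  rewrite -RintegralD//; [|exact: L2_int|]; last first.
    by have := integrableZl mD (t ^+ 2) (L2_int hg); apply: eq_integrable.
  apply: le_Rintegral => //.
  - by have := integrableZl mD (2 * t) iF; apply: eq_integrable.
  - have := integrableD mD (L2_int hf) (integrableZl mD (t ^+ 2) (L2_int hg)).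
    by apply: eq_integrable.
  - move=> p _; rewrite /F.
    have := sqr_ge0 (cabs (f (of_xy p)) - t * cabs (g (of_xy p))); nra.
have a0 := L2_norm_ge0 f; have b0 := L2_norm_ge0 g.
move: a0 b0 key; move: (L2_norm f) (L2_norm g) => a b a0 b0 key.
have [b00|bn0] := eqVneq b 0.
  rewrite b00 mulr0; apply/ler_addgt0Pr => e e0; rewrite add0r.
  have := key ((a ^+ 2 + e) / (2 * e)); rewrite b00 expr0n mulr0 addr0 => h.
  rewrite leNgt; apply/negP => eX.
  have : 2 * ((a ^+ 2 + e) / (2 * e)) * e < 2 * ((a ^+ 2 + e) / (2 * e)) * X.
    by rewrite ltr_pM2l// mulr_gt0// divr_gt0 ?mulr_gt0// ltr_wpDl ?sqr_ge0.
  have e2 : 2 * ((a ^+ 2 + e) / (2 * e)) * e = a ^+ 2 + e by field; rewrite gt_eqF.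
  by rewrite e2; lra.
have bp : 0 < b by rewrite lt_def bn0.
have [a00|an0] := eqVneq a 0.
  have := key (X / b ^+ 2); rewrite a00 expr0n add0r mul0r.
  have -> : (X / b ^+ 2) ^+ 2 * b ^+ 2 = X / b ^+ 2 * X by field.
  rewrite -mulrA (mulrA 2) => h; have : X / b ^+ 2 * X <= 0 by move: h; lra.
  by rewrite mulrAC pmulr_lle0 ?invr_gt0 ?exprn_gt0// => h2; nra.
have ap : 0 < a by rewrite lt_def an0.
have := key (a / b); rewrite (_ : (a / b) ^+ 2 * b ^+ 2 = a ^+ 2); last by field.
rewrite (_ : 2 * (a / b) * X = 2 * a * (X / b)); last by field.
move=> h; have : X / b <= a by rewrite -(ler_pM2l (mulr_gt0 (ltr0n R 2) ap)); move: h; lra.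
by rewrite ler_pdivrMr.
Qed.

(** The normalization gives the disk total mass 1, so no constant appears. *)
Lemma L2_norm_bounded f (B : R) : 0 <= B -> L2 f ->
  (forall z, cabs z < 1 -> cabs (f z) <= B) -> L2_norm f <= B.
Proof.
move=> B0 hf fB; rewrite -(@ler_pXn2r _ 2) ?nnegrE ?L2_norm_ge0//.
rewrite L2_norm_sqr -[leRHS]mulr1 -[X in _ <= _ * X]/(fine 1%E) -dA_unit_disk -Rintegral_cst//.
apply: le_Rintegral => //; first exact: L2_int.
  by apply: integrable_cst_fin => //; exact: dA_disk_lty.
by move=> p /disk_xyE pD; rewrite ler_pXn2r ?nnegrE ?cabs_ge0// fB.
Qed.

Lemma L2_dotDl f g h : L2 f -> L2 g -> L2 h ->
  L2_dot (fun z => f z + g z) h = L2_dot f h + L2_dot g h.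
Proof.
move=> hf hg hh; rewrite !L2_dotE -cintD//; try exact: L2_dot_int.
by apply: eq_cint => p _; rewrite mulrDl.
Qed.

Lemma L2_dotBl f g h : L2 f -> L2 g -> L2 h ->
  L2_dot (fun z => f z - g z) h = L2_dot f h - L2_dot g h.
Proof.
move=> hf hg hh; rewrite !L2_dotE -cintB//; try exact: L2_dot_int.
by apply: eq_cint => p _; rewrite mulrBl.
Qed.

Lemma L2_dotZl (a : C) f h : L2 f -> L2 h ->
  L2_dot (fun z => a * f z) h = a * L2_dot f h.
Proof.
move=> hf hh; rewrite !L2_dotE -cintZ//; last exact: L2_dot_int.
by apply: eq_cint => p _; rewrite mulrA.
Qed.

Lemma L2_dotC f g : L2 f -> L2 g -> L2_dot g f = cc (L2_dot f g).
Proof.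
move=> hf hg; rewrite !L2_dotE -cint_cc//; last exact: L2_dot_int.
by apply: eq_cint => p _; rewrite ccM ccK mulrC.
Qed.

Lemma L2_dot_ae f g h : L2 f -> L2 g -> L2 h -> L2_eq f g -> L2_dot f h = L2_dot g h.
Proof.
move=> hf hg hh fg; rewrite !L2_dotE.
have [i1 i2] := L2_dot_int hf hh; have [j1 j2] := L2_dot_int hg hh.
apply: C_eq; rewrite ?Re_cint ?Im_cint; congr fine; apply: ae_eq_integral => //.
- exact: measurable_int i1.
- exact: measurable_int j1.
- by apply: filterS fg => p /= h' /h' ->.
- exact: measurable_int i2.
- exact: measurable_int j2.
- by apply: filterS fg => p /= h' /h' ->.
Qed.

End DiskL2.

(** * The Bergman kernel *)

Section BergmanKernel.
Context {R : realType}.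
Local Notation C := (CC R).
Local Notation T1 := (measurableTypeR R).
Local Notation plane := (T1 * T1)%type.
Local Notation mu := (@lebesgue_measure R).
Implicit Types (f g : C -> C) (z w : C) (L : (C -> C) -> C).

Let mD := @measurable_disk R.

Definition bergman_kernel z : C -> C := fun x => szego z x ^+ 2.

(** In this form the dependence on [w] is visibly holomorphic, although the function is
    antiholomorphic in [x]. *)
Lemma conjf_szegoE w x : conjf (szego w) x = (1 - w * cc x)^-1.
Proof. by rewrite /conjf -[conjc _]/(cc _) /szego ccV ccB cc1 ccM -[conjc w]/(cc w) ccK. Qed.

Lemma cc_szego w x : cc (szego w x) = (1 - w * cc x)^-1.
Proof. exact: conjf_szegoE. Qed.

Lemma conjf_bergmanE w x : conjf (bergman_kernel w) x = (1 - w * cc x)^-1 ^+ 2.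
Proof. by rewrite /conjf -[conjc _]/(cc _) ccX -[cc _]/(conjf (szego w) x) conjf_szegoE. Qed.

Lemma one_sub_neq0 (u : C) : cabs u < 1 -> 1 - u != 0.
Proof.
move=> u1; rewrite -cabs_gt0; apply: lt_le_trans (ler_cabsB _ _).
by rewrite cabs1 subr_gt0.
Qed.

Lemma cabs_one_subV (u : C) (r : R) : cabs u <= r -> r < 1 -> cabs ((1 - u)^-1) <= (1 - r)^-1.
Proof.
move=> ur r1; have u1 := le_lt_trans ur r1.
rewrite cabsV lef_pV2 ?posrE ?subr_gt0//; last by rewrite cabs_gt0 one_sub_neq0.
by apply: le_trans (ler_cabsB _ _); rewrite cabs1 lerB.
Qed.

Lemma cabs_mul_cc (w x : C) : cabs x < 1 -> cabs (w * cc x) <= cabs w.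
Proof. by move=> x1; rewrite cabsM cabs_cc ler_piMr ?cabs_ge0 ?ltW. Qed.

Lemma mC_conjf_szego w (D : set plane) : mC D (conjf (szego w) \o of_xy).
Proof.
have : mC D (fun p : plane => (1 - w * cc (of_xy p))^-1).
  apply/mCV/mCB; first exact: mC_cst.
  exact/mCZ/mC_cc/measurable_of_xy.
by congr mC; apply/funext => p; rewrite /= conjf_szegoE.
Qed.

Lemma L2_conjf_szego w : cabs w < 1 -> L2 (conjf (szego w)).
Proof.
move=> w1; apply: (@L2_bounded _ _ (1 - cabs w)^-1); first exact: mC_conjf_szego.
by move=> x x1; rewrite conjf_szegoE cabs_one_subV// cabs_mul_cc.
Qed.

Lemma L2_szego w : cabs w < 1 -> L2 (szego w).
Proof. by move=> /L2_conjf_szego/L2_conjf; rewrite conjfK. Qed.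

Lemma cabs_conjf_bergman w x : cabs w < 1 -> cabs x < 1 ->
  cabs (conjf (bergman_kernel w) x) <= (1 - cabs w)^-1 ^+ 2.
Proof.
move=> w1 x1; rewrite conjf_bergmanE cabsX ler_pXn2r ?nnegrE ?cabs_ge0 ?invr_ge0 ?subr_ge0 ?(ltW w1)//.
by rewrite cabs_one_subV// cabs_mul_cc.
Qed.

Lemma L2_conjf_bergman w : cabs w < 1 -> L2 (conjf (bergman_kernel w)).
Proof.
move=> w1; apply: (@L2_bounded _ _ ((1 - cabs w)^-1 ^+ 2)).
  have := mCX 2 (mC_conjf_szego w disk_xy); congr mC.
  by apply/funext => p; rewrite /= conjf_bergmanE -conjf_szegoE.
by move=> x x1; exact: cabs_conjf_bergman.
Qed.

Lemma L2_bergman w : cabs w < 1 -> L2 (bergman_kernel w).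
Proof. by move=> /L2_conjf_bergman/L2_conjf; rewrite conjfK. Qed.

Lemma bergman_A2 z : cabs z < 1 -> A2 (bergman_kernel z).
Proof.
move=> z1; split; first exact: L2_bergman.
move=> x /unit_diskE x1; rewrite /bergman_kernel.
have d1 : derivable (fun x : C => (1 : C) - cc z * x) x 1.
  apply: derivableB; first exact: derivable_cst.
  by apply: derivableM; [exact: derivable_cst|exact: derivable_id].
have d2 : derivable (szego z) x 1.
  apply: derivableV => //; apply: one_sub_neq0.
  by rewrite cabsM -[conjc z]/(cc z) cabs_cc (le_lt_trans _ z1)// ler_piMr ?cabs_ge0 ?ltW.
exact: (@derivableX _ _ (szego z) 2 x 1 d2).
Qed.

(** The common form of [<T(.), g>] and of [<g, .>] with conjugated argument, so that a single
    differentiation lemma serves both variables of the symbol. *)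
Definition bounded_functional L :=
  (forall (a : C) f g, L2 f -> L2 g -> L (fun z => a * f z + g z) = a * L f + L g) /\
  exists M : R, 0 <= M /\ forall f, L2 f -> cabs (L f) <= M * L2_norm f.

Section Functional.
Variable L : (C -> C) -> C.
Hypothesis hL : bounded_functional L.

Lemma functional0 : L (fun=> 0) = 0.
Proof.
have [lin _] := hL; have := lin 1 _ _ (L2_cst 0) (L2_cst 0).
rewrite (_ : (fun z : C => _ + _) = fun=> 0); last first.
  by apply/funext => z; rewrite mulr0 addr0.
rewrite mul1r.
by move/eqP; rewrite -subr_eq0 opprD addrA subrr sub0r oppr_eq0 => /eqP.
Qed.

Lemma functionalZ (a : C) f : L2 f -> L (fun z => a * f z) = a * L f.
Proof.
move=> hf; have [lin _] := hL; have := lin a _ _ hf (L2_cst 0).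
rewrite functional0 addr0 => <-; congr L.
by apply/funext => z; rewrite addr0.
Qed.

Lemma functionalD f g : L2 f -> L2 g -> L (fun z => f z + g z) = L f + L g.
Proof.
move=> hf hg; have [lin _] := hL; have := lin 1 _ _ hf hg; rewrite mul1r => <-.
by congr L; apply/funext => z; rewrite mul1r.
Qed.

Lemma functionalB f g : L2 f -> L2 g -> L (fun z => f z - g z) = L f - L g.
Proof.
move=> hf hg; rewrite functionalD//; last exact: L2N.
congr (_ + _); rewrite -mulN1r -functionalZ//; congr L.
by apply/funext => z; rewrite mulN1r.
Qed.

Lemma functional_sum (I : Type) (s : seq I) (a : I -> C) (F : I -> C -> C) :
  (forall i, L2 (F i)) ->
  L (fun z => \sum_(i <- s) a i * F i z) = \sum_(i <- s) a i * L (F i).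
Proof.
move=> h; elim: s => [|i s IH].
  rewrite big_nil -[RHS]functional0; congr L; by apply/funext => z; rewrite big_nil.
rewrite big_cons -IH -functionalZ// -functionalD.
- by congr L; apply/funext => z; rewrite big_cons.
- exact: L2Z.
- by apply: (@L2_sum _ _ s (fun i z => a i * F i z)) => j; exact: L2Z.
Qed.

Lemma functional_bounded : exists M : R, 0 < M /\
  (forall f, L2 f -> cabs (L f) <= M * L2_norm f) /\
  (forall f (B : R), 0 <= B -> L2 f -> (forall z, cabs z < 1 -> cabs (f z) <= B) ->
    cabs (L f) <= M * B).
Proof.
have [_ [M [M0 hM]]] := hL; exists (M + 1).
have h f : L2 f -> cabs (L f) <= (M + 1) * L2_norm f.
  move=> hf; rewrite (le_trans (hM _ hf))// ler_wpM2r ?L2_norm_ge0//; lra.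
split; first by rewrite ltr_wpDl.
split => // f B B0 hf fB; rewrite (le_trans (h _ hf))// ler_wpM2l//; first by rewrite addr_ge0.
exact: L2_norm_bounded.
Qed.

(* The functional may be differentiated inside since the difference quotients
   of [w * conj (szego w)] converge uniformly on the disk. *)
Lemma functional_deriv w : cabs w < 1 ->
  derivC (fun w' => w' * L (conjf (szego w'))) w (L (conjf (bergman_kernel w))).
Proof.
move=> w1 e e0; have [M [M0 [_ hM]]] := functional_bounded.
(* Half the distance from [w] to the circle: both [w] and [h + w] then keep a distance at least [d]
   from it. *)
pose d := (1 - cabs w) / 2; have d0 : 0 < d by rewrite divr_gt0// subr_gt0.
have N0 : 0 < M + 1 by rewrite addr_gt0.
have d3 : 0 < d ^+ 3 by rewrite exprn_gt0.
exists (Num.min d (e * d ^+ 3 / (M + 1))).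
  by rewrite lt_min d0 divr_gt0// mulr_gt0.
move=> h h0; rewrite lt_min => /andP[hd he].
have wh1 : cabs (h + w) <= 1 - d.
  by rewrite (le_trans (cabsD _ _))//; move: hd; rewrite /d; lra.
have wh : cabs (h + w) < 1 by rewrite (le_lt_trans wh1)// ltrBlDr ltrDl.
have wd : cabs w <= 1 - d by rewrite /d; move: w1; lra.
have d1 : 1 - d < 1 by rewrite ltrBlDr ltrDl.
pose F x := h^-1 * ((h + w) * conjf (szego (h + w)) x - w * conjf (szego w) x)
  - conjf (bergman_kernel w) x.
have L1 := L2Z (h + w) (L2_conjf_szego wh); have L3 := L2Z w (L2_conjf_szego w1).
have hF : L2 F by apply: L2B; [apply/L2Z/L2B|exact: L2_conjf_bergman].
rewrite (_ : _ - _ = L F); last first.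
  rewrite functionalB; [|exact/L2Z/L2B|exact: L2_conjf_bergman].
  rewrite functionalZ; last exact: L2B.
  by rewrite functionalB// !functionalZ//; exact: L2_conjf_szego.
apply: le_lt_trans (_ : M * (cabs h * (d^-1 ^+ 3)) < e); last first.
  move: he; rewrite ltr_pdivlMr// => he.
  rewrite exprVn mulrCA mulrA ltr_pdivrMr// (le_lt_trans _ he)//.
  by rewrite ler_wpM2l ?cabs_ge0// lerDl.
apply: hM => //; first by rewrite mulr_ge0 ?cabs_ge0// exprn_ge0// invr_ge0 ltW.
move=> x x1; rewrite /F !conjf_szegoE conjf_bergmanE.
have n1 : 1 - (h + w) * cc x != 0.
  by apply: one_sub_neq0; apply: le_lt_trans wh; exact: cabs_mul_cc.
have n2 : 1 - w * cc x != 0.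
  by apply: one_sub_neq0; apply: le_lt_trans w1; exact: cabs_mul_cc.
(* The factor [w] in front of the Szego kernel is what makes the derivative exactly the Bergman
   kernel; the error is h times a product of three factors bounded by [d^-1]. *)
rewrite (_ : _ - _ = h * (cc x * ((1 - (h + w) * cc x)^-1 * ((1 - w * cc x)^-1) ^+ 2))); last first.
  by field; rewrite n1 n2 h0.
rewrite cabsM ler_wpM2l ?cabs_ge0// cabsM.
apply: (@le_trans _ _ (1 * d^-1 ^+ 3)); last by rewrite mul1r.
apply: ler_pM; rewrite ?cabs_ge0//; first by rewrite cabs_cc ltW.
rewrite cabsM [leRHS]exprS cabsX.
have b1 : cabs ((1 - (h + w) * cc x)^-1) <= d^-1.
  rewrite -[X in _ <= X^-1](subKr 1) cabs_one_subV// (le_trans _ wh1)//.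
  exact: cabs_mul_cc.
have b2 : cabs ((1 - w * cc x)^-1) <= d^-1.
  rewrite -[X in _ <= X^-1](subKr 1) cabs_one_subV// (le_trans _ wd)//.
  exact: cabs_mul_cc.
rewrite ler_pM ?exprn_ge0 ?cabs_ge0// ler_pXn2r ?nnegrE ?cabs_ge0// (le_trans _ b2) ?cabs_ge0//.
Qed.

End Functional.

(** Conjugating the argument makes the second slot of the inner product linear. *)
Lemma dot_functional g : L2 g -> bounded_functional (fun f => L2_dot g (conjf f)).
Proof.
move=> hg; split=> [a f1 f2 h1 h2|].
  rewrite !L2_dotE -cintZ//; last exact: L2_dot_int hg (L2_conjf h1).
  rewrite -cintD//.
  - by apply: eq_cint => p _; rewrite /conjf -!/(cc _) !ccK; ring.
  - by apply: intCZ => //; exact: L2_dot_int hg (L2_conjf h1).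
  - exact: L2_dot_int hg (L2_conjf h2).
exists (L2_norm g); split => [|f hf]; first exact: L2_norm_ge0.
rewrite (le_trans (cauchy_schwarz hg (L2_conjf hf)))//.
rewrite le_eqVlt; apply/orP; left; apply/eqP; congr (_ * _).
rewrite /L2_norm; congr Num.sqrt; apply: eq_Rintegral => p _.
by rewrite -[Normc.normc _]/(cabs (cc (f (of_xy p)))) cabs_cc.
Qed.

End BergmanKernel.

(** * The reproducing property *)

Section Reproducing.
Context {R : realType}.
Local Notation C := (CC R).
Local Notation T1 := (measurableTypeR R).
Local Notation plane := (T1 * T1)%type.
Local Notation mu := (@lebesgue_measure R).
Variable g : C -> C.
Hypothesis gA2 : A2 g.

Let mD := @measurable_disk R.
Let gL2 : L2 g. Proof. by case: gA2. Qed.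

Let gd (x : C) : cabs x < 1 -> derivable g x 1.
Proof. by move=> x1; case: gA2 => _; apply; apply/unit_diskE. Qed.

Lemma derivable_comp_scale (a x : C) : derivable g (x * a) 1 ->
  derivable (fun y : C => g (y * a)) x 1.
Proof.
move=> /derivable_derivC[l hl]; apply: (@derivC_derivable _ _ _ (l * a)) => e e0.
(* The [+ 1] covers [a = 0]. *)
have e'0 : 0 < e / (cabs a + 1) by rewrite divr_gt0// ltr_wpDl ?cabs_ge0.
have [r r0 hr] := derivC_affine hl e'0.
exists (r / (cabs a + 1)); first by rewrite divr_gt0// ltr_wpDl ?cabs_ge0.
move=> h h0; rewrite ltr_pdivlMr ?ltr_wpDl ?cabs_ge0// => hh.
have hp : 0 < cabs h by rewrite cabs_gt0.
have ha : cabs ((h + x) * a - x * a) = cabs h * cabs a.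
  by rewrite -mulrBl addrK cabsM.
have := hr ((h + x) * a); rewrite ha => H.
have {}H := H (le_lt_trans (ler_wpM2l (ltW hp) (_ : cabs a <= cabs a + 1)) hh).
have aa : cabs a <= cabs a + 1 by rewrite lerDl.
have {}H := H aa.
rewrite -(ltr_pM2l hp) -cabsM mulrBr mulrA divff// mul1r.
have -> : h * (l * a) = l * ((h + x) * a - x * a) by ring.
rewrite (le_lt_trans H)// mulrCA ltr_pM2l// mulrAC ltr_pdivrMr ?ltr_wpDl ?cabs_ge0//.
by rewrite ltr_pM2l// ltrDl.
Qed.

Lemma g_ray_cont (E : C) (s : R) : cabs E <= 1 -> 0 <= s < 1 ->
  g (E * rc t) @[t --> s] --> g (E * rc s).
Proof.
move=> E1 /andP[s0 s1].
have h : cabs (E * rc s) < 1.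
  by rewrite cabsM cabs_rc (ger0_norm s0) (le_lt_trans _ s1)// ler_piMl.
apply: (@cvg_comp _ _ _ (fun t : R => E * rc t) g _ _ _ _ (derivable_cont (gd h))).
apply: cvgM; first exact: cvg_cst.
by apply: cvg_ReImC; [exact: cvg_id|exact: cvg_cst].
Qed.

Lemma g_ray_int (E : C) (rho : R) : cabs E <= 1 -> rho < 1 ->
  intC mu `[0, rho]%classic (fun t => g (E * rc t)).
Proof.
move=> E1 r1; apply: intC_cont => s /andP[s0 sr]; apply: g_ray_cont => //.
by rewrite s0 (le_lt_trans sr).
Qed.

Lemma circle_mean (z x : C) : cabs z < 1 -> cabs x < 1 ->
  intC mu `[0, 2 * pi]%classic (fun s => g (cis s * x) * (1 - z * cc (cis s * x))^-1) /\
  cint mu `[0, 2 * pi]%classic (fun s => g (cis s * x) * (1 - z * cc (cis s * x))^-1) =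
    rc (2 * pi) * g (z * rc (cabs x ^+ 2)).
Proof.
(* On the circle through [x] the kernel becomes that of Cauchy's formula with pole [l], whose value
   [k l] is g at z |x|^2. *)
move=> z1 x1; pose k y := g (y * x); pose l := z * cc x.
have kd (y : C) : cabs y <= 1 -> derivable k y 1.
  move=> y1; apply/derivable_comp_scale/gd.
  by rewrite cabsM (le_lt_trans _ x1)// ler_piMl ?cabs_ge0.
have l1 : cabs l < 1 by rewrite (le_lt_trans (cabs_mul_cc _ _)).
have E s : g (cis s * x) * (1 - z * cc (cis s * x))^-1 = k (cis s) * (1 - l * cc (cis s))^-1.
  by rewrite /k /l ccM; congr (_ * _^-1); ring.
have cont : contC_on 0 (2 * pi) (fun s => k (cis s) * (1 - l * cc (cis s))^-1).
  move=> s _; apply: cvgM; last exact: cvg_one_sub_cisV.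
  have kc : derivable k (cis s) 1 by apply: kd; rewrite cabs_cis.
  exact: (cvg_comp (@cis R) k (@cvg_cis R s) (derivable_cont kc)).
split.
  by apply: intC_eq (intC_cont cont) => // s _; rewrite E.
transitivity (cint mu `[0, 2 * pi]%classic (fun s => k (cis s) * (1 - l * cc (cis s))^-1)).
  by apply: eq_cint => s _; rewrite E.
by rewrite circle_cauchy_formula// /k /l -mulrA [cc x * x]mulrC mulcc.
Qed.

Lemma dot_szego_radial (z : C) : cabs z < 1 ->
  L2_dot g (szego z) = cint dA disk_xy (fun p => g (z * rc (cabs (of_xy p) ^+ 2))).
Proof.
move=> z1; rewrite L2_dotE.
apply: (@cint_average _ (fun x => g x * cc (szego z x)) (fun x => g (z * rc (cabs x ^+ 2)))).
- exact: L2_dot_int gL2 (L2_szego z1).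
- pose E := z / rc (cabs z); pose rho := cabs z.
  (* At z = 0 there is no direction [E], but the radial integrand is constant. *)
  have [z0|z0] := eqVneq z 0.
    have := intC_cst mD (g 0) (@dA_disk_lty R); apply: intC_eq => // p _ /=.
    by rewrite z0 mul0r.
  have rho0 : 0 < rho by rewrite cabs_gt0.
  have rC : rc rho != 0 :> C by rewrite -cabs_gt0 cabs_rc normr_gt0 gt_eqF.
  have E1 : cabs E <= 1 by rewrite cabsM cabsV cabs_rc gtr0_norm// divff// gt_eqF.
  have [] := cint_squared_modulus rho0 (g_ray_int E1 z1).
  move=> + _; apply: intC_eq => // p _ /=.
  by rewrite rcM mulrA /E divfK.
- move=> x x1; have [] := circle_mean z1 x1.
  by move=> + _; apply: intC_eq => // s _; rewrite cc_szego.
- move=> x x1; have [_ <-] := circle_mean z1 x1.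
  by apply: eq_cint => s _; rewrite cc_szego.
Qed.

Lemma dot_szego_ray (E : C) (rho : R) : cabs E = 1 -> 0 <= rho < 1 ->
  E * rc rho * L2_dot g (szego (E * rc rho)) =
  E * cint mu `[0, rho]%classic (fun s => g (E * rc s)).
Proof.
move=> E1 /andP[]; rewrite le_eqVlt => /predU1P[<- _|rho0 rho1].
  rewrite set_itv1 rc0 mulr0 mul0r (_ : cint _ _ _ = 0) ?mulr0//.
  by apply: C_eq; rewrite ?Re_cint ?Im_cint Rintegral_set1.
have z1 : cabs (E * rc rho) < 1 by rewrite cabsM E1 mul1r cabs_rc gtr0_norm.
have E1' : cabs E <= 1 by rewrite E1.
have [_ <-] := cint_squared_modulus rho0 (g_ray_int E1' rho1).
rewrite dot_szego_radial// mulrA; congr (_ * _).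
by apply: eq_cint => p _; rewrite rcM mulrA.
Qed.

Lemma polar_decomposition (z : C) : exists2 E : C, cabs E = 1 & z = E * rc (cabs z).
Proof.
have [u u1 uz] := unimodular_rotation z.
have u0 : u != 0 by rewrite -cabs_gt0 u1.
by exists u^-1; rewrite ?cabsV ?u1 ?invr1// -uz mulrA mulVf// mul1r.
Qed.

(* Both sides are the radial derivative of [z * L2_dot g (szego z)], which is the
   primitive of [g] along the ray through [z]. *)
Lemma bergman_reproducing (z : C) : cabs z < 1 -> L2_dot g (bergman_kernel z) = g z.
Proof.
move=> z1; have [E E1 zE] := polar_decomposition z.
pose rho := cabs z; have rho0 : 0 <= rho := cabs_ge0 z.
pose Phi w := w * L2_dot g (szego w).
have dPhi : derivC Phi z (L2_dot g (bergman_kernel z)).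
  have E' : (fun w => w * L2_dot g (conjf (conjf (szego w)))) = Phi.
    by apply/funext => w; rewrite conjfK.
  by have := functional_deriv (dot_functional gL2) z1; rewrite /= E' conjfK.
apply/eqP; rewrite -subr_eq0; apply/eqP; apply: cabs0_eq.
apply/eqP; rewrite eq_le cabs_ge0 andbT; apply/ler_addgt0Pr => e e0; rewrite add0r.
have e2 : 0 < e / 2 by rewrite divr_gt0.
have [r1 r10 hr1] := dPhi _ e2.
have gc : g (E * rc t) @[t --> rho] --> g (E * rc rho).
  by apply: g_ray_cont; rewrite ?E1// rho0.
have /(cvgC_P _ _ _)/(_ _ e2)/nbhs_ballP[r2 /= r20 hr2] := gc.
(* A radial increment small enough for the difference quotient, for the continuity of [g] along the
   ray, and for staying inside the disk. *)
pose k := Num.min (Num.min (r1 / 2) (r2 / 2)) ((1 - rho) / 2).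
have k0 : 0 < k by rewrite !lt_min !divr_gt0//= subr_gt0.
have kr1 : k < r1 by rewrite !gt_min (_ : r1 / 2 < r1)//; lra.
have kr2 : k < r2 by rewrite !gt_min (_ : r2 / 2 < r2) ?orbT//; lra.
have krho : rho + k < 1.
  have r1' : 0 < 1 - rho by rewrite subr_gt0.
  have kr : k <= (1 - rho) / 2 by rewrite !ge_min lexx !orbT.
  by move: kr r1'; lra.
have kC : rc k != 0 :> C by rewrite -cabs_gt0 cabs_rc normr_gt0 gt_eqF.
have E0 : E != 0 by rewrite -cabs_gt0 E1.
have intk : intC mu `[0, (rho + k)]%classic (fun t => g (E * rc t)).
  by apply: g_ray_int; rewrite ?E1.
have intk2 : intC mu `[rho, (rho + k)]%classic (fun t => g (E * rc t)).
  apply: intCS intk => // x /=; rewrite !in_itv /= => /andP[h1 ->].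
  by rewrite (le_trans rho0).
have quot : (E * rc k)^-1 * (Phi (E * rc k + z) - Phi z) =
    (rc k)^-1 * cint mu `[rho, (rho + k)]%classic (fun t => g (E * rc t)).
  have zk : E * rc k + z = E * rc (rho + k) by rewrite rcD mulrDr -zE addrC.
  have rho01 : 0 <= rho < 1 by rewrite rho0.
  have rhok : 0 <= rho + k < 1 by rewrite krho addr_ge0// ltW.
  have PhiE : Phi z = E * cint mu `[0, rho]%classic (fun s => g (E * rc s)).
    by rewrite -dot_szego_ray// -zE.
  rewrite zk PhiE /Phi dot_szego_ray//.
  rewrite (@cint_split _ 0 rho (rho + k))//; last by rewrite lerDl ltW.
  by field; rewrite kC E0.
have := hr1 (E * rc k); rewrite mulf_neq0// => /(_ isT).
rewrite cabsM E1 mul1r cabs_rc gtr0_norm// => /(_ kr1); rewrite quot => H1.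
have H2 : cabs ((rc k)^-1 * cint mu `[rho, (rho + k)]%classic (fun t => g (E * rc t)) - g z) <= e / 2.
  have -> : (rc k)^-1 * cint mu `[rho, (rho + k)]%classic (fun t => g (E * rc t)) - g z =
    (rc k)^-1 * cint mu `[rho, (rho + k)]%classic (fun t => g (E * rc t) - g z).
    rewrite cintB//; last by apply: intC_cst => //; exact: lebesgue_segment_lty.
    rewrite mulrBr cint_segment_cst ?lerDl ?ltW// [rho + k]addrC addrK.
    by rewrite mulrC; congr (_ - _); rewrite mulrCA mulVf// mulr1.
  rewrite cabsM cabsV cabs_rc gtr0_norm// mulrC ler_pdivrMr//.
  rewrite -[X in _ <= _ * X](addrK rho) [k + rho]addrC.
  apply: le_cabs_cint_segment; first by rewrite lerDl ltW.
    by apply: intCB => //; apply: intC_cst => //; exact: lebesgue_segment_lty.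
  move=> t /andP[t1 t2]; rewrite {1}zE; apply/ltW/hr2.
  rewrite /ball /= distrC ger0_norm ?subr_ge0// ltrBlDl (le_lt_trans t2)// ltrD2l//.
rewrite cabsB (_ : g z - _ = (g z - (rc k)^-1 * cint mu `[rho, (rho + k)]%classic (fun t => g (E * rc t)))
  + ((rc k)^-1 * cint mu `[rho, (rho + k)]%classic (fun t => g (E * rc t)) - L2_dot g (bergman_kernel z))).
  by rewrite (le_trans (cabsD _ _))// (splitr e) lerD// ?(ltW H1)// cabsB.
by rewrite addrA subrK.
Qed.

End Reproducing.

(** [f - P f] is orthogonal to the kernel, which lies in [A2]; the reproducing property then applies
    to [P f]. *)
Lemma projection_reproducing (R : realType) (P : (CC R -> CC R) -> CC R -> CC R)
    (f : CC R -> CC R) (z : CC R) : orthogonal_projection A2 P -> L2 f -> cabs z < 1 ->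
  P f z = L2_dot f (bergman_kernel z).
Proof.
move=> hP hf z1; have [PA2 orth] := hP _ hf; have PL2 : L2 (P f) by case: PA2.
rewrite -(bergman_reproducing PA2 z1); apply/eqP; rewrite eq_sym -subr_eq0; apply/eqP.
rewrite -L2_dotBl//; first exact: orth (bergman_A2 z1).
exact: L2_bergman.
Qed.

(** * Bounded functionals and the projection *)

Section Truncation.
Context {R : realType}.
Local Notation C := (CC R).
Local Notation T1 := (measurableTypeR R).
Local Notation plane := (T1 * T1)%type.
Implicit Types (f g : C -> C) (z w x : C).

Let mD := @measurable_disk R.

Definition truncate (r : R) f : C -> C := fun x => if cabs x < r then f x else 0.

Lemma mC_truncate r f : mC disk_xy (f \o of_xy) -> mC disk_xy (truncate r f \o of_xy).
Proof.
move=> mf; pose A := [set p : plane | cabs (of_xy p) < r].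
have mI : measurable_fun (disk_xy : set plane) (\1_A : plane -> R).
  by apply: measurable_indic; exact: measurable_disk_cabs.
have := mCM (mC_rc mI) mf; congr mC; apply/funext => p.
rewrite /= /truncate indicE; case: ifPn => pr.
  have -> : (p \in A) = true by apply/mem_set.
  by rewrite -[rc _]/(1 : C) mul1r.
have -> : (p \in A) = false by apply/negbTE; rewrite notin_setE; exact/negP.
by rewrite -[rc _]/(0 : C) mul0r.
Qed.

Lemma cabs_truncate r f x : cabs (truncate r f x) <= cabs (f x).
Proof. by rewrite /truncate; case: ifP => // _; rewrite cabs0 cabs_ge0. Qed.

Lemma L2_truncate r f : L2 f -> L2 (truncate r f).
Proof.
move=> hf; apply: (@L2_dominated _ _ (fun p => cabs (f (of_xy p)) ^+ 2)).
- exact/mC_truncate/L2_mC.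
- exact: L2_int.
- by move=> p _; rewrite ler_pXn2r ?nnegrE ?cabs_ge0// cabs_truncate.
Qed.

Definition radius (n : nat) : R := 1 - n.+1%:R^-1.

Lemma radius_lt1 n : radius n < 1.
Proof. by rewrite /radius ltrBlDr ltrDl invr_gt0. Qed.

Lemma radius_ge0 n : 0 <= radius n.
Proof. by rewrite /radius subr_ge0 invf_le1// ler1n. Qed.

Lemma radius_nd m n : (m <= n)%N -> radius m <= radius n.
Proof. by move=> mn; rewrite lerB// lef_pV2 ?posrE// ler_nat. Qed.

Lemma lt_radius x : cabs x < 1 -> exists N, forall n, (N <= n)%N -> cabs x < radius n.
Proof.
move=> x1; exists (Num.truncn (1 - cabs x)^-1) => n Nn.
have x0 : 0 < 1 - cabs x by rewrite subr_gt0.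
rewrite /radius ltrBrDl -ltrBrDr -[ltRHS]invrK ltf_pV2 ?posrE ?invr_gt0//.
by rewrite (lt_le_trans (truncnS_gt _))// ler_nat.
Qed.

Lemma truncate_near f x : cabs x < 1 -> \forall n \near \oo, truncate (radius n) f x = f x.
Proof.
by move=> /lt_radius[N hN]; exists N => // n /hN xn; rewrite /truncate xn.
Qed.

Lemma L2_of_truncations f (M : R) : mC disk_xy (f \o of_xy) ->
  (forall n, L2 (truncate (radius n) f)) ->
  (forall n, L2_norm (truncate (radius n) f) <= M) -> L2 f.
Proof.
move=> mf tL2 tM; apply/L2P; split => //.
have M0 : 0 <= M by exact: le_trans (L2_norm_ge0 _) (tM 0%N).
have mcab : measurable_fun disk_xy (fun p : plane => (cabs (f (of_xy p)) ^+ 2)%:E).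
  by apply/measurable_EFinP/measurable_funX/measurable_cabs.
apply/integrableP; split => //.
under eq_integral do rewrite gee0_abs ?lee_fin ?sqr_ge0//.
pose G n (p : plane) := (cabs (truncate (radius n) f (of_xy p)) ^+ 2)%:E.
have mG n : measurable_fun disk_xy (G n).
  by apply/measurable_EFinP/measurable_funX/measurable_cabs/mC_truncate.
have G0 n p : disk_xy p -> (0 <= G n p)%E by rewrite lee_fin sqr_ge0.
have ndG p : disk_xy p -> {homo G^~ p : m n / (m <= n)%N >-> (m <= n)%E}.
  move=> _ m n mn; rewrite /G lee_fin ler_pXn2r ?nnegrE ?cabs_ge0//.
  rewrite /truncate; case: ifP => [h|_]; last by rewrite cabs0 cabs_ge0.
  by rewrite (lt_le_trans h (radius_nd mn)).
have limG p : disk_xy p -> limn (G^~ p) = (cabs (f (of_xy p)) ^+ 2)%:E.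
  move=> /disk_xyE pD; apply/cvg_lim => //; apply: cvg_near_cst.
  by apply: filterS (truncate_near f pD) => n; rewrite /G => ->.
rewrite (@eq_integral _ _ _ _ _ (fun p => limn (G^~ p))); last first.
  by move=> p; rewrite inE => /limG.
rewrite monotone_convergence//.
apply: (@le_lt_trans _ _ (M ^+ 2)%:E); last exact: ltry.
apply: lime_le.
  apply: ereal_nondecreasing_is_cvgn => m n mn.
  by apply: ge0_le_integral => // p Dp; first [exact: G0|exact: ndG].
apply: nearW => n.
rewrite -[leLHS]fineK; last exact: integrable_fin_num (L2_int (tL2 n)).
rewrite lee_fin -[fine _]/(\int[dA]_(p in disk_xy) _) -L2_norm_sqr.
by rewrite ler_pXn2r ?nnegrE ?L2_norm_ge0.
Qed.

(** Dominated convergence: at each point of the disk the difference is eventually zero, and it is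
    bounded by |f|. *)
Lemma truncate_cvg f : L2 f -> forall e : R, 0 < e ->
  exists n, L2_norm (fun x => f x - truncate (radius n) f x) <= e.
Proof.
move=> hf e e0.
pose D n x := f x - truncate (radius n) f x.
have DL2 n : L2 (D n) by apply: L2B => //; exact: L2_truncate.
have Dle n x : cabs (D n x) <= cabs (f x).
  by rewrite /D /truncate; case: ifP => _; rewrite ?subr0// subrr cabs0 cabs_ge0.
have := @dominated_cvg _ _ _ dA disk_xy mD (fun n p => (cabs (D n (of_xy p)) ^+ 2)%:E)
  (cst 0%E) (fun p => (cabs (f (of_xy p)) ^+ 2)%:E).
have m1 n : measurable_fun disk_xy (fun p : plane => (cabs (D n (of_xy p)) ^+ 2)%:E).
  exact: measurable_int (L2_int (DL2 n)).
have m2 p : disk_xy p -> (cabs (D n (of_xy p)) ^+ 2)%:E @[n --> \oo] --> (0%E : \bar R).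
  move=> /disk_xyE pD; apply: cvg_near_cst.
  apply: filterS (truncate_near f pD) => n h.
  by rewrite /D h subrr cabs0 expr0n.
have m3 n (p : plane) : disk_xy p ->
    (`|(cabs (D n (of_xy p)) ^+ 2)%:E| <= (cabs (f (of_xy p)) ^+ 2)%:E)%E.
  by move=> _; rewrite gee0_abs ?lee_fin ?sqr_ge0// ler_pXn2r ?nnegrE ?cabs_ge0.
move=> /(_ m1 m2 (fun _ _ => isT) (L2_int hf) m3); rewrite integral0 => H.
have /fine_cvgP[_ /cvgrPdist_le/(_ (e ^+ 2))] := H.
rewrite exprn_gt0// => /(_ isT)[n _ /(_ n (leqnn n))] /=.
rewrite sub0r normrN -[fine _]/(\int[dA]_(p in disk_xy) _) -L2_norm_sqr => h.
exists n; rewrite -(@ler_pXn2r _ 2) ?nnegrE ?L2_norm_ge0 ?(ltW e0)//.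
by rewrite (le_trans _ h)// ler_norm.
Qed.

End Truncation.

(** * The integral formula for a bounded functional *)

Section FunctionalProjection.
Context {R : realType}.
Local Notation C := (CC R).
Local Notation T1 := (measurableTypeR R).
Local Notation plane := (T1 * T1)%type.
Implicit Types (f g : C -> C) (z w x : C).

Let mD := @measurable_disk R.

Definition geom (N : nat) (u : C) : C := \sum_(i < N) u ^+ i.

(** Squaring the partial sum keeps the remainder algebraic: with v = u^N, the difference is (1 -
    u)^-2 times 1 - (1 - v)^2 = v (2 - v), and |2 - v| <= 3. *)
Lemma geom_sqr_remainder N (u : C) (r : R) : cabs u <= r -> r < 1 ->
  cabs ((1 - u)^-1 ^+ 2 - geom N u ^+ 2) <= 3 * (1 - r)^-1 ^+ 2 * r ^+ N.
Proof.
move=> ur r1; have r0 : 0 <= r := le_trans (cabs_ge0 _) ur.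
have u1 : 1 - u != 0 by apply: one_sub_neq0; exact: le_lt_trans ur r1.
have gE : geom N u = (1 - u)^-1 - u ^+ N * (1 - u)^-1.
  by apply/eqP; rewrite eq_sym subr_eq {1}(geometric_remainder N u1).
have -> : (1 - u)^-1 ^+ 2 - geom N u ^+ 2 = (1 - u)^-1 ^+ 2 * (u ^+ N * (2 - u ^+ N)).
  by rewrite gE; ring.
have b1 : cabs ((1 - u)^-1 ^+ 2) <= (1 - r)^-1 ^+ 2.
  rewrite cabsX ler_pXn2r ?nnegrE ?cabs_ge0 ?invr_ge0 ?subr_ge0 ?(ltW r1)//.
  exact: cabs_one_subV.
have b2 : cabs (u ^+ N) <= r ^+ N by rewrite cabsX lerXn2r ?nnegrE ?cabs_ge0.
have b3 : cabs (2 - u ^+ N) <= 3.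
  rewrite (le_trans (cabsD _ _))// cabsN.
  have -> : cabs (2 : C) = 2 by rewrite -[2 : C]/(1 + 1) -rc1 -rcD cabs_rc ger0_norm.
  have : r ^+ N <= 1 by rewrite exprn_ile1// ltW.
  by move: b2; lra.
rewrite cabsM (mulrC 3) -mulrA; apply: ler_pM; rewrite ?cabs_ge0//.
by rewrite cabsM mulrC ler_pM ?cabs_ge0.
Qed.

(** For [u = w * cc x] each term is a power of [w] times a power of [cc x]: this separates the
    variable of the integral from that of the functional. *)
Lemma geom_sqrE N (u : C) :
  geom N u ^+ 2 = \sum_(q : 'I_N * 'I_N) u ^+ (q.1 + q.2).
Proof.
rewrite expr2 /geom big_distrlr /= pair_big; apply: eq_bigr => q _.
by rewrite exprD.
Qed.

Lemma L2_cc_pow n : L2 (fun x => cc x ^+ n).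
Proof.
apply: (@L2_bounded _ _ 1).
  exact/mCX/mC_cc/measurable_of_xy.
by move=> x x1; rewrite cabsX cabs_cc exprn_ile1 ?cabs_ge0 ?ltW.
Qed.

Lemma L2_pow n : L2 (fun x => x ^+ n).
Proof.
apply: (@L2_bounded _ _ 1).
  exact/mCX/measurable_of_xy.
by move=> x x1; rewrite cabsX exprn_ile1 ?cabs_ge0 ?ltW.
Qed.

Variables (P : (C -> C) -> C -> C) (L : (C -> C) -> C).
Hypotheses (hP : orthogonal_projection A2 P) (hL : bounded_functional L).

Definition functional_kernel w : C := L (conjf (bergman_kernel w)).
Local Notation H := functional_kernel.

Lemma conj_op_L2 f : L2 f -> L2 (conj_op P f).
Proof.
move=> hf; apply: L2_conjf; have [[]] := hP (L2_conjf hf).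
by [].
Qed.

(** The value of [bergman_kernel x] at w is that of [conjf (bergman_kernel w)] at x, the function of
    x to which [L] is applied in [H w]. *)
Lemma conj_opE f x : L2 f -> cabs x < 1 ->
  conj_op P f x = cint dA disk_xy (fun p => f (of_xy p) * bergman_kernel x (of_xy p)).
Proof.
move=> hf x1; rewrite /conj_op /conjf -[conjc _]/(cc _).
rewrite (projection_reproducing hP (L2_conjf hf) x1).
rewrite -L2_dotC; [|exact: L2_conjf|exact: L2_bergman].
by rewrite L2_dotE; apply: eq_cint => p _; rewrite ccK mulrC.
Qed.

Lemma L2_norm_conjf f : L2_norm (conjf f) = L2_norm f.
Proof.
rewrite /L2_norm; congr Num.sqrt; apply: eq_Rintegral => p _.
by rewrite -[Normc.normc _]/(cabs (cc (f (of_xy p)))) cabs_cc.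
Qed.

(** From <h, P h> = <P h, P h> and the Cauchy-Schwarz inequality; conjugation preserves the norm. *)
Lemma conj_op_contraction f : L2 f -> L2_norm (conj_op P f) <= L2_norm f.
Proof.
move=> hf; rewrite L2_norm_conjf -[leRHS]L2_norm_conjf; move: (L2_conjf hf).
move: (conjf f) => h hh; have [PA2 orth] := hP hh; have hPh : L2 (P h) by case: PA2.
have := orth _ PA2; rewrite L2_dotBl// => /eqP; rewrite subr_eq0 => /eqP dotE.
have := cauchy_schwarz hh hPh; rewrite dotE L2_norm_dot// cabs_rc ger0_norm ?sqr_ge0//.
have [->|n0] := eqVneq (L2_norm (P h)) 0; first by rewrite L2_norm_ge0.
by rewrite expr2 ler_pM2r// lt_def n0 L2_norm_ge0.
Qed.

(** Representatives are arbitrary outside the disk; the bound, applied to a difference vanishing on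
    the disk, shows that [L] ignores those values. *)
Lemma functional_eq f g : L2 f -> L2 g -> (forall x, cabs x < 1 -> f x = g x) -> L f = L g.
Proof.
move=> hf hg fg; have [M [M0 [_ hM]]] := functional_bounded hL.
apply/eqP; rewrite -subr_eq0 -functionalB//; apply/eqP/cabs0_eq/eqP.
rewrite eq_le cabs_ge0 andbT; have := hM (fun x => f x - g x) 0 (lexx 0).
rewrite mulr0; apply; first exact: L2B.
by move=> x x1; rewrite fg// subrr cabs0.
Qed.

Let Hpoly N w : C := L (fun x => geom N (w * cc x) ^+ 2).

Let HpolyE N w : Hpoly N w =
  \sum_(q : 'I_N * 'I_N) w ^+ (q.1 + q.2) * L (fun x => cc x ^+ (q.1 + q.2)).
Proof.
rewrite -(functional_sum hL) => [|q]; last exact: L2_cc_pow.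
congr L; apply/funext => x; rewrite geom_sqrE; apply: eq_bigr => q _.
by rewrite exprMn.
Qed.

Let L2_geom N w : L2 (fun x => geom N (w * cc x) ^+ 2).
Proof.
have := @L2_sum R _ (index_enum ('I_N * 'I_N)%type)
  (fun q x => w ^+ (q.1 + q.2) * cc x ^+ (q.1 + q.2)) (fun q => L2Z _ (L2_cc_pow _)).
congr L2; apply/funext => x; rewrite geom_sqrE; apply: eq_bigr => q _.
by rewrite exprMn.
Qed.

Let H_Hpoly N w (r M : R) : 0 <= r < 1 -> 0 < M ->
  (forall f (B : R), 0 <= B -> L2 f -> (forall z, cabs z < 1 -> cabs (f z) <= B) ->
    cabs (L f) <= M * B) ->
  cabs w <= r -> cabs (H w - Hpoly N w) <= M * (3 * (1 - r)^-1 ^+ 2 * r ^+ N).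
Proof.
move=> /andP[r0 r1] M0 hM wr; have w1 := le_lt_trans wr r1.
rewrite /H /Hpoly -functionalB//; last exact: L2_conjf_bergman.
apply: hM.
- by rewrite !mulr_ge0 ?exprn_ge0 ?invr_ge0 ?subr_ge0 ?(ltW r1).
- by apply: L2B => //; exact: L2_conjf_bergman.
move=> x x1; rewrite conjf_bergmanE; apply: geom_sqr_remainder => //.
exact: le_trans (cabs_mul_cc _ x1) wr.
Qed.

Let pow_small (r c e : R) : 0 <= r < 1 -> 0 < e -> exists n, c * r ^+ n <= e.
Proof.
move=> /andP[r0 r1] e0.
have c1 : 0 < `|c| + 1 by rewrite ltr_wpDl.
have : r ^+ n @[n --> \oo] --> (0 : R) by apply: cvg_expr; rewrite ger0_norm.
move=> /cvgrPdist_le/(_ (e / (`|c| + 1))); rewrite divr_gt0// => /(_ isT) [n _ /(_ n (leqnn n))].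
rewrite sub0r normrN ger0_norm ?exprn_ge0// ler_pdivlMr// => h; exists n.
rewrite (le_trans _ h)// mulrC ler_wpM2l ?exprn_ge0//.
by rewrite (le_trans (ler_norm c))// lerDl.
Qed.

(** [H] is a pointwise limit of the polynomials [Hpoly N]. *)
Lemma mC_functional_kernel : mC disk_xy (H \o of_xy).
Proof.
have [M [M0 [_ hM]]] := functional_bounded hL.
have mpoly N : mC disk_xy (Hpoly N \o of_xy : plane -> C).
  have := @mC_sum _ _ R disk_xy _ (index_enum ('I_N * 'I_N)%type)
    (fun q (p : plane) => of_xy p ^+ (q.1 + q.2) * L (fun x => cc x ^+ (q.1 + q.2)))
    (fun q => mCM (mCX _ (measurable_of_xy _)) (mC_cst _ _)).
  by congr mC; apply/funext => p; rewrite /= HpolyE.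
have cv p : disk_xy p -> Hpoly n (of_xy p) @[n --> \oo] --> H (of_xy p).
  move=> /disk_xyE p1; apply/cvgC_P => e e0.
  have p01 : 0 <= cabs (of_xy p) < 1 by rewrite cabs_ge0.
  have := cvg_expr (_ : `|cabs (of_xy p)| < 1); rewrite ger0_norm ?cabs_ge0// => /(_ p1).
  pose c := M * (3 * (1 - cabs (of_xy p))^-1 ^+ 2).
  have c0 : 0 <= c by rewrite !mulr_ge0 ?(ltW M0) ?exprn_ge0// invr_ge0 subr_ge0 ltW.
  move=> /cvgrPdist_lt/(_ (e / (c + 1))); rewrite divr_gt0 ?ltr_wpDl// => /(_ isT).
  apply: filterS => n; rewrite sub0r normrN ger0_norm ?exprn_ge0 ?cabs_ge0// => h.
  rewrite cabsB (le_lt_trans (H_Hpoly n p01 M0 hM (lexx _)))// mulrA -/c.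
  move: h; rewrite ltr_pdivlMr ?ltr_wpDl// => h; apply: le_lt_trans h.
  by rewrite mulrC ler_wpM2l ?exprn_ge0 ?cabs_ge0// lerDl.
split.
  apply: (measurable_fun_cvg (h := fun n => ReC \o (Hpoly n \o of_xy))) => [n|p pD].
    by case: (mpoly n).
  exact: cvg_ReC (cv p pD).
apply: (measurable_fun_cvg (h := fun n => ImC \o (Hpoly n \o of_xy))) => [n|p pD].
  by case: (mpoly n).
exact: cvg_ImC (cv p pD).
Qed.

Lemma cabs_functional_kernel : exists B : R, 0 <= B /\ forall r w, cabs w <= r -> r < 1 ->
  cabs (H w) <= B * (1 - r)^-1 ^+ 2.
Proof.
have [M [M0 [_ hM]]] := functional_bounded hL.
exists M; split=> [|r w wr r1]; first exact: ltW.
have w1 := le_lt_trans wr r1.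
apply: hM; [by rewrite exprn_ge0// invr_ge0 subr_ge0 ltW|exact: L2_conjf_bergman|].
move=> x x1; rewrite (le_trans (cabs_conjf_bergman w1 x1))//.
have i0 : 0 <= (1 - cabs w)^-1 by rewrite invr_ge0 subr_ge0 ltW.
have i1 : 0 <= (1 - r)^-1 by rewrite invr_ge0 subr_ge0 ltW.
by rewrite ler_pXn2r ?nnegrE// lef_pV2 ?posrE ?subr_gt0// lerB.
Qed.

(* For [f] supported in a smaller disk, the kernel is a uniform limit of finite
   sums of products, for which both sides agree by linearity. *)
Lemma functional_projection_truncate (r : R) f : 0 <= r < 1 -> L2 f ->
  intC dA disk_xy (fun p => H (of_xy p) * truncate r f (of_xy p)) /\
  L (conj_op P (truncate r f)) = cint dA disk_xy (fun p => H (of_xy p) * truncate r f (of_xy p)).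
Proof.
move=> r01 hf0; have /andP[r0 r1] := r01.
have hf := L2_truncate r hf0; set F := truncate r f in hf *.
have Fsupp x : ~~ (cabs x < r) -> F x = 0 by rewrite /F /truncate => /negbTE ->.
have [M [M0 [_ hM]]] := functional_bounded hL.
have intF : intC dA disk_xy (F \o of_xy) := L2_intC hf.
have intHF : intC dA disk_xy (fun p => H (of_xy p) * F (of_xy p)).
  have [B [B0 hB]] := cabs_functional_kernel.
  apply: (intC_dom mD (h := fun p => B * (1 - r)^-1 ^+ 2 * cabs (F (of_xy p)))) => //.
  - exact: mCM mC_functional_kernel (L2_mC hf).
  - by have := integrableZl mD (B * (1 - r)^-1 ^+ 2) (intC_cabs mD intF); apply: eq_integrable.
  - move=> p _; rewrite cabsM; have [pr|/Fsupp ->] := boolP (cabs (of_xy p) < r).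
      by rewrite ler_wpM2r ?cabs_ge0// hB// ltW.
    by rewrite cabs0 !mulr0.
split => //.
(* The L1 norm of [F]; every error below is an integral against [F], bounded through [n1]. *)
pose n1 := Rintegral dA disk_xy (fun p => cabs (F (of_xy p))).
have n10 : 0 <= n1 by apply: Rintegral_ge0 => p _; exact: cabs_ge0.
pose K := 3 * (1 - r)^-1 ^+ 2.
have K0 : 0 <= K by rewrite mulr_ge0 ?exprn_ge0// invr_ge0 subr_ge0 ltW.
pose c N := fun q : 'I_N * 'I_N => cint dA disk_xy (fun p => of_xy p ^+ (q.1 + q.2) * F (of_xy p)).
pose S N x := \sum_(q : 'I_N * 'I_N) c N q * cc x ^+ (q.1 + q.2).
have intpow n : intC dA disk_xy (fun p : plane => of_xy p ^+ n * F (of_xy p)).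
  exact: L2_prod (L2_pow n) hf.
have SL2 N : L2 (S N).
  by apply: (@L2_sum R _ _ (fun q x => c N q * cc x ^+ (q.1 + q.2))) => q; exact/L2Z/L2_cc_pow.
have LS N : L (S N) = cint dA disk_xy (fun p => Hpoly N (of_xy p) * F (of_xy p)).
  rewrite /S (functional_sum hL) => [|q]; last exact: L2_cc_pow.
  transitivity (cint dA disk_xy (fun p => \sum_(q : 'I_N * 'I_N)
      L (fun x => cc x ^+ (q.1 + q.2)) * (of_xy p ^+ (q.1 + q.2) * F (of_xy p)))).
    rewrite cint_sum//; last by move=> q; apply: intCZ.
    by apply: eq_bigr => q _; rewrite cintZ// mulrC.
  apply: eq_cint => p _; rewrite HpolyE mulr_suml; apply: eq_bigr => q _.
  by rewrite mulrA [L _ * _]mulrC.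
have intHp N : intC dA disk_xy (fun p => Hpoly N (of_xy p) * F (of_xy p)).
  have : intC dA disk_xy (fun p => \sum_(q : 'I_N * 'I_N)
      L (fun x => cc x ^+ (q.1 + q.2)) * (of_xy p ^+ (q.1 + q.2) * F (of_xy p))).
    by apply: intC_sum => // q; exact: intCZ.
  apply: intC_eq => // p _; rewrite HpolyE mulr_suml; apply: eq_bigr => q _.
  by rewrite mulrA [L _ * _]mulrC.
have SE N x : S N x = cint dA disk_xy (fun p => F (of_xy p) * geom N (cc x * of_xy p) ^+ 2).
  transitivity (cint dA disk_xy (fun p => \sum_(q : 'I_N * 'I_N)
      cc x ^+ (q.1 + q.2) * (of_xy p ^+ (q.1 + q.2) * F (of_xy p)))).
    rewrite cint_sum//; last by move=> q; apply: intCZ.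
    by apply: eq_bigr => q _; rewrite cintZ// mulrC.
  apply: eq_cint => p _; rewrite geom_sqrE mulr_sumr; apply: eq_bigr => q _.
  by rewrite exprMn mulrA mulrC.
have intS N x : intC dA disk_xy (fun p => F (of_xy p) * geom N (cc x * of_xy p) ^+ 2).
  have : intC dA disk_xy (fun p => \sum_(q : 'I_N * 'I_N)
      cc x ^+ (q.1 + q.2) * (of_xy p ^+ (q.1 + q.2) * F (of_xy p))).
    by apply: intC_sum => // q; exact: intCZ.
  apply: intC_eq => // p _; rewrite geom_sqrE mulr_sumr; apply: eq_bigr => q _.
  by rewrite exprMn mulrA mulrC.
have bound (G : plane -> C) (B : R) : 0 <= B -> intC dA disk_xy G ->
    (forall p, disk_xy p -> cabs (G p) <= B * cabs (F (of_xy p))) ->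
    cabs (cint dA disk_xy G) <= B * n1.
  move=> B0 iG GB; rewrite (le_trans (le_cabs_cint mD iG))//.
  rewrite /n1 -RintegralZl//; last exact: intC_cabs.
  apply: le_Rintegral => //; first exact: intC_cabs.
  by have := integrableZl mD B (intC_cabs mD intF); apply: eq_integrable.
(* On the support of [F] the argument [cc x * w] of the geometric sum has modulus at most r, so the
   error is uniform in x up to the unit circle. *)
have approx N x : cabs x < 1 -> cabs (conj_op P F x - S N x) <= K * r ^+ N * n1.
  move=> x1; rewrite conj_opE// SE -cintB//; last exact: L2_prod hf (L2_bergman x1).
  apply: bound; first by rewrite mulr_ge0// exprn_ge0.
    by apply: intCB => //; exact: L2_prod hf (L2_bergman x1).
  move=> p /disk_xyE p1; rewrite -mulrBr cabsM mulrC.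
  have [pr|/Fsupp ->] := boolP (cabs (of_xy p) < r); last by rewrite cabs0 !mulr0.
  rewrite ler_wpM2r ?cabs_ge0// /bergman_kernel /szego -[conjc x]/(cc x).
  apply: geom_sqr_remainder => //; rewrite cabsM cabs_cc (le_trans _ (ltW pr))//.
  by rewrite ler_piMl ?cabs_ge0 ?ltW.
apply/eqP; rewrite -subr_eq0; apply/eqP; apply: cabs0_eq.
apply/eqP; rewrite eq_le cabs_ge0 andbT; apply/ler_addgt0Pr => e e0; rewrite add0r.
(* There are two errors of size [M * K * r ^+ N * n1]: approximating the projection inside [L], and
   approximating [H] inside the integral. *)
have [N hN] := pow_small (2 * M * K * n1) r01 e0.
rewrite (_ : _ - _ = (L (conj_op P F) - L (S N)) +
  (cint dA disk_xy (fun p => Hpoly N (of_xy p) * F (of_xy p)) -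
   cint dA disk_xy (fun p => H (of_xy p) * F (of_xy p)))); last by rewrite LS addrA subrK.
rewrite (le_trans (cabsD _ _))// (le_trans _ hN)//.
rewrite (_ : 2 * M * K * n1 * r ^+ N = M * (K * r ^+ N * n1) + M * (K * r ^+ N) * n1); last by ring.
apply: lerD.
  rewrite -functionalB//; last exact: conj_op_L2.
  have KN0 : 0 <= K * r ^+ N * n1 by rewrite mulr_ge0// mulr_ge0// exprn_ge0.
  exact: (hM _ _ KN0 (L2B (conj_op_L2 hf) (SL2 N)) (approx N)).
rewrite -cintB//; apply: bound.
- by rewrite mulr_ge0 ?(ltW M0)// mulr_ge0// exprn_ge0.
- exact: intCB.
- move=> p _; rewrite -mulrBl cabsM.
  have [pr|/Fsupp ->] := boolP (cabs (of_xy p) < r); last by rewrite cabs0 !mulr0.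
  by rewrite ler_wpM2r ?cabs_ge0// cabsB; exact: H_Hpoly (ltW pr).
Qed.

Lemma L2_functional_kernel : L2 H.
Proof.
have [M [M0 [hM _]]] := functional_bounded hL.
have [B [B0 hB]] := cabs_functional_kernel.
have rad n : 0 <= (radius n : R) < 1 by rewrite radius_ge0 radius_lt1.
have tL2 n : L2 (truncate (radius n) H).
  apply: (@L2_bounded _ _ (B * (1 - radius n)^-1 ^+ 2)); first exact: mC_truncate mC_functional_kernel.
  move=> x _; rewrite /truncate; case: ifP => [xr|_]; last first.
    by rewrite cabs0 mulr_ge0// exprn_ge0// invr_ge0 subr_ge0 ltW// radius_lt1.
  by apply: hB; [exact: ltW|exact: radius_lt1].
apply: (@L2_of_truncations R _ M) => //; first exact: mC_functional_kernel.
move=> n; pose h := truncate (radius n) H.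
(* [conjf h] already vanishes off the smaller disk, so the truncated formula applies to it
   unchanged. *)
have idem : truncate (radius n) (conjf h) = conjf h.
  apply/funext => x; rewrite /truncate /h /truncate /conjf; case: (cabs x < radius n) => //.
  by rewrite -[RHS]/(cc 0) -rc0 cc_rc.
have [_] := functional_projection_truncate (rad n) (L2_conjf (tL2 n)); rewrite -/h idem => E.
have hL2 : L2 h := tL2 n; have chL2 := L2_conjf hL2.
(* The test function conj h turns the integral into the squared norm of [h], whence |h|^2 <= M |h|
   with [M] independent of n. *)
have E2 : L (conj_op P (conjf h)) = rc (L2_norm h ^+ 2).
  rewrite E -L2_norm_dot// L2_dotE; apply: eq_cint => p _.
  rewrite /h /truncate /conjf; case: (_ < _) => //.
  by rewrite -[conjc 0]/(cc 0) -rc0 cc_rc mul0r mulr0.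
have := hM _ (conj_op_L2 chL2); rewrite E2 cabs_rc ger0_norm ?sqr_ge0// => le1.
have le2 : L2_norm h ^+ 2 <= M * L2_norm h.
  rewrite (le_trans le1)// ler_wpM2l ?(ltW M0)// -[leRHS]L2_norm_conjf.
  exact: conj_op_contraction.
have [->|n0] := eqVneq (L2_norm h) 0; first exact: ltW.
by move: le2; rewrite expr2 ler_pM2r// lt_def n0 L2_norm_ge0.
Qed.

Lemma functional_projection f : L2 f ->
  intC dA disk_xy (fun p => H (of_xy p) * f (of_xy p)) /\
  L (conj_op P f) = cint dA disk_xy (fun p => H (of_xy p) * f (of_xy p)).
Proof.
move=> hf; have HL2 := L2_functional_kernel.
split; first exact: L2_prod.
have [M [M0 [hM _]]] := functional_bounded hL.
apply/eqP; rewrite -subr_eq0; apply/eqP; apply: cabs0_eq.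
apply/eqP; rewrite eq_le cabs_ge0 andbT; apply/ler_addgt0Pr => e e0; rewrite add0r.
(* [M] controls the error in [L (conj_op P f)], and the norm of [H] the error in the integral. *)
have c0 : 0 < M + L2_norm H by rewrite ltr_wpDr ?L2_norm_ge0.
have [n hn] := truncate_cvg hf (divr_gt0 e0 c0).
have rad : 0 <= (radius n : R) < 1 by rewrite radius_ge0 radius_lt1.
pose F := truncate (radius n) f; have FL2 : L2 F := L2_truncate _ hf.
have [intF LF] := functional_projection_truncate rad hf.
pose D x := f x - F x; have DL2 : L2 D by exact: L2B.
have PD : L (conj_op P f) - L (conj_op P F) = L (conj_op P D).
  rewrite -functionalB//; try exact: conj_op_L2.
  apply: functional_eq; [by apply: L2B; exact: conj_op_L2|exact: conj_op_L2|].
  move=> x x1; rewrite !conj_opE// -cintB//; try exact: L2_prod _ (L2_bergman x1).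
  by apply: eq_cint => p _; rewrite mulrBl.
have ID : cint dA disk_xy (fun p => H (of_xy p) * F (of_xy p)) -
    cint dA disk_xy (fun p => H (of_xy p) * f (of_xy p)) = - L2_dot H (conjf D).
  rewrite L2_dotE -[RHS]cintN//; last exact: L2_dot_int HL2 (L2_conjf DL2).
  rewrite -cintB//; last exact: L2_prod.
  by apply: eq_cint => p _; rewrite /conjf -[conjc _]/(cc _) ccK /D; ring.
rewrite (_ : _ - _ = (L (conj_op P f) - L (conj_op P F)) +
  (cint dA disk_xy (fun p => H (of_xy p) * F (of_xy p)) -
   cint dA disk_xy (fun p => H (of_xy p) * f (of_xy p)))); last by rewrite LF addrA subrK.
rewrite PD ID (le_trans (cabsD _ _))// cabsN.
have b1 : cabs (L (conj_op P D)) <= M * L2_norm D.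
  rewrite (le_trans (hM _ (conj_op_L2 DL2)))// ler_wpM2l ?(ltW M0)//.
  exact: conj_op_contraction.
have b2 : cabs (L2_dot H (conjf D)) <= L2_norm H * L2_norm D.
  by rewrite (le_trans (cauchy_schwarz HL2 (L2_conjf DL2)))// L2_norm_conjf.
rewrite (le_trans (lerD b1 b2))// -mulrDl mulrC -ler_pdivlMr//.
Qed.

End FunctionalProjection.

(** * The Dirichlet symbol *)

Section DirichletSymbol.
Context {R : realType}.
Local Notation C := (CC R).
Implicit Types (f g : C -> C) (z w x : C).

(** The formulas for the symbol and its partial derivative are used only inside the disk, which is
    open; a derivative sees nothing else. *)
Lemma derivC_eq_on_disk f g z l : cabs z < 1 -> (forall x, cabs x < 1 -> f x = g x) ->
  derivC f z l -> derivC g z l.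
Proof.
move=> z1 fg df e /df[r r0 hr]; exists (Num.min r (1 - cabs z)).
  by rewrite lt_min r0 subr_gt0.
move=> h h0; rewrite lt_min => /andP[hr' hz].
rewrite -!fg//; first exact: hr.
by rewrite (le_lt_trans (cabsD _ _))// -ltrBrDr.
Qed.

Lemma derivC_scale (a : C) f z l : derivC f z l -> derivC (fun x => a * f x) z (a * l).
Proof.
move=> df e e0; have c0 : 0 < cabs a + 1 by rewrite ltr_wpDl ?cabs_ge0.
have [r r0 hr] := df (e / (cabs a + 1)) (divr_gt0 e0 c0).
exists r => // h h0 /(hr _ h0); rewrite ltr_pdivlMr// => H.
rewrite -mulrBr mulrCA -mulrBr cabsM (le_lt_trans _ H)// mulrC.
by rewrite ler_wpM2l ?cabs_ge0// lerDl.
Qed.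

Variable T : (C -> C) -> C -> C.
Hypothesis hT : bounded_linear_operator T.

Lemma operator_functional g : L2 g -> bounded_functional (fun f => L2_dot (T f) g).
Proof.
move=> hg; have [TL2 _ Tlin [M TM]] := hT; split=> [a f1 f2 h1 h2|].
  have haf : L2 (fun z => a * f1 z + f2 z) by apply: L2D => //; exact: L2Z.
  have haT : L2 (fun z => a * T f1 z + T f2 z).
    by apply: L2D; [exact/L2Z/TL2|exact: TL2].
  (* [T] is linear only up to almost everywhere equality, which the inner product does not see. *)
  rewrite (L2_dot_ae (TL2 _ haf) haT hg (Tlin a f1 f2 h1 h2)).
  rewrite L2_dotDl//; [|exact/L2Z/TL2|exact: TL2].
  by rewrite L2_dotZl//; exact: TL2.
(* The bound [M] of the operator may be negative as given, hence the absolute value. *)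
exists (`|M| * L2_norm g); split => [|f hf]; first by rewrite mulr_ge0// L2_norm_ge0.
rewrite (le_trans (cauchy_schwarz (TL2 _ hf) hg))// mulrAC ler_wpM2r ?L2_norm_ge0//.
by rewrite (le_trans (TM _ hf))// ler_wpM2r ?L2_norm_ge0// ler_norm.
Qed.

Lemma dirichlet_symbol_deriv_w z w : cabs z < 1 -> cabs w < 1 ->
  derivC (dirichlet_symbol T z) w (z * L2_dot (T (conjf (bergman_kernel w))) (szego z)).
Proof.
move=> z1 w1.
have := derivC_scale z (functional_deriv (operator_functional (L2_szego z1)) w1).
by apply: derivC_eq_on_disk => // x _; rewrite /dirichlet_symbol mulrA.
Qed.

Lemma partial_w_symbol z w : cabs z < 1 -> cabs w < 1 ->
  partial_w (dirichlet_symbol T) z w = z * L2_dot (T (conjf (bergman_kernel w))) (szego z).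
Proof. by move=> z1 w1; apply: derivC_derive1; exact: dirichlet_symbol_deriv_w. Qed.

Lemma partial_w_symbol_deriv_z z w : cabs z < 1 -> cabs w < 1 ->
  derivC (fun x => partial_w (dirichlet_symbol T) x w) z
    (L2_dot (T (conjf (bergman_kernel w))) (bergman_kernel z)).
Proof.
move=> z1 w1; have [TL2 _ _ _] := hT.
have := functional_deriv (dot_functional (TL2 _ (L2_conjf_bergman w1))) z1.
rewrite /= conjfK; apply: derivC_eq_on_disk => // x x1.
by rewrite conjfK partial_w_symbol.
Qed.

Lemma mixed_partial_symbol z w : cabs z < 1 -> cabs w < 1 ->
  partial_z (partial_w (dirichlet_symbol T)) z w =
  L2_dot (T (conjf (bergman_kernel w))) (bergman_kernel z).
Proof. by move=> z1 w1; apply: derivC_derive1; exact: partial_w_symbol_deriv_z. Qed.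

End DirichletSymbol.

Unset Implicit Arguments.

(** [derive1] and [disk_integral] return values even without a derivative or integrability, so both
    existence claims belong to the conclusion. *)
Theorem proposition2p4 (R : realType) (T P : (CC R -> CC R) -> CC R -> CC R)
    (hT : bounded_linear_operator T) (hP : orthogonal_projection A2 P) :
  let Q := dirichlet_symbol T in
  (forall z w : CC R, unit_disk z -> unit_disk w ->
     derivable (fun w' => Q z w') w 1 /\
     derivable (fun z' => partial_w Q z' w) z 1) /\
  (forall f : CC R -> CC R, L2 f -> forall z : CC R, unit_disk z ->
     disk_integrable (fun w => partial_z (partial_w Q) z w * f w) /\
     P (T (conj_op P f)) z =
       disk_integral (fun w => partial_z (partial_w Q) z w * f w)).
Proof.
move=> Q; split=> [z w /unit_diskE z1 /unit_diskE w1|f hf z /unit_diskE z1].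
  split; apply: derivC_derivable; first exact: dirichlet_symbol_deriv_w.
  exact: partial_w_symbol_deriv_z.
have [TL2 _ _ _] := hT.
have hL := operator_functional hT (L2_bergman z1).
have [intH HE] := functional_projection hP hL hf.
(* By the mixed partial formula, the kernel of this functional is the mixed partial of the symbol at
   (z, w) for w in the disk. *)
pose L g := L2_dot (T g) (bergman_kernel z).
have eqH p : p \in disk_xy -> functional_kernel L (of_xy p) * f (of_xy p) =
    partial_z (partial_w Q) z (of_xy p) * f (of_xy p).
  by move=> /mem_disk p1; rewrite mixed_partial_symbol.
split; first by apply: intC_eq intH; [exact: measurable_disk|exact: eqH].
rewrite (projection_reproducing hP (TL2 _ (conj_op_L2 hP hf)) z1) HE.
by apply: eq_cint => p /eqH.
Qed.
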